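(* Let $F_0$ be an arbitrary number field and let $F_1,F_2,F_3,\ldots$ be a sequence of field extensions of $F_0$ with $[F_i:F_0]\leq 3$ such that for each positive integer $i$ there is a prime $p_i$ with $p_i\mid \Delta_{F_i}$ and $p_i\nmid \Delta_{F_j}$ for $0\leq j<i$. Then the compositum of $F_0,F_1,F_2,F_3,\ldots$ has the Northcott property.
   Context: All fields lie in a fixed algebraic closure $\overline{\mathbb{Q}}$ of $\mathbb{Q}$. $H(\cdot)$ denotes the non-logarithmic absolute Weil height on $\overline{\mathbb{Q}}$: for $\alpha$ in a number field $F$, $H(\alpha)=\prod_v \max\{1,|\alpha|_v\}^{[F_v:\mathbb{Q}_v]/[F:\mathbb{Q}]}$, the product over all places $v$ of $F$, with $|\cdot|_v$ extending the usual absolute values of $\mathbb{Q}$. A subset $\mathcal{A}\subseteq\overline{\mathbb{Q}}$ has the Northcott property (property $(N)$) if for each positive real $X$ there are only finitely many $\alpha\in\mathcal{A}$ with $H(\alpha)\le X$. $\Delta_F$ denotes the absolute discriminant of a number field $F$; primes $p_i$ are prime numbers in $\mathbb{Z}$. *)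

(* Defs.v *)
(* MathComp / MathComp-Analysis *)
From HB Require Import structures.
From mathcomp Require Import all_boot all_order all_algebra all_field.
From mathcomp Require Import all_classical all_reals all_analysis.

Set Implicit Arguments.
Unset Strict Implicit.
Unset Printing Implicit Defensive.

Import Order.TTheory GRing.Theory Num.Theory.
Import numFieldNormedType.Exports.
Local Open Scope classical_set_scope.
Local Open Scope ring_scope.

(* A number field inside the algebraic closure [algC] of Q: a finite extension
   of Q together with its embedding (the morphism is automatically injective
   and Q-linear).  Equality of fields inside [algC] is equality of [nf_set]. *)
Record numField := NumField {
  nf_type :> fieldExtType rat;
  nf_emb : {rmorphism nf_type -> algC}
}.

Definition nf_set (F : numField) : set algC := range (nf_emb F).

(* For [nf_set K `<=` nf_set L], this says [L : K] = n; the products and sums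
   are formed in [algC]. *)
Definition has_degree (K L : numField) (n : nat) : Prop :=
  exists b : 'I_n -> L, forall y : L, exists! c : {ffun 'I_n -> K},
    nf_emb L y = \sum_(i < n) nf_emb K (c i) * nf_emb L (b i).

Definition is_subfield (S : set algC) : Prop := divring_closed (mem S).

Definition compositum (F : nat -> numField) : set algC :=
  smallest is_subfield (\bigcup_i nf_set (F i)).

Section Discriminant.
Variable L : fieldExtType rat.

Definition trace (x : L) : rat :=
  \tr (passmx.mxof (vbasis {:L}) (vbasis {:L}) (amull x)).

Definition integral_basis (e : (\dim {:L}).-tuple L) : Prop :=
  basis_of {:L} e /\
  forall x : L, integralOver (intr : int -> L) x <->
    exists z : 'I_(\dim {:L}) -> int, x = \sum_i tnth e i *~ z i.

(* An integral basis always exists, and the determinant is an integer that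
   does not depend on it; the default value 0 is never used. *)
Definition discriminant : int :=
  xget 0 [set D : int | exists2 e, integral_basis e &
    D%:~R = \det (\matrix_(i, j) trace (tnth e i * tnth e j))].

End Discriminant.

Section Height.
Variables (R : realType) (L : fieldExtType rat).

Definition absolute_value (v : L -> R) : Prop :=
  [/\ forall x, 0 <= v x, forall x, v x = 0 <-> x = 0,
      forall x y, v (x * y) = v x * v y & forall x y, v (x + y) <= v x + v y].

Definition padic_abs (p : nat) (q : rat) : R :=
  if q == 0 then 0
  else p%:R ^+ logn p `|denq q|%N / p%:R ^+ logn p `|numq q|%N.

Definition extends_usual (v : L -> R) : Prop :=
  (forall q : rat, v q%:A = `|ratr q|) \/
  (exists2 p : nat, prime p & forall q : rat, v q%:A = padic_abs p q).

(* Every place of L, as an equivalence class of nontrivial absolute values,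
   contains exactly one absolute value extending a usual one of Q; the place
   is represented by it. *)
Definition places : set (L -> R) :=
  [set v | absolute_value v /\ extends_usual v].

Definition v_null (v : L -> R) (u : nat -> L) : Prop :=
  v (u k) @[k --> \oo] --> (0 : R).

Definition v_cauchy (v : L -> R) (u : nat -> L) : Prop :=
  forall e : R, 0 < e ->
    \forall m \near \oo & n \near \oo, v (u m - u n) < e.

(* The completion L_v is the ring of Cauchy sequences modulo null sequences,
   and Q_v is the completion of Q inside it.  This says that the classes of
   b_0, ..., b_(n-1) form a basis of L_v over Q_v. *)
Definition completion_basis (v : L -> R) (n : nat) (b : 'I_n -> nat -> L) :
    Prop :=
  [/\ forall i, v_cauchy v (b i),
      forall u, v_cauchy v u -> exists2 a : 'I_n -> nat -> rat,
        forall i, v_cauchy v (fun k => (a i k)%:A) &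
        v_null v (fun k => u k - \sum_(i < n) a i k *: b i k)
    & forall a : 'I_n -> nat -> rat,
        (forall i, v_cauchy v (fun k => (a i k)%:A)) ->
        v_null v (fun k => \sum_(i < n) a i k *: b i k) ->
        forall i, v_null v (fun k => (a i k)%:A)].

(* [L_v : Q_v]; the default value 0 is never used. *)
Definition local_degree (v : L -> R) : nat :=
  xget 0%N [set n | exists b : 'I_n -> nat -> L, completion_basis v b].

(* Only finitely many factors differ from 1, as [\big_(_ \in _)] requires. *)
Definition field_height (x : L) : R :=
  \big[*%R/1]_(v \in places)
    (Num.max 1 (v x) `^ ((local_degree v)%:R / (\dim {:L})%:R)).

End Height.

(* The value does not depend on the number field F containing alpha. *)
Definition height (R : realType) (alpha : algC) : R :=
  xget 0 [set h | exists (F : numField) (x : F),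
    nf_emb F x = alpha /\ h = field_height R x].

Definition northcott (R : realType) (A : set algC) : Prop :=
  forall X : R, 0 < X -> finite_set [set alpha | A alpha /\ height R alpha <= X].

(* Main.v *)
(* Let K_i be the compositum of F_0, ..., F_i and let alpha lie in K_i but not in K_(i-1).
   Its degree d over K_(i-1) is at most 3; let delta in K_(i-1) be the product of the
   differences of its conjugates over K_(i-1). Since p_i is unramified in F_0, ..., F_(i-1),
   it is unramified in K_(i-1). Since it ramifies in F_i, in a Galois extension M of Q
   containing everything some inertia element over p_i moves a conjugate of F_i, hence also,
   as d <= 3, a conjugate of alpha over K_(i-1). So a factor of delta is smaller than it need
   be at a proportion at least 1/[F_0 : Q] of the conjugates of a place over p_i, and
   unramifiedness turns this into a gain of a full factor p_i. The product formula for the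
   norm of delta then gives p_i <= (2^6 H(alpha)^12)^[F_0 : Q]. The p_i being distinct, the
   elements of bounded height of the compositum all lie in one number field K_i.
   On the side of heights only H(alpha)^[M : Q] >= \prod_u \prod_s max(1, w_u(s alpha)) is
   needed, where w_u is any place of M over the place u of Q and s runs over Gal(M/Q). *)
From HB Require Import structures.
Require Import Defs.
From mathcomp Require Import all_boot all_order all_algebra all_fingroup all_field.
From mathcomp Require Import complex.
From mathcomp Require Import all_classical all_reals all_analysis.
From mathcomp Require Import lra ring zify.
Set Implicit Arguments.
Unset Strict Implicit.
Unset Printing Implicit Defensive.
Import Order.TTheory GRing.Theory Num.Theory.
Import numFieldNormedType.Exports.
Local Open Scope classical_set_scope.
Local Open Scope ring_scope.

(** * Absolute values and places *)

(** Ramification enters only through divisibility of [discriminant] and has to become a statement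
    about absolute values of one Galois extension of Q. An unramified subfield is one with integral
    elements whose conjugates separate the identity ([splits_at]); an inertia element is one that
    moves every [w]-integral element by less than 1. The first property passes to composita, forces
    inertia to act trivially, and leaves no absolute values strictly between [p^-1] and 1. The
    degree bound 3 is used twice. A relative degree 2 or 3 is prime, so [alpha] generates over
    K_(i-1) all that F_i does; and at most one conjugate of a generator of F_i over F_0 then escapes
    the conjugates over K_(i-1). The constants count the factors of delta: there are d(d-1), at most
    6, each costing a 2 at the archimedean place; each of the d conjugates occurs in 2(d-1) of them,
    so the height gets the exponent 2d(d-1), at most 12. The proportion 1/[F_0 : Q] is that of a
    coset of Gal(M/F_0) in Gal(M/Q). *)

Lemma rmorph_ratZ (L M : fieldExtType rat) (f : {rmorphism L -> M}) (q : rat) x :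
  f (q *: x) = q *: f x.
Proof. by rewrite -[LHS]/(f (q *: x)) -mulr_algl rmorphM /= alg_num_field fmorph_rat -alg_num_field mulr_algl. Qed.

Lemma rmorph_ratA (L M : fieldExtType rat) (f : {rmorphism L -> M}) (q : rat) :
  f q%:A = q%:A.
Proof. by rewrite rmorph_ratZ rmorph1. Qed.

Section AbsoluteValues.
Variables (R : realType) (L : fieldExtType rat) (v : L -> R).
Hypothesis av : absolute_value v.

Lemma abs_ge0 x : 0 <= v x. Proof. by case: av. Qed.

Lemma absM x y : v (x * y) = v x * v y. Proof. by case: av. Qed.

Lemma abs_leD x y : v (x + y) <= v x + v y. Proof. by case: av. Qed.

Lemma abs0 : v 0 = 0. Proof. by case: av => _ v0 _ _; apply/v0. Qed.

Lemma abs_eq0 x : (v x == 0) = (x == 0).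
Proof. by case: av => _ v0 _ _; apply/eqP/eqP => /v0. Qed.

Lemma abs_gt0 x : (0 < v x) = (x != 0).
Proof. by rewrite lt_neqAle abs_ge0 andbT eq_sym abs_eq0. Qed.

Lemma abs1 : v 1 = 1.
Proof.
have n1 : v 1 != 0 by rewrite abs_eq0 oner_eq0.
by apply: (mulIf n1); rewrite -absM !mul1r.
Qed.

Lemma absX x k : v (x ^+ k) = v x ^+ k.
Proof. by elim: k => [|k IHk]; rewrite ?abs1 // !exprS absM IHk. Qed.

Lemma absN x : v (- x) = v x.
Proof.
have vN1 : v (-1) = 1.
  by apply/eqP; rewrite -(@eqrXn2 _ 2%N) ?abs_ge0 // -absX sqrrN !expr1n abs1.
by rewrite -mulN1r absM vN1 mul1r.
Qed.

Lemma absB x y : v (x - y) = v (y - x).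
Proof. by rewrite -absN opprB. Qed.

Lemma absV x : v x^-1 = (v x)^-1.
Proof.
have [->|x0] := eqVneq x 0; first by rewrite invr0 abs0 invr0.
have vx0 : v x != 0 by rewrite abs_eq0.
by apply: (mulfI vx0); rewrite -absM !divff // abs1.
Qed.

Lemma abs_prod I (r : seq I) (P : pred I) (f : I -> L) :
  v (\prod_(i <- r | P i) f i) = \prod_(i <- r | P i) v (f i).
Proof. by rewrite (big_morph v absM abs1). Qed.

Lemma abs_sum_le I (r : seq I) (P : pred I) (f : I -> L) :
  v (\sum_(i <- r | P i) f i) <= \sum_(i <- r | P i) v (f i).
Proof.
elim/big_ind2: _ => // [|x a y b le1 le2]; first by rewrite abs0.
exact: le_trans (abs_leD _ _) (lerD le1 le2).
Qed.

Lemma abs_geB x y : v x - v y <= v (x + y).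
Proof.
by rewrite lerBlDr -(absN y); apply: le_trans (abs_leD _ _); rewrite addrK.
Qed.

End AbsoluteValues.

Lemma absolute_value_comp (R : realType) (L M : fieldExtType rat) (w : M -> R)
  (f : {rmorphism L -> M}) : absolute_value w -> absolute_value (w \o f).
Proof.
move=> aw; split=> [x|x|x y|x y] /=; first exact: abs_ge0.
- split=> [/eqP|->]; last by rewrite rmorph0 abs0.
  by rewrite abs_eq0 // fmorph_eq0 => /eqP.
- by rewrite rmorphM absM.
by rewrite rmorphD abs_leD.
Qed.

(** Places of Q are indexed by [option nat], with [None] for the archimedean one; [valid_base] keeps
    only the prime indices. *)
Definition usual_abs (R : realType) (u : option nat) (q : rat) : R :=
  if u is Some p then padic_abs R p q else `|ratr q|.

Definition valid_base (u : option nat) : bool := if u is Some p then prime p else true.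

Definition place_over (R : realType) (L : fieldExtType rat) (u : option nat)
    (v : L -> R) : Prop :=
  [/\ absolute_value v, valid_base u
    & forall q : rat, v q%:A = usual_abs R u q].

Lemma placesP (R : realType) (L : fieldExtType rat) (v : L -> R) :
  places v <-> exists u, place_over u v.
Proof.
split=> [[av [vq|[p pp vq]]]|[[p|] [av pp vq]]].
- by exists None.
- by exists (Some p).
- by split=> //; right; exists p.
by split=> //; left.
Qed.

Lemma place_over_comp (R : realType) (L M : fieldExtType rat) u (w : M -> R)
  (f : {rmorphism L -> M}) : place_over u w -> place_over u (w \o f).
Proof.
case=> aw pu wq; split=> //; first exact: absolute_value_comp.
by move=> q /=; rewrite alg_num_field fmorph_rat -alg_num_field wq.
Qed.

(** * The product formula over the rationals *)

Section PadicAbsoluteValue.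
Variables (R : realType) (p : nat).
Hypothesis p_pr : prime p.

Let p0 : (0 : R) < p%:R. Proof. by rewrite ltr0n prime_gt0. Qed.
Let p1 : (1 : R) < p%:R. Proof. by rewrite ltr1n prime_gt1. Qed.
Let pn0 k : (p%:R : R) ^+ k != 0. Proof. by rewrite expf_neq0 // gt_eqF. Qed.

Lemma padic_abs_frac (a b : int) : a != 0 -> b != 0 ->
  padic_abs R p (a%:~R / b%:~R) =
  p%:R ^+ logn p `|b|%N / p%:R ^+ logn p `|a|%N.
Proof.
move=> a0 b0; pose q : rat := a%:~R / b%:~R; rewrite -/q; have q0 : q != 0.
  by rewrite mulf_neq0 ?invr_eq0 ?intr_eq0.
have e : (numq q * b = a * denq q).
  apply: (@intr_inj rat); rewrite !rmorphM /=.
  rewrite -[in RHS](divfK (_ : b%:~R != 0) (a%:~R : rat)) ?intr_eq0 //.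
  by rewrite -/q numqE; ring.
have {e} : (logn p `|numq q| + logn p `|b| = logn p `|a| + logn p `|denq q|)%N.
  by rewrite -!lognM ?absz_gt0 ?numq_eq0 ?denq_eq0 // -!abszM e.
rewrite /padic_abs (negPf q0) => e; apply/eqP.
by rewrite eqr_div ?pn0 // -!exprD addnC -e addnC.
Qed.

Lemma padic_absX k : padic_abs R p (p%:R ^+ k) = (p%:R ^+ k)^-1.
Proof.
have -> : p%:R ^+ k = (Posz (p ^ k))%:~R / 1%:~R :> rat by rewrite divr1 -natrX.
rewrite padic_abs_frac //; last by rewrite eqz_nat expn_eq0 -leqn0 leqNgt prime_gt0.
by rewrite /= logn1 expr0 mul1r pfactorK.
Qed.

Lemma padic_absXV k : padic_abs R p (p%:R ^- k) = p%:R ^+ k.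
Proof.
have -> : p%:R ^- k = 1%:~R / (Posz (p ^ k))%:~R :> rat by rewrite mul1r -natrX.
rewrite padic_abs_frac //; last by rewrite eqz_nat expn_eq0 -leqn0 leqNgt prime_gt0.
by rewrite /= logn1 expr0 divr1 pfactorK.
Qed.

Lemma padic_abs_int (z : int) : z != 0 ->
  padic_abs R p z%:~R = (p%:R ^+ logn p `|z|%N)^-1.
Proof.
move=> z0; rewrite -[_%:~R]divr1 -[1]/(1%:~R) padic_abs_frac //.
by rewrite logn1 mul1r.
Qed.

Lemma padic_abs_int_le1 (z : int) : padic_abs R p z%:~R <= 1.
Proof.
have [->|z0] := eqVneq z 0; first by rewrite /padic_abs eqxx ler01.
by rewrite padic_abs_int // invf_le1 ?exprn_gt0 // exprn_ege1 // ltW.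
Qed.

Lemma padic_abs_int_lt1 (z : int) : (padic_abs R p z%:~R < 1) = (p%:Z %| z)%Z.
Proof.
have [->|z0] := eqVneq z 0; first by rewrite /padic_abs eqxx ltr01 dvdz0.
rewrite padic_abs_int // invf_lt1 ?exprn_gt0 // dvdzE /=.
case: (posnP (logn p `|z|)) => [e|l0].
  rewrite e expr0 ltxx; apply/esym/negP => pz.
  have: (0 < logn p `|z|)%N by rewrite logn_gt0 mem_primes p_pr absz_gt0 z0.
  by rewrite e.
rewrite exprn_egt1 ?lt0n_neq0 //; apply/esym.
by move: l0; rewrite logn_gt0 mem_primes => /and3P[].
Qed.

Lemma padic_abs_ge0 q : 0 <= padic_abs R p q.
Proof.
by rewrite /padic_abs; case: ifP => // _; rewrite divr_ge0 // exprn_ge0 // ltW.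
Qed.

(** The p-adic values of Q are discrete; through traces, this is where the gain of a full factor [p]
    comes from. *)
Lemma padic_abs_lt1_le q : padic_abs R p q < 1 -> padic_abs R p q <= p%:R^-1.
Proof.
rewrite /padic_abs; case: ifP => [_ _|_]; first by rewrite invr_ge0 ltW.
set i := logn _ _; set j := logn _ _; rewrite ltr_pdivrMr ?exprn_gt0 // mul1r.
rewrite ltr_eXn2l // => ij; rewrite ler_pdivrMr ?exprn_gt0 //.
by rewrite ler_pdivlMl // -exprS ler_eXn2l.
Qed.

Lemma padic_abs_denq q : p%:R ^+ logn p `|denq q|%N <= Num.max 1 (padic_abs R p q).
Proof.
rewrite /padic_abs; have [->|q0] := eqVneq q 0.
  by rewrite logn1 expr0 le_max lexx.
case: (posnP (logn p `|denq q|)) => [->|]; first by rewrite expr0 le_max lexx.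
rewrite logn_gt0 mem_primes => /and3P[_ _ pd].
case: (posnP (logn p `|numq q|)) => [->|]; first by rewrite expr0 divr1 le_max lexx orbT.
rewrite logn_gt0 mem_primes => /and3P[_ _ pn].
have := coprime_num_den q; rewrite /coprime => /eqP g1.
by have := dvdn_gcd p `|numq q| `|denq q|; rewrite g1 pn pd dvdn1 eqn_leq leqNgt prime_gt1.
Qed.

End PadicAbsoluteValue.

Lemma prod_pfactor (S : seq nat) m : (0 < m)%N -> uniq S ->
  {subset primes m <= S} -> (\prod_(p <- S) p ^ logn p m)%N = m.
Proof.
move=> m0 uS sub; rewrite [RHS](@prod_prime_decomp m) // prime_decompE.
rewrite big_map /= (bigID (mem (primes m))) /= [X in (_ * X)%N]big1 ?muln1; last first.
  by move=> p; rewrite -logn_gt0 lt0n negbK => /eqP->.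
rewrite -big_filter; apply: perm_big; apply: uniq_perm; rewrite ?filter_uniq ?primes_uniq //.
by move=> p; rewrite mem_filter; case pm: (_ \in _) => //=; apply: sub.
Qed.

Lemma rat_product_formula (R : realType) (S : seq nat) (q : rat) : q != 0 ->
  uniq S -> all prime S -> {subset primes (`|numq q| * `|denq q|) <= S} ->
  `|ratr q : R| * \prod_(p <- S) padic_abs R p q = 1.
Proof.
move=> q0 uS prS sub.
have n0 : (0 < `|numq q|)%N by rewrite absz_gt0 numq_eq0.
have d0 : (0 < `|denq q|)%N by rewrite absz_gt0 denq_eq0.
have pE m : (0 < m)%N -> (m %| `|numq q| * `|denq q|)%N ->
    \prod_(p <- S) (p%:R ^+ logn p m) = m%:R :> R.
  move=> m0 md; rewrite -[in RHS](@prod_pfactor S m) //; last first.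
    move=> p; rewrite mem_primes => /and3P[pp _ pm]; apply: sub.
    by rewrite mem_primes pp muln_gt0 n0 d0 (dvdn_trans pm).
  by rewrite natr_prod; apply: eq_bigr => p _; rewrite natrX.
rewrite /padic_abs (negPf q0) prodf_div (pE _ n0 (dvdn_mulr _ (dvdnn _))) (pE _ d0 (dvdn_mull _ (dvdnn _))).
have d0R : `|denq q|%N%:R != 0 :> R by rewrite pnatr_eq0 -lt0n.
have n0R : `|numq q|%N%:R != 0 :> R by rewrite pnatr_eq0 -lt0n.
rewrite -{1}(divq_num_den q) fmorph_div /= !ratr_int normrM normrV ?unitfE ?intr_eq0 ?denq_eq0 //.
by rewrite -!intr_norm -!abszE -!pmulrn mulrA divfK // divff.
Qed.

Lemma denq_le_prod (R : realType) (S : seq nat) (q : rat) :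
  uniq S -> all prime S -> {subset primes `|denq q| <= S} ->
  `|denq q|%N%:R <= \prod_(p <- S) Num.max 1 (padic_abs R p q).
Proof.
move=> uS /allP prS sub; rewrite -{1}(@prod_pfactor S `|denq q|) ?absz_gt0 ?denq_eq0 //.
rewrite natr_prod !big_seq; apply: ler_prod => p pS.
by rewrite natrX exprn_ge0 ?ler0n //= padic_abs_denq // prS.
Qed.

(** In logarithmic scale the interval has length [k * (ln B - ln A)], which for large [k] exceeds
    [ln p], the gap between p-adic values. *)
Lemma usual_abs_between (R : realType) u (A B : R) : valid_base u ->
  0 < A -> A < B -> exists k c, A ^+ k < usual_abs R u c /\ usual_abs R u c < B ^+ k.
Proof.
case: u => [p|] /= up A0 AB; last first.
  have [c] := rat_in_itvoo AB; rewrite in_itv /= => /andP[Ac cB]; exists 1%N, c.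
  by rewrite !expr1 ger0_norm // ltW // (lt_trans A0).
have p1 : (1 : R) < p%:R by rewrite ltr1n prime_gt1.
have p0 : (0 : R) < p%:R by exact: lt_trans p1.
have B0 := lt_trans A0 AB.
have lnp : 0 < ln (p%:R : R) by rewrite ln_gt0.
have lnAB : 0 < ln B - ln A by rewrite subr_gt0 ltr_ln.
pose k := (Num.truncn (ln (p%:R : R) / (ln B - ln A))).+1.
have hk : ln (p%:R : R) < k%:R * (ln B - ln A).
  by rewrite -ltr_pdivrMr // /k truncnS_gt.
pose x := k%:R * ln A / ln (p%:R : R).
pose j : int := Num.floor x + 1.
have j1 : x < j%:~R by rewrite /j floorD1_gt.
have j2 : j%:~R <= x + 1 by rewrite /j rmorphD /= lerD2r floor_le.
pose c : rat := if j is Posz m then (p%:R ^- m) else p%:R ^+ `|j|%N.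
have ec : padic_abs R p c = expR (j%:~R * ln (p%:R : R)).
  rewrite /c; case: j {j1 j2 c} => m.
    by rewrite padic_absXV // -pmulrn expRM_natl lnK ?posrE.
  by rewrite padic_absX // NegzE mulrNz mulNr -pmulrn expRN expRM_natl lnK ?posrE //= abszN.
exists k, c; rewrite ec.
have eX y : 0 < y -> y ^+ k = expR (k%:R * ln y).
  by move=> y0; rewrite expRM_natl lnK ?posrE.
rewrite !eX // !ltr_expR.
split; first by rewrite -ltr_pdivrMr.
apply: le_lt_trans (_ : (x + 1) * ln p%:R < _); first by rewrite ler_pM2r.
by rewrite mulrDl /x divfK ?gt_eqF // mul1r; lra.
Qed.

(** * Approximation at several places *)

(** If [a = 1 + h] with [h > 0], Bernoulli's inequality squared makes [a ^+ (2 * k)] at least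
    quadratic in [k], which overtakes the linear bound. *)
Lemma le1_of_linear_powers (R : realType) (a : R) : 0 <= a ->
  (forall k : nat, a ^+ k <= k.+1%:R) -> a <= 1.
Proof.
move=> a0 ha; rewrite leNgt; apply/negP => a1; pose h := a - 1.
have h0 : 0 < h by rewrite subr_gt0.
pose k := (Num.truncn (2 / h ^+ 2)).+1.
have hk : 2 < k%:R * h ^+ 2 by rewrite -ltr_pdivrMr ?exprn_gt0 // truncnS_gt.
have bern m : 1 + m%:R * h <= a ^+ m.
  elim: m => [|m IHm]; first by rewrite mul0r addr0 expr0.
  rewrite exprS -(subrK 1 a) -/h -natr1.
  have : 0 <= (m%:R : R) by [].
  by move: IHm; rewrite -{1}(subrK 1 a) -/h; nra.
have := ha (2 * k)%N; rewrite mulnC exprM; apply/negP; rewrite -ltNge.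
apply: lt_le_trans (_ : (1 + k%:R * h) ^+ 2 <= _); last first.
  by rewrite ler_pXn2r ?nnegrE ?exprn_ge0 // addr_ge0 // mulr_ge0 // ltW.
rewrite -natr1 natrM sqrrD expr1n mul1r exprMn.
have k0 : (0 : R) < k%:R by rewrite ltr0n.
have : 2 * k%:R < k%:R * (k%:R * h ^+ 2) by rewrite mulrC ltr_pM2l.
have : 0 < k%:R * h by rewrite mulr_gt0.
rewrite (_ : k%:R ^+ 2 * _ = k%:R * (k%:R * h ^+ 2)); last by rewrite mulrA -expr2.
rewrite -mulr_natr; lra.
Qed.

Definition ultrametric (R : realType) (L : fieldExtType rat) (v : L -> R) :=
  forall x y, v (x + y) <= Num.max (v x) (v y).

Lemma place_over_nat (R : realType) (L : fieldExtType rat) p (v : L -> R) (n : nat) :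
  place_over (Some p) v -> v n%:R <= 1.
Proof.
case=> av pp vq; rewrite -(scaler_nat n (1 : L)) vq /=.
exact: (padic_abs_int_le1 R pp n).
Qed.

(** In the expansion of [(x + y) ^+ k] the binomial coefficients have absolute value at most 1, so
    only the number [k.+1] of terms is lost, and it disappears on taking k-th roots. *)
Lemma place_over_ultrametric (R : realType) (L : fieldExtType rat) p (v : L -> R) :
  place_over (Some p) v -> ultrametric v.
Proof.
move=> pv x y; have [av _ _] := pv; set M := Num.max _ _.
have M0 : 0 <= M by rewrite le_max abs_ge0.
have xM : v x <= M by rewrite le_max lexx.
have yM : v y <= M by rewrite le_max lexx orbT.
have pw k : v (x + y) ^+ k <= k.+1%:R * M ^+ k.
  rewrite -absX // exprDn; apply: le_trans (abs_sum_le av _ _ _) _.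
  rewrite mulr_natl -[k.+1 in leRHS]card_ord -sumr_const; apply: ler_sum => i _.
  rewrite -mulr_natr !absM // !absX //.
  rewrite -[leRHS]mulr1 ler_pM ?mulr_ge0 ?exprn_ge0 ?abs_ge0 //; last exact: place_over_nat pv.
  have -> : M ^+ k = M ^+ (k - i) * M ^+ i.
    by rewrite -exprD subnK // -ltnS.
  by rewrite ler_pM ?exprn_ge0 ?abs_ge0 // lerXn2r ?nnegrE ?abs_ge0.
move: M0; rewrite le_eqVlt => /predU1P[M0|M0].
  by have := pw 1%N; rewrite -M0 !expr1 mulr0.
rewrite -[leRHS]mul1r -ler_pdivrMr //; apply: le1_of_linear_powers.
  by rewrite divr_ge0 ?abs_ge0 // ltW.
by move=> k; rewrite expr_div_n ler_pdivrMr ?exprn_gt0.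
Qed.

Section Ultrametric.
Variables (R : realType) (L : fieldExtType rat) (v : L -> R).
Hypotheses (av : absolute_value v) (uv : ultrametric v).

Lemma ultra_sum_le I (r : seq I) (P : pred I) (f : I -> L) (B : R) : 0 <= B ->
  (forall i, P i -> v (f i) <= B) -> v (\sum_(i <- r | P i) f i) <= B.
Proof.
move=> B0 fB; elim/big_rec: _ => [|i x Pi xB]; first by rewrite abs0.
by apply: le_trans (uv _ _) _; rewrite ge_max xB fB.
Qed.

Lemma ultra_sum_lt I (r : seq I) (P : pred I) (f : I -> L) (B : R) : 0 < B ->
  (forall i, P i -> v (f i) < B) -> v (\sum_(i <- r | P i) f i) < B.
Proof.
move=> B0 fB; elim/big_rec: _ => [|i x Pi xB]; first by rewrite abs0.
by apply: le_lt_trans (uv _ _) _; rewrite gt_max xB fB.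
Qed.

Lemma ultra_leB x y : v (x - y) <= Num.max (v x) (v y).
Proof. by rewrite -(absN av y) uv. Qed.

Lemma ultra_eq x y : v x < v y -> v (x + y) = v y.
Proof.
move=> xy; apply/eqP; rewrite eq_le; apply/andP; split.
  by apply: le_trans (uv _ _) _; rewrite ge_max lexx ltW.
have := ultra_leB (x + y) x; rewrite addrC addKr le_max => /orP[//|].
by rewrite leNgt xy.
Qed.

End Ultrametric.

(** Both places give a rational the same value, so a power of [y] divided by a rational of value
    between [v y ^+ k] and [v' y ^+ k] separates them. *)
Lemma place_separate (R : realType) (L : fieldExtType rat) (E : {subfield L}) u
    (v v' : L -> R) y : place_over u v -> place_over u v' -> y \in E ->
  v y != v' y -> exists2 z, z \in E & v z < 1 /\ 1 < v' z.
Proof.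
move=> pv pv' yE; have [av pu vq] := pv; have [av' _ vq'] := pv'.
wlog lt : y yE / v y < v' y => [hw|_].
  move=> ne; have := ne; rewrite neq_lt => /orP[lt|gt].
    exact: (hw y).
  apply: (hw y^-1); rewrite ?rpredV ?absV //.
    rewrite ltf_pV2 ?posrE ?abs_gt0 //; last by rewrite -(abs_eq0 av) gt_eqF // (le_lt_trans _ gt) ?abs_ge0.
    by rewrite -(abs_eq0 av) gt_eqF // (le_lt_trans _ gt) ?abs_ge0.
  by rewrite (inj_eq invr_inj).
have y0 : y != 0 by rewrite -(abs_eq0 av') gt_eqF // (le_lt_trans _ lt) ?abs_ge0.
have vy0 : 0 < v y by rewrite abs_gt0.
have [k [c [c1 c2]]] := usual_abs_between pu vy0 lt.
have c0 : 0 < usual_abs R u c by apply: lt_trans c1; rewrite exprn_gt0.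
exists (y ^+ k / c%:A).
  by rewrite rpred_div ?rpredX // rpredZ ?mem1v.
by rewrite !absM ?absV ?absX // vq vq' ltr_pdivrMr // ltr_pdivlMr // !mul1r.
Qed.

Lemma near_expr_lt (R : realType) (a b : R) : 0 <= a -> a < 1 -> 0 < b ->
  \forall n \near \oo, a ^+ n < b.
Proof.
move=> a0 a1 b0; have := @cvg_expr R a; rewrite ger0_norm // => /(_ a1).
by move=> /cvgrPdist_lt /(_ b b0); apply: filterS => n; rewrite sub0r normrN ger0_norm ?exprn_ge0.
Qed.

Lemma near_all_seq (T : eqType) (s : seq T) (P : T -> nat -> Prop) :
  (forall x, x \in s -> \forall n \near \oo, P x n) ->
  \forall n \near \oo, forall x, x \in s -> P x n.
Proof.
elim: s => [|x s IHs] hs; first by near=> n.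
have := IHs (fun y ys => hs y (@mem_behead _ (x :: s) y ys)).
have := hs x (mem_head _ _); apply: filterS2 => n Px Ps y.
by rewrite inE => /predU1P[->|/Ps].
Unshelve. all: by end_near. Qed.

Lemma near_infty_ex (P : nat -> Prop) : (\forall n \near \oo, P n) -> exists n, P n.
Proof. by case=> n _ hn; exists n; apply: hn => /=. Qed.

(** Weak approximation, by induction on the places: [y] handles those of [vs], and [z] the new place
    [v1]. *)
Lemma artin_whaples (R : realType) (L : fieldExtType rat) (E : {subfield L})
    (v0 : L -> R) (vs : seq (L -> R)) : absolute_value v0 ->
  (exists2 y, y \in E & 1 < v0 y) ->
  (forall v, v \in vs -> absolute_value v /\
     exists2 y, y \in E & v y < 1 /\ 1 < v0 y) ->
  exists2 y, y \in E & 1 < v0 y /\ forall v, v \in vs -> v y < 1.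
Proof.
move=> av0 [x xE x1]; elim: vs => [|v1 vs IHvs] hvs; first by exists x.
have [v vvs|y yE [y1 vy]] := IHvs; first by apply: hvs; rewrite inE vvs orbT.
have [av1 [z zE [v1z z1]]] := hvs v1 (mem_head _ _).
have avs v : v \in vs -> absolute_value v.
  by move=> vvs; have [] := hvs v; rewrite ?inE ?vvs ?orbT.
(* If [v1 y <= 1], then [y ^+ n * z] works: the power is harmless at [v1], helps at [v0] and tends
   to 0 at the places of [vs]. *)
have [v1y|v1y] := leP (v1 y) 1.
  have : \forall n \near \oo, forall v, v \in vs -> v y ^+ n < (1 + v z)^-1.
    apply: near_all_seq => v vvs; have av := avs v vvs.
    by apply: near_expr_lt; rewrite ?abs_ge0 ?vy // invr_gt0 ltr_pwDl ?abs_ge0.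
  move=> /near_infty_ex[n hn]; exists (y ^+ n * z); first by rewrite rpredM ?rpredX.
  split=> [|v].
    rewrite absM // absX //; apply: lt_le_trans z1 _.
    by rewrite ler_peMl ?abs_ge0 // exprn_ege1 // ltW.
  rewrite inE => /predU1P[->|vvs].
    rewrite absM // absX //; apply: le_lt_trans v1z.
    by rewrite ler_piMl ?abs_ge0 // exprn_ile1 ?abs_ge0.
  have av := avs v vvs; rewrite absM // absX //.
  have z0 := abs_ge0 av z; have y0 := exprn_ge0 n (abs_ge0 av y).
  have : v y ^+ n * (1 + v z) < 1.
    by rewrite -ltr_pdivlMr ?mul1r ?hn // ltr_pwDl.
  by rewrite mulrDr mulr1; apply: le_lt_trans; rewrite lerDr.
have y0 : y != 0 by rewrite -(abs_gt0 av0) (lt_trans ltr01 y1).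
have h0 : \forall n \near \oo, (v0 y)^-1 ^+ n < Num.min 1 (v0 z - 1).
  by apply: near_expr_lt; rewrite ?invr_ge0 ?abs_ge0 ?invf_lt1 ?lt_min ?ltr01 ?subr_gt0 ?(lt_trans ltr01 y1).
have h1 : \forall n \near \oo, (v1 y)^-1 ^+ n < 1 - v1 z.
  by apply: near_expr_lt; rewrite ?invr_ge0 ?abs_ge0 ?invf_lt1 ?subr_gt0 ?(lt_trans ltr01 v1y).
have hs : \forall n \near \oo, forall v, v \in vs -> v y ^+ n < (1 + v z)^-1.
  apply: near_all_seq => v vvs; have av := avs v vvs.
  by apply: near_expr_lt; rewrite ?abs_ge0 ?vy // invr_gt0 ltr_pwDl ?abs_ge0.
have [n [[a0 a1] as_]] : exists n, ((v0 y)^-1 ^+ n < Num.min 1 (v0 z - 1) /\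
    (v1 y)^-1 ^+ n < 1 - v1 z) /\ forall v, v \in vs -> v y ^+ n < (1 + v z)^-1.
  by apply: near_infty_ex; apply: filterS3 h0 h1 hs.
(* Now [y] is large at both [v0] and [v1]: the factor [(1 + y ^- n)^-1] tends to 1 there and to 0 at
   the places of [vs]. *)
exists (z / (1 + y ^- n)).
  by rewrite rpred_div // rpredD ?rpred1 // rpredV rpredX.
have yn (w : L -> R) : absolute_value w -> w (y ^- n) = (w y)^-1 ^+ n.
  by move=> aw; rewrite absV // absX // exprVn.
have one (w : L -> R) : absolute_value w -> 1 - w (y ^- n) <= w (1 + y ^- n) /\
    w (1 + y ^- n) <= 1 + w (y ^- n).
  by move=> aw; have := abs_geB aw 1 (y ^- n); have := abs_leD aw 1 (y ^- n); rewrite abs1.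
split=> [|v].
  move: a0; rewrite lt_min => /andP[a0 a0'].
  have [l1 l2] := one _ av0; rewrite yn // in l1 l2.
  by rewrite absM // absV // ltr_pdivlMr ?mul1r; lra.
rewrite inE => /predU1P[->|vvs].
  have [l1 l2] := one _ av1; rewrite yn // in l1 l2.
  have v1z0 := abs_ge0 av1 z.
  by rewrite absM // absV // ltr_pdivrMr ?mul1r; lra.
have av := avs v vvs; have hv := as_ v vvs; have z0 := abs_ge0 av z.
have l1 := abs_geB av 1 (y ^+ n); rewrite abs1 // absX // in l1.
have yn0 : 0 <= v y ^+ n by rewrite exprn_ge0 ?abs_ge0.
have hv' : v y ^+ n * (1 + v z) < 1 by rewrite -ltr_pdivlMr ?mul1r // ltr_pwDl.
have -> : z / (1 + y ^- n) = z * y ^+ n / (1 + y ^+ n).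
  have yn1 : y ^+ n != 0 by rewrite expf_neq0.
  have -> : 1 + y ^- n = (1 + y ^+ n) / y ^+ n by rewrite mulrDl divff // mul1r addrC.
  by rewrite invf_div mulrA.
rewrite !absM // absV // absX // ltr_pdivrMr ?mul1r; last by nra.
by nra.
Qed.

Lemma place_over_gt1 (R : realType) (L : fieldExtType rat) u (v : L -> R) :
  place_over u v -> exists c : rat, 1 < v c%:A.
Proof.
case: u => [p|] [av pp vq].
  exists p%:R^-1; rewrite vq /=.
  by have /= := padic_absXV R pp 1; rewrite expr1 => ->; rewrite expr1 ltr1n prime_gt1.
exists 2%:R; rewrite vq /= ratr_nat normr_nat.
by rewrite ltr1n.
Qed.

Lemma place_over_base (R : realType) (L : fieldExtType rat) u u' (v : L -> R) :
  place_over u v -> place_over u' v -> u = u'.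
Proof.
have key p (pp : prime p) : usual_abs R (Some p) p%:R < 1.
  by have /= := padic_abs_int_lt1 R pp p%:Z => ->.
move=> [av pu vq] [_ pu' vq'].
have e q : usual_abs R u q = usual_abs R u' q by rewrite -vq vq'.
case: u u' pu pu' {vq vq'} e => [p|] [p'|] //= pu pu' e.
- have := key _ pu; rewrite /= e.
  have -> : p%:R = (p%:Z)%:~R :> rat by [].
  by rewrite padic_abs_int_lt1 // dvdzE /= dvdn_prime2 // => /eqP->.
- by have := key _ pu; rewrite /= e ratr_nat normr_nat ltrn1 ltnNge prime_gt0.
by have := key _ pu'; rewrite /= -e ratr_nat normr_nat ltrn1 ltnNge prime_gt0.
Qed.

(* If [v_i (z_i) > r >= 1 > v_j (z_i)] for all [j <> i], then in a rational
   linear relation between the [z_i] the term with the largest coefficient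
   cannot cancel. *)
Lemma size_places_over (R : realType) (L : fieldExtType rat) u
    (vs : seq (L -> R)) : uniq vs -> (forall v, v \in vs -> place_over u v) ->
  (size vs <= \dim {:L})%N.
Proof.
move=> uvs hvs; set r := size vs; pose w (i : 'I_r) := nth (fun=> 0) vs i.
have wP i : place_over u (w i) by apply: hvs; rewrite mem_nth.
have aw i : absolute_value (w i) by case: (wP i).
have hz (i : 'I_r) : exists z, r%:R < w i z /\ forall j : 'I_r, j != i -> w j z < 1.
  have [|v|y _ [y1 hy]] := @artin_whaples R L {:L}%AS (w i) (rem (w i) vs) (aw i).
  - by have [c c1] := place_over_gt1 (wP i); exists c%:A; rewrite ?memvf.
  - rewrite (rem_filter _ uvs) mem_filter /= => /andP[vwi vvs].
    have [av _ _] := hvs v vvs; split=> //.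
    have [x vx] : exists x, v x != w i x.
      apply: contrapT => nx; case/eqP: vwi; apply/funext => x.
      by apply/eqP; apply: contrapT => /negP h; apply: nx; exists x.
    by apply: place_separate (hvs v vvs) (wP i) (memvf x) vx.
  have [n hn] : exists n, (w i y)^-1 ^+ n < r.+1%:R^-1.
    apply: near_infty_ex; apply: near_expr_lt; rewrite ?invr_ge0 ?abs_ge0 //.
    by rewrite invf_lt1 // (lt_trans ltr01 y1).
  exists (y ^+ n.+1); split=> [|j ji].
    rewrite absX // exprS; apply: lt_le_trans (_ : (w i y) ^+ n <= _).
      move: hn; rewrite exprVn ltf_pV2 ?posrE ?exprn_gt0 ?(lt_trans ltr01 y1) //.
      by apply: lt_trans; rewrite ltr_nat.
    by rewrite ler_peMl ?exprn_ge0 ?abs_ge0 // ltW.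
  have wj : w j y < 1.
    apply: hy; rewrite (rem_filter _ uvs) mem_filter /= mem_nth // andbT.
    by apply: contra ji; rewrite nth_uniq.
  by rewrite absX // exprn_ilt1 ?abs_ge0.
have [z hz'] := choice hz.
have fz : free [tuple z i | i < r].
  apply/freeP => q; under eq_bigr do rewrite -tnth_nth tnth_mktuple.
  move=> q0 i0; apply/eqP/negPn/negP => qi0.
  have [i _ imax] := @Order.TotalTheory.arg_maxP _ _ _ i0 xpredT (fun i => usual_abs R u (q i)) isT.
  have wq j k : w j (q k)%:A = usual_abs R u (q k) by case: (wP j).
  have ge0 k : 0 <= usual_abs R u (q k) by rewrite -(wq i0) abs_ge0.
  have i_gt0 : 0 < usual_abs R u (q i).
    apply: lt_le_trans (imax i0 isT).
    by rewrite -(wq i0) abs_gt0 // scaler_eq0 oner_eq0 orbF.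
  have [zi zj] := hz' i.
  have qE k : w i (q k *: z k) = usual_abs R u (q k) * w i (z k).
    by rewrite -mulr_algl absM ?wq.
  have : w i (q i *: z i) <= r%:R * usual_abs R u (q i).
    move: q0; rewrite (bigD1 i) //= => /eqP; rewrite addr_eq0 => /eqP->.
    rewrite absN //; apply: le_trans (abs_sum_le (aw i) _ _ _) _.
    rewrite -[r in leRHS]card_ord mulr_natl -sumr_const.
    apply: le_trans (_ : \sum_(k | k != i) usual_abs R u (q i) <= _).
      apply: ler_sum => k ki; rewrite qE -[leRHS]mulr1 ler_pM ?abs_ge0 //.
        exact: imax.
      by have [_ /(_ i)] := hz' k; rewrite eq_sym ki => /(_ isT)/ltW.
    by rewrite [leRHS](bigD1 i) //= lerDr ltW.
  by rewrite qE mulrC ler_pM2r // leNgt zi.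
have := dimvS (subvf <<[tuple z i | i < r]>>).
by rewrite (eqP (fz : \dim _ == _)) size_tuple.
Qed.

(** * Local degrees *)

Section LocalDegree.
Variables (R : realType) (L : fieldExtType rat) (v : L -> R).
Hypothesis av : absolute_value v.

Lemma v_nullP (u : nat -> L) : v_null v u <->
  forall e, 0 < e -> exists N, forall n, (N <= n)%N -> v (u n) < e.
Proof.
split=> [/cvgrPdist_lt u0 e e0|u0].
  have [N _ hN] := u0 e e0; exists N => n Nn; have := hN n Nn.
  by rewrite /= sub0r normrN ger0_norm ?abs_ge0.
apply/cvgrPdist_lt => e e0; have [N hN] := u0 e e0; exists N => // n /hN.
by rewrite /= sub0r normrN ger0_norm ?abs_ge0.
Qed.

Lemma v_cauchyP (u : nat -> L) : v_cauchy v u <->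
  forall e, 0 < e -> exists N, forall m n, (N <= m)%N -> (N <= n)%N -> v (u m - u n) < e.
Proof.
split=> uc e e0.
  have [[/= A B] [[M _ hM] [N _ hN]] AB] := uc e e0.
  exists (maxn M N) => m n; rewrite !geq_max => /andP[Mm _] /andP[_ Nn].
  by apply: (AB (m, n)); split; [apply: hM|apply: hN].
have [N hN] := uc e e0; exists ([set n | (N <= n)%N], [set n | (N <= n)%N]).
  by split; exists N.
by move=> [m n] /= [Nm Nn]; apply: hN.
Qed.

(** Density of the rational span stands for generating the completion over Q_v by constant
    sequences. *)
Definition dense_span m (b : 'I_m -> L) : Prop := forall y e, 0 < e ->
  exists q : 'I_m -> rat, v (y - \sum_(i < m) q i *: b i) < e.

(** Dividing small combinations by their coefficient at [i0], which stays away from 0, makes [b i0]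
    a limit of combinations of the other vectors. *)
Lemma dense_span_drop m (b : 'I_m.+1 -> L) (i0 : 'I_m.+1) (e : R) :
  dense_span b -> 0 < e ->
  (forall d, 0 < d -> exists a : 'I_m.+1 -> rat,
     v (\sum_i a i *: b i) < d /\ e <= v (a i0)%:A) ->
  dense_span (b \o lift i0).
Proof.
move=> db e0 small y h h0; have h2 : 0 < h / 2 by rewrite divr_gt0.
have [q hq] := db y (h / 2) h2.
set Q := v (q i0)%:A; have Q0 : 0 <= Q by rewrite abs_ge0.
have [|a [ha ea]] := small (e * (h / 2 / (1 + Q))).
  by rewrite mulr_gt0 // divr_gt0 // ltr_pwDl.
have va0 : 0 < v (a i0)%:A by apply: lt_le_trans ea.
have a0 : a i0 != 0.
  by apply: contraTneq va0 => ->; rewrite scale0r abs0 // ltxx.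
exists (fun j => q (lift i0 j) - q i0 * (a (lift i0 j) / a i0)).
have -> : y - \sum_(j < m) (q (lift i0 j) - q i0 * (a (lift i0 j) / a i0)) *: (b \o lift i0) j =
   (y - \sum_i q i *: b i) + (q i0 / a i0) *: \sum_i a i *: b i.
  have -> : \sum_(j < m) (q (lift i0 j) - q i0 * (a (lift i0 j) / a i0)) *: (b \o lift i0) j =
     \sum_j q (lift i0 j) *: b (lift i0 j) -
     (q i0 / a i0) *: \sum_j a (lift i0 j) *: b (lift i0 j).
    rewrite scaler_sumr -sumrB; apply: eq_bigr => j _.
    by rewrite scalerBl scalerA mulrA mulrAC.
  rewrite !(bigD1_ord i0) //= scalerDr scalerA divfK //.
  by move: (q i0 *: b i0) (_ *: \sum_j _) => X Y; ring.
apply: le_lt_trans (abs_leD av _ _) _.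
have : v ((q i0 / a i0) *: (\sum_i a i *: b i)) < h / 2.
  have -> : v ((q i0 / a i0) *: (\sum_i a i *: b i)) =
      Q / v (a i0)%:A * v (\sum_i a i *: b i).
    by rewrite -[in LHS]mulr_algl [_%:A](fmorph_div (in_alg L)) /= !absM // absV.
  have hd : Q / v (a i0)%:A <= Q / e.
    by rewrite ler_wpM2l // lef_pV2.
  apply: le_lt_trans (_ : _ <= Q / e * v (\sum_i a i *: b i)) _.
    by rewrite ler_wpM2r ?abs_ge0.
  apply: le_lt_trans (_ : _ <= Q / e * (e * (h / 2 / (1 + Q)))) _.
    by rewrite ler_wpM2l ?divr_ge0 // ltW.
  rewrite mulrA divfK ?gt_eqF // mulrCA gtr_pMr //.
  by rewrite ltr_pdivrMr ?mul1r; lra.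
by move: hq; lra.
Qed.

(** A dense family of least size is a basis. Its coefficients depend uniformly continuously on the
    combination, so approximations of a Cauchy sequence have Cauchy coefficients, and null
    combinations have null ones. *)
Lemma exists_completion_basis : exists n (b : 'I_n -> nat -> L), completion_basis v b.
Proof.
have ex : exists m, `[< exists b : 'I_m -> L, dense_span b >].
  exists (\dim {:L}); apply/asboolP; exists (fun i => (vbasis {:L})`_i) => y e e0.
  exists (fun i => coord (vbasis {:L}) i y).
  by rewrite -(coord_vbasis (memvf y)) subrr abs0.
have [m /asboolP[b db] mmin] := ex_minnP ex.
(* Were some coefficient able to stay large in arbitrarily small combinations, [dense_span_drop]
   would shorten the family. *)
have unif e : 0 < e -> exists2 d, 0 < d &
    forall a : 'I_m -> rat, v (\sum_i a i *: b i) < d -> forall i, v (a i)%:A < e.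
  move=> e0; apply: contrapT => no.
  have [i0 hi0] : exists i0 : 'I_m, forall d, 0 < d -> exists a : 'I_m -> rat,
     v (\sum_i a i *: b i) < d /\ e <= v (a i0)%:A.
    apply: contrapT => /forallNP no'; apply: no.
    have /choice[d hd] i : exists d, 0 < d /\ forall a : 'I_m -> rat,
        v (\sum_i a i *: b i) < d -> v (a i)%:A < e.
      have /existsNP[d /not_implyP[d0 nd]] := no' i; exists d; split=> // a ad.
      by rewrite ltNge; apply/negP => ea; apply: nd; exists a.
    exists (\big[Num.min/1]_i d i) => [|a ad i].
      by elim/big_ind: _ => // [x y x0 y0|i _]; rewrite ?lt_min ?x0 //; case: (hd i).
    by case: (hd i) => _; apply; apply: lt_le_trans ad _; apply: bigmin_le_cond.
  have : (m <= m.-1)%N.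
    case: m b db mmin {no} i0 hi0 => [|m] b db mmin; first by case.
    move=> i0 hi0; apply: mmin; apply/asboolP.
    by exists (b \o lift i0); apply: dense_span_drop db e0 hi0.
  by case: (m) (i0) => [[]//|k] _; rewrite ltnn.
exists m, (fun i _ => b i); split.
- by move=> i; apply/v_cauchyP => e e0; exists 0%N => *; rewrite subrr abs0.
- move=> u uc.
  have /choice[q hq] k : exists q : 'I_m -> rat, v (u k - \sum_i q i *: b i) < k.+1%:R^-1.
    by apply: db; rewrite invr_gt0.
  exists (fun i k => q k i) => [i|].
    apply/v_cauchyP => e e0; have [d d0 hd] := unif e e0.
    have d3 : 0 < d / 3 by rewrite divr_gt0.
    have /v_cauchyP /(_ _ d3)[N hN] := uc.
    pose K := (Num.truncn (d / 3)^-1); exists (maxn N K) => k l.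
    rewrite !geq_max => /andP[Nk Kk] /andP[Nl Kl].
    rewrite -scalerBl; apply: (hd (fun i => q k i - q l i)).
    have hK n : (K <= n)%N -> n.+1%:R^-1 < d / 3.
      move=> Kn; rewrite invf_plt ?posrE //; apply: lt_le_trans (truncnS_gt _) _.
      by rewrite ler_nat ltnS.
    have -> : \sum_i (q k i - q l i) *: b i = (u k - u l) + (u l - \sum_i q l i *: b i) - (u k - \sum_i q k i *: b i).
      under eq_bigr do rewrite scalerBl.
      by rewrite sumrB; move: (\sum_i _) (\sum_i _) => X Y; ring.
    apply: le_lt_trans (abs_leD av _ _) _; rewrite absN //.
    have := abs_leD av (u k - u l) (u l - \sum_i q l i *: b i).
    by have := hN k l Nk Nl; have := lt_trans (hq k) (hK k Kk); have := lt_trans (hq l) (hK l Kl); lra.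
  apply/v_nullP => e e0; exists (Num.truncn e^-1) => n hn; apply: lt_trans (hq n) _.
  rewrite invf_plt ?posrE //; apply: lt_le_trans (truncnS_gt _) _.
  by rewrite ler_nat ltnS.
move=> a _ /v_nullP a0 i; apply/v_nullP => e e0; have [d d0 hd] := unif e e0.
have [N hN] := a0 d d0; exists N => n /hN; move/(hd (fun i => a i n)); apply.
Qed.

Lemma local_degreeP : exists b : 'I_(local_degree v) -> nat -> L, completion_basis v b.
Proof.
rewrite /local_degree; case: xgetP => [n -> //|nob].
by have [n hn] := exists_completion_basis; case: (nob n).
Qed.

End LocalDegree.

Lemma max_abs_coord (R : realType) (M : fieldExtType rat) (w : M -> R) k (c : 'rV[M]_k) :
  absolute_value w -> c != 0 -> exists2 a, 0 < w (c 0 a) & forall b, w (c 0 b) <= w (c 0 a).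
Proof.
move=> aw c0; have /rV0Pn[i0 ci0] := c0.
have [a _ amax] := @Order.TotalTheory.arg_maxP _ _ _ i0 xpredT (fun i => w (c 0 i)) isT.
exists a => [|b]; last exact: amax.
by apply: lt_le_trans (amax i0 isT); rewrite abs_gt0.
Qed.

(* The matrix of the [s a (b l)] would have a nonzero left kernel vector [c] if [m < k];
   normalizing [c] by its largest entry contradicts the invertibility of the
   matrix of the [s a (e i)], which it approximates. *)
Lemma size_completion_basis (R : realType) (L M : fieldExtType rat) (v : L -> R)
    (w : M -> R) k n m (s : 'I_k -> {rmorphism L -> M}) (e : 'I_n -> L)
    (C : 'M[M]_(n, k)) (b : 'I_m -> nat -> L) :
  absolute_value v -> absolute_value w -> (forall a x, w (s a x) = v x) ->
  (\matrix_(a, i) s a (e i)) *m C = 1%:M -> completion_basis v b -> (k <= m)%N.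
Proof.
move=> av aw ws eC [_ gen _]; rewrite leqNgt; apply/negP => mk.
pose G := k%:R * \sum_i \sum_a w (C i a).
have G0 : 0 <= G by rewrite mulr_ge0 // sumr_ge0 // => i _; rewrite sumr_ge0 // => *; rewrite abs_ge0.
have /choice[A hA] i : exists a : 'I_m -> nat -> rat,
    v_null v (fun t => e i - \sum_l a l t *: b l t).
  have [|a _ ha] := gen (fun=> e i); last by exists a.
  by apply/v_cauchyP => d d0; exists 0%N => *; rewrite subrr abs0.
have [t ht] : exists t, forall i, v (e i - \sum_l A i l t *: b l t) < (1 + G)^-1.
  have /choice[N hN] i : exists N, forall t, (N <= t)%N ->
      v (e i - \sum_l A i l t *: b l t) < (1 + G)^-1.
    by have /(v_nullP av) := hA i; apply; rewrite invr_gt0 ltr_pwDl.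
  by exists (\max_i N i) => i; apply: hN; apply: leq_bigmax.
pose B := \matrix_(a < k, l < m) s a (b l t).
pose D := \matrix_(l < m, i < n) ((A i l t)%:A : M).
pose E := \matrix_(a, i) s a (e i) - B *m D.
have hE a i : w (E a i) < (1 + G)^-1.
  apply: le_lt_trans (ht i); rewrite -(ws a) !mxE rmorphB rmorph_sum /=.
  rewrite (eq_bigr (fun l => s a (A i l t *: b l t))) // => l _.
  by rewrite !mxE rmorph_ratZ mulr_algr.
have [c c0 cB] : exists2 c : 'rV_k, c != 0 & c *m B = 0.
  have : kermx B != 0.
    rewrite -mxrank_eq0 mxrank_ker -lt0n subn_gt0.
    exact: leq_ltn_trans (rank_leq_col _) mk.
  by case/rowV0Pn => c /sub_kermxP cB c0; exists c.
have cE : c = c *m (E *m C).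
  by rewrite mulmxBl eC mulmxBr mulmx1 -mulmxA [X in _ - X]mulmxA cB mul0mx subr0.
have [a wa amax] := max_abs_coord aw c0.
have : w (c 0 a) <= w (c 0 a) * (G / (1 + G)).
  rewrite {1}cE mxE; apply: le_trans (abs_sum_le aw _ _ _) _.
  apply: le_trans (_ : \sum_(j < k) w (c 0 a) * ((1 + G)^-1 * \sum_i \sum_a w (C i a)) <= _).
    apply: ler_sum => j _; rewrite absM //; apply: ler_pM; rewrite ?abs_ge0 ?amax //.
    rewrite mxE mulr_sumr; apply: le_trans (abs_sum_le aw _ _ _) _.
    apply: ler_sum => i _; rewrite absM //; apply: ler_pM; rewrite ?abs_ge0 //.
      exact/ltW/hE.
    by rewrite (bigD1 a) //= lerDl sumr_ge0 // => *; rewrite abs_ge0.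
  rewrite sumr_const card_ord -mulr_natl [leLHS](_ : _ = w (c 0 a) * (G / (1 + G))) //.
  by move: (1 + G)^-1 => H; rewrite /G; ring.
rewrite -[leLHS]mulr1 ler_pM2l // ler_pdivlMr ?mul1r; lra.
Qed.

(** * Galois extensions of the rationals *)

Lemma rat_ext_separable (L : fieldExtType rat) (K E : {subfield L}) : separable K E.
Proof.
apply/separableP => y _; apply: pcharf0_separable => p.
by rewrite pchar_lalg pchar_num.
Qed.

Lemma primitive_element (L : fieldExtType rat) (K E : {subfield L}) : (K <= E)%VS ->
  exists z, (<<K; z>>%VS = E :> {vspace L}).
Proof.
move=> KE; exists (separable_generator K E).
by rewrite -eq_adjoin_separable_generator // rat_ext_separable.
Qed.

Section GaloisOverRat.
Variable M : splittingFieldType rat.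
Implicit Types (s t : gal_of {:M}) (K : {subfield M}).

Lemma galois_full K : galois K {:M}.
Proof. by apply/and3P; split; rewrite ?subvf ?rat_ext_separable ?normalFieldf. Qed.

Lemma mem_galP K s : reflect {in K, forall x, s x = x} (s \in 'Gal({:M} / K)%g).
Proof.
apply: (iffP idP) => [sK x xK|sK]; first exact: fixed_gal (subvf K) sK xK.
by rewrite gal_kHom ?subvf //; apply/kHomP; split=> // x y _ _; rewrite rmorphM.
Qed.

Lemma gal_ratA s (q : rat) : s q%:A = q%:A. Proof. by rewrite linearZ rmorph1. Qed.

Lemma gal_fixed_rat x : (forall s, s x = x) -> exists q : rat, x = q%:A.
Proof.
move=> fx; apply/vlineP.
have /galois_fixedField <- := galois_full 1%AS.
by apply/fixedFieldP; rewrite ?memvf.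
Qed.

Lemma mem_galC K x : (forall s, s \in 'Gal({:M} / K)%g -> s x = x) -> x \in K.
Proof.
move=> fx; have /galois_fixedField <- := galois_full K.
by apply/fixedFieldP; rewrite ?memvf.
Qed.

Lemma galMf s t x : (s * t)%g x = t (s x). Proof. by rewrite galM ?memvf. Qed.

Lemma gal_prod_fixed (x : M) t : t (\prod_(s : gal_of {:M}) s x) = \prod_(s : gal_of {:M}) s x.
Proof.
rewrite rmorph_prod [RHS](reindex_inj (mulIg t)) /=.
by apply: eq_bigr => s _; rewrite galMf.
Qed.

Lemma minPoly_factors K (x : M) : exists r : seq (gal_of {:M}),
  [/\ {subset r <= 'Gal({:M} / K)%g}, uniq [seq s x | s : gal_of {:M} <- r],
      minPoly K x = \prod_(s <- r) ('X - (s x)%:P) &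
      forall s, s \in 'Gal({:M} / K)%g -> exists2 t, t \in r & s x = t x].
Proof.
have /(galois_factors (subvf K))/(_ x (memvf x))[r [rG ur mE]] := galois_full K.
exists r; split=> //; first by move=> s; apply: (fintype.subsetP rG).
  by rewrite mE big_map.
move=> s sG; have := root_minPoly_gal (subvf K) sG (memvf x).
by rewrite mE root_prod_XsubC => /mapP[t tr ->]; exists t.
Qed.

End GaloisOverRat.

Section Embeddings.
Variables (L : fieldExtType rat) (M : splittingFieldType rat) (f : {rmorphism L -> M}).

Lemma minPoly_rmorph x : size (minPoly 1 (f x)) = size (minPoly 1 x).
Proof.
have sz (K K' : fieldExtType rat) (y : K) (y' : K') :
    (forall q : {poly rat}, root (map_poly (in_alg K) q) y -> root (map_poly (in_alg K') q) y') ->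
    (size (minPoly 1 y') <= size (minPoly 1 y))%N.
  move=> h; have /polyOver1P[q qE] := minPolyOver 1 y.
  have := root_minPoly 1 y; rewrite qE => /h rq.
  have q0 : map_poly (in_alg K') q != 0.
    rewrite map_poly_eq0; apply/eqP => q0.
    by have := monic_neq0 (monic_minPoly 1 y); rewrite qE q0 rmorph0 eqxx.
  have : minPoly 1 y' %| map_poly (in_alg K') q.
    by apply: minPoly_dvdp => //; apply/polyOver1P; exists q.
  by move/(dvdp_leq q0); rewrite !size_map_poly.
have fE (q : {poly rat}) : map_poly (in_alg M) q = map_poly f (map_poly (in_alg L) q).
  by rewrite -map_poly_comp; apply: eq_map_poly => c /=; rewrite rmorph_ratA.
apply/eqP; rewrite eqn_leq !sz // => q; rewrite fE ?fmorph_root //.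
Qed.

(** As [M] is normal, the roots of the minimal polynomial of [f z], for a generator [z] of [L], are
    Galois conjugates of [f z]; [t] picks one automorphism for each of them. *)
Lemma embeddings : exists (t : 'I_(\dim {:L}) -> gal_of {:M}) (z : L),
  [/\ <<1; z>>%VS = {:L}%VS, injective (fun a => t a (f z)) &
      forall s : gal_of {:M}, exists a, forall x, s (f x) = t a (f x)].
Proof.
have [z zE] := primitive_element (sub1v {:L}%AS).
have [r [rG ur mE rex]] := minPoly_factors 1%AS (f z).
have szr : size r = \dim {:L}.
  have := minPoly_rmorph z; rewrite mE size_prod_XsubC size_minPoly => -[->].
  by rewrite adjoin_degreeE zE dimv1 divn1.
pose t (a : 'I_(\dim {:L})) := nth 1%g r a; exists t, z; split=> //.
  move=> a b /eqP; rewrite /t -!(nth_map _ 0 (fun s : gal_of {:M} => s (f z))) ?szr ?ltn_ord //.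
  by rewrite nth_uniq ?size_map ?szr ?ltn_ord // => /eqP/val_inj.
move=> s; have [|u ur' su] := rex s.
  by apply/mem_galP => x /vlineP[q ->]; rewrite gal_ratA.
have ui : (index u r < \dim {:L})%N by rewrite -szr index_mem.
exists (Ordinal ui) => x; rewrite /t /= nth_index //.
have : x \in <<1; z>>%VS by rewrite zE memvf.
case/Fadjoin_polyP => p /polyOver1P[q ->] ->.
rewrite -!horner_map /= -!map_poly_comp su; congr _.[_].
by apply: eq_map_poly => c /=; rewrite !rmorph_ratA ?gal_ratA.
Qed.

Lemma image_subfield : exists E : {subfield M}, forall y, (y \in E) <-> exists x, y = f x.
Proof.
have [z zE] := primitive_element (sub1v {:L}%AS).
exists <<1; f z>>%AS => y; split=> [/Fadjoin_polyP[p /polyOver1P[q ->] ->]|[x ->]].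
  exists (map_poly (in_alg L) q).[z]; rewrite -horner_map -map_poly_comp; congr _.[_].
  by apply: eq_map_poly => c /=; rewrite rmorph_ratA.
have : x \in <<1; z>>%VS by rewrite zE memvf.
case/Fadjoin_polyP => p /polyOver1P[q ->] ->; apply/Fadjoin_polyP.
exists (map_poly (in_alg M) q); first by apply/polyOver1P; exists q.
rewrite -horner_map -map_poly_comp; congr _.[_].
by apply: eq_map_poly => c /=; rewrite rmorph_ratA.
Qed.

End Embeddings.

(** * Existence of places *)

Section MaximalSubring.
Variables (L : fieldExtType rat) (p : nat).
Hypothesis p_pr : prime p.

Definition proper_subring (S : set L) : Prop :=
  [/\ forall x, S x -> S 1, forall x y, S x -> S y -> S (x - y),
      forall x y, S x -> S y -> S (x * y) & ~ S p%:R^-1].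

Lemma exists_maximal_subring : exists A : set L,
  [/\ proper_subring A, A 1 & forall S, proper_subring S -> A `<=` S -> S `<=` A].
Proof.
have [|A [PA Amax]] := @Zorn_bigcup L proper_subring.
  move=> F FP tot; split.
  - move=> x [S FS Sx]; exists S => //; have [h _ _ _] := FP S FS; exact: h Sx.
  - move=> x y [S FS Sx] [T FT Ty]; have [ST|TS] := tot S T FS FT.
      by exists T => //; have [_ h _ _] := FP T FT; apply: h; first exact: ST.
    by exists S => //; have [_ h _ _] := FP S FS; apply: h => //; exact: TS.
  - move=> x y [S FS Sx] [T FT Ty]; have [ST|TS] := tot S T FS FT.
      by exists T => //; have [_ _ h _] := FP T FT; apply: h; first exact: ST.
    by exists S => //; have [_ _ h _] := FP S FS; apply: h => //; exact: TS.
  by move=> [S FS Sp]; have [_ _ _ h] := FP S FS; apply: h.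
have mx S : proper_subring S -> A `<=` S -> S `<=` A.
  move=> PS AS x Sx; apply: contrapT => nAx; apply: (Amax S) => //.
  by split=> // SA; apply: nAx; apply: SA.
exists A; split=> //.
(* The integers form such a subring, so a maximal one is not empty. *)
have PZ : proper_subring [set x | exists z : int, x = z%:~R].
  split=> [_ _|_ _ [z ->] [t ->]|_ _ [z ->] [t ->]|[z zE]].
  - by exists 1.
  - by exists (z - t); rewrite intrB.
  - by exists (z * t); rewrite intrM.
  have : (p%:R^-1 : rat) = z%:~R.
    apply: (fmorph_inj (in_alg L)); rewrite fmorphV rmorph_nat zE.
    by rewrite rmorph_int.
  have p0 : p%:R != 0 :> rat by rewrite pnatr_eq0 -lt0n prime_gt0.
  move/(congr1 ( *%R p%:R)); rewrite divff // => /eqP.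
  rewrite -[p%:R]/(p%:Z%:~R) -intrM -[1]/(1%:~R) eqr_int => /eqP e.
  have : (p%:Z %| 1%:Z)%Z by apply/dvdzP; exists z; rewrite mulrC -e.
  by rewrite dvdzE /= dvdn1 => /eqP p1; move: p_pr; rewrite p1.
case: (pselect (exists x, A x)) => [[x Ax]|nA]; first by have [h _ _ _] := PA; apply: h Ax.
by apply: (mx _ PZ) => [x Ax|]; [case: nA; exists x|exists 1].
Qed.

End MaximalSubring.

Section ValuationRing.
Variables (L : fieldExtType rat) (p : nat) (A : set L).
Hypotheses (p_pr : prime p) (PA : proper_subring p A) (A1 : A 1).
Hypothesis Amax : forall S, proper_subring p S -> A `<=` S -> S `<=` A.

Let AB x y : A x -> A y -> A (x - y). Proof. by case: PA => _ h _ _; apply: h. Qed.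
Let AM x y : A x -> A y -> A (x * y). Proof. by case: PA => _ _ h _; apply: h. Qed.
Let ApV : ~ A p%:R^-1. Proof. by case: PA. Qed.
Let A0 : A 0. Proof. by rewrite -(subrr 1); apply: AB. Qed.
Let AN x : A x -> A (- x). Proof. by move=> Ax; rewrite -sub0r; apply: AB. Qed.
Let AD x y : A x -> A y -> A (x + y).
Proof. by move=> Ax Ay; rewrite -[y]opprK; apply/AB/AN. Qed.
Let AX x k : A x -> A (x ^+ k).
Proof. by move=> Ax; elim: k => [|k IHk]; rewrite ?exprS //; apply: AM. Qed.
Let Anat n : A n%:R.
Proof. by elim: n => [|n IHn] //; rewrite -natr1; apply: AD. Qed.
Let Aint (z : int) : A z%:~R.
Proof. by case: z => n; rewrite ?NegzE ?mulrNz; [|apply: AN]; apply: Anat. Qed.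
Let Asum I (r : seq I) (P : pred I) (f : I -> L) :
  (forall i, P i -> A (f i)) -> A (\sum_(i <- r | P i) f i).
Proof. by move=> h; elim/big_ind: _ => //; apply: AD. Qed.
Let p0 : p%:R != 0 :> L.
Proof. by rewrite -(rmorph_nat (in_alg L)) fmorph_eq0 pnatr_eq0 -lt0n prime_gt0. Qed.

Let unit_neq0 b : A b -> 1 - p%:R * b != 0.
Proof.
move=> Ab; rewrite subr_eq0; apply: contra_notN ApV => /eqP e.
by have -> : p%:R^-1 = b by apply: (mulfI p0); rewrite mulfV.
Qed.

(** Inverting [u = 1 - p b] cannot introduce [p^-1]: the powers of [u] again have the form
    [1 - p b'], and [p^-1 * u ^+ k = p^-1 - b'] lies outside [A]. Maximality concludes. *)
Lemma subring_unit1 b : A b -> A (1 - p%:R * b)^-1.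
Proof.
move=> Ab; set u := 1 - _.
have Au : A u by apply: AB => //; apply: AM => //; apply: Anat.
have u0 : u != 0 by apply: unit_neq0.
have uk k : exists2 b', A b' & u ^+ k = 1 - p%:R * b'.
  elim: k => [|k [b' Ab' e]]; first by exists 0; rewrite // mulr0 subr0.
  exists (b + b' - p%:R * b * b'); last by rewrite exprS e /u; ring.
  by apply: AB; [apply: AD|apply: AM => //; apply: AM => //; apply: Anat].
have PS : proper_subring p [set x | exists k, A (x * u ^+ k)].
  split.
  - by move=> x _; exists 0%N; rewrite mulr1.
  - move=> x y [k xk] [l yl]; exists (k + l)%N.
    have -> : (x - y) * u ^+ (k + l) = x * u ^+ k * u ^+ l - y * u ^+ l * u ^+ k.
      by rewrite exprD; ring.
    by apply: AB; apply: AM => //; apply: AX.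
  - by move=> x y [k xk] [l yl]; exists (k + l)%N; rewrite exprD mulrACA; apply: AM.
  move=> [k]; have [b' Ab' ->] := uk k; rewrite mulrBr mulr1 mulKf // => h.
  by apply: ApV; rewrite -(subrK b' p%:R^-1); apply: AD.
apply: (Amax PS) => [x Ax|]; first by exists 0%N; rewrite mulr1.
by exists 1%N; rewrite expr1 mulVf.
Qed.

(* [p^-1] is a value at [x] of a polynomial over [A] of size at most [n]. *)
Let inverts n x := exists q : {poly L},
  [/\ (size q <= n)%N, forall i, A q`_i & p%:R * q.[x] = 1].

(** By maximality, adjoining to [A] an element outside it must produce [p^-1]. *)
Let invertsP x : ~ A x -> exists n, inverts n x.
Proof.
move=> nAx; apply: contrapT => ninv.
have PS : proper_subring p [set y | exists2 q : {poly L}, forall i, A q`_i & y = q.[x]].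
  split.
  - move=> _ _; exists 1%:P; last by rewrite hornerC.
    by move=> i; rewrite coefC; case: ifP.
  - move=> _ _ [q Aq ->] [r Ar ->]; exists (q - r); last by rewrite !hornerE.
    by move=> i; rewrite coefB; apply: AB.
  - move=> _ _ [q Aq ->] [r Ar ->]; exists (q * r); last by rewrite !hornerE.
    by move=> i; rewrite coefM; apply: Asum => j _; apply: AM.
  move=> [q Aq qE]; apply: ninv; exists (size q), q; split=> //.
  by rewrite -qE mulfV.
apply: nAx; apply: (Amax PS) => [y Ay|].
  exists y%:P; last by rewrite hornerC.
  by move=> i; rewrite coefC; case: ifP.
exists 'X; last by rewrite hornerX.
by move=> i; rewrite coefX; case: eqP.
Qed.

(** The relation for [x^-1], multiplied by [x ^+ n] and with its constant term moved into the unit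
    [u], expresses [x ^+ n] as [p] times a polynomial in [x] of smaller degree; substituting this
    removes the leading term of [q]. *)
Let inverts_decr n m x : x != 0 -> inverts n.+1 x -> inverts m x^-1 -> (m <= n.+1)%N ->
  inverts n x.
Proof.
move=> x0 [q [sq Aq qx]] [r [sr Ar rx]] mn.
have Au : A (1 - p%:R * r`_0)^-1 by apply: subring_unit1.
set u := 1 - _ in Au; have u0 : u != 0 by apply: unit_neq0.
pose T := \poly_(i < n) (u^-1 * r`_(n - i)).
have Tx : x ^+ n = p%:R * T.[x].
  move: rx; rewrite (horner_coef_wide _ (leq_trans sr mn)) big_ord_recl expr0 mulr1.
  rewrite mulrDr => /(canRL (addKr _)); rewrite addrC -/u => e.
  apply: (mulfI u0); rewrite -{1}e horner_poly mulrCA -mulrA; congr (_ * _).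
  rewrite mulr_suml mulr_sumr [RHS](reindex_inj rev_ord_inj) /=; apply: eq_bigr => i _.
  rewrite /bump /= add1n subKn // -[in RHS]mulrA mulVKf // -mulrA; congr (_ * _).
  have -> : x ^+ n = x ^+ i.+1 * x ^+ (n - i.+1) by rewrite -exprD subnKC.
  by rewrite exprVn mulKf // expf_neq0.
exists (take_poly n q + (p%:R * q`_n) *: T); split.
- rewrite (leq_trans (size_polyD _ _)) // geq_max size_take_poly.
  by rewrite (leq_trans (size_scale_leq _ _)) // size_poly.
- move=> i; rewrite coefD coefZ coef_take_poly coef_poly.
  apply: AD; [by case: ifP|apply: AM; first by apply: AM => //; apply: Anat].
  by case: ifP => // _; apply: AM.
apply: etrans qx; rewrite (horner_coef_wide _ sq) big_ord_recr /= hornerD hornerZ.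
rewrite (horner_coef_wide _ (size_take_poly n q)) Tx; congr (_ * _).
rewrite mulrA (mulrC q`_n); congr (_ + _); apply: eq_bigr => i _.
by rewrite coef_take_poly ltn_ord.
Qed.

(** Otherwise take polynomials of least size for [x] and for [x^-1]; the longer of the two could be
    shortened. *)
Lemma maximal_subring_valuation x : A x \/ A x^-1.
Proof.
apply: contrapT => /not_orP[nx nxV].
have x0 : x != 0 by apply: contra_notN nx => /eqP->.
have mini y : ~ A y -> exists n, inverts n y /\ forall m, inverts m y -> (n <= m)%N.
  move=> /invertsP[n hn]; have ex : exists n, `[< inverts n y >] by exists n; apply/asboolP.
  have [m /asboolP hm mmin] := ex_minnP ex; exists m; split=> // k hk.
  by apply: mmin; apply/asboolP.
have pos n y : inverts n y -> (0 < n)%N.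
  case: n => [|n] [q [sq _ qy]] //; move: sq qy; rewrite leqn0 size_poly_eq0 => /eqP->.
  by rewrite horner0 mulr0 => /eqP; rewrite eq_sym oner_eq0.
have [n [hn nmin]] := mini x nx; have [m [hm mmin]] := mini _ nxV.
wlog mn : x n m nx nxV x0 hn nmin hm mmin / (m <= n)%N => [hw|].
  have [h|/ltnW h] := leqP m n; first exact: (hw x n m).
  by apply: (hw x^-1 m n); rewrite ?invrK ?invr_eq0.
case: n hn nmin mn => [/pos//|n] hn nmin mn.
by have := nmin _ (inverts_decr x0 hn hm mn); rewrite ltnn.
Qed.

Lemma subring_rat (q : rat) : ~~ (p %| `|denq q|)%N -> A q%:A.
Proof.
move=> pq; have qE : q%:A = (numq q)%:~R / (denq q)%:~R :> L.
  by rewrite -{1}(divq_num_den q) -[LHS]/(in_alg L _) fmorph_div !rmorph_int.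
rewrite qE; apply: AM => //.
have [a [b ab]] : exists a b : int, a * denq q + p%:Z * b = 1.
  have [a [b ab]] := Bezoutz (denq q) p%:Z; exists a, b; rewrite (mulrC p%:Z) ab.
  have : coprime p `|denq q| by rewrite prime_coprime.
  by rewrite coprime_sym /coprime /gcdz => /eqP->.
have dE : (denq q)%:~R * a%:~R = 1 - p%:R * b%:~R :> L.
  rewrite mulrC; apply/(canRL (addrK _)).
  by rewrite -[p%:R]/(p%:Z%:~R) -!intrM -intrD ab.
have Ab := subring_unit1 (Aint b); have b0 := unit_neq0 (Aint b).
suff -> : (denq q)%:~R^-1 = a%:~R * (1 - p%:R * b%:~R)^-1 :> L by apply: AM.
have d0 : (denq q)%:~R != 0 :> L.
  by apply: contraNneq b0 => d0; rewrite -dE d0 mul0r.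
by apply: (mulfI d0); rewrite mulfV // mulrA dE mulfV.
Qed.

Let unitA x := [/\ A x, A x^-1 & x != 0].

Let ratE (q : rat) : q != 0 -> exists2 u, unitA u &
  q%:A * p%:R ^+ logn p `|denq q| = p%:R ^+ logn p `|numq q| * u.
Proof.
move=> q0; pose n := `|numq q|%N; pose d := `|denq q|%N.
have n0 : (0 < n)%N by rewrite absz_gt0 numq_eq0.
have d0 : (0 < d)%N by rewrite absz_gt0 denq_eq0.
have [j cj nE] := pfactor_coprime p_pr n0; have [k ck dE] := pfactor_coprime p_pr d0.
have ndv i : coprime p i -> (0 < i)%N -> unitA (i%:R).
  move=> ci i0; have iL : i%:R != 0 :> L.
    by rewrite -(rmorph_nat (in_alg L)) fmorph_eq0 pnatr_eq0 -lt0n.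
  split=> //; have -> : i%:R^-1 = (i%:R^-1 : rat)%:A :> L.
    by rewrite -[RHS]/(in_alg L _) fmorphV rmorph_nat.
  apply: subring_rat; rewrite -[i%:R]/(i%:Z%:~R) denqVz; last by rewrite eqz_nat -lt0n.
  by rewrite absz_id absz_nat -prime_coprime.
have j0 : (0 < j)%N by move: n0; rewrite nE muln_gt0 => /andP[].
have k0 : (0 < k)%N by move: d0; rewrite dE muln_gt0 => /andP[].
have [Aj AjV jL] := ndv j cj j0; have [Ak AkV kL] := ndv k ck k0.
pose sg : L := (-1) ^+ (numq q < 0)%R.
have sgV : sg^-1 = sg by rewrite /sg -exprVn invrN1.
have sg0 : sg != 0 by rewrite /sg signr_eq0.
have Asg : A sg by apply: AX; apply: AN.
exists (sg * (j%:R / k%:R)).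
  split; [apply: AM => //; exact: AM| |].
    by rewrite invfM sgV invf_div; apply: AM => //; exact: AM.
  by rewrite !mulf_neq0 ?invr_eq0.
have -> : q%:A = sg * n%:R / d%:R :> L.
  rewrite -{1}(divq_num_den q) -[LHS]/(in_alg L _) fmorph_div !rmorph_int.
  by rewrite (intEsign (numq q)) -/n rmorphM rmorphXn /= rmorphN1 -(gtz0_abs (denq_gt0 q)).
rewrite nE dE !natrM !natrX -/n -/d.
have pL i : p%:R ^+ i != 0 :> L by rewrite expf_neq0.
by move: (pL (logn p d)); move: (_ ^+ logn p d) => P P0; field; rewrite ?P0 ?kL.
Qed.

(** [A] is a local ring: one of [y / x] and [x / y] lies in [A], and if [x + y] were a unit this
    would make [x] or [y] one too. *)
Let nonunit_add x y : A x -> A y -> ~ unitA x -> ~ unitA y -> ~ unitA (x + y).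
Proof.
move=> Ax Ay nx ny [_ AV xy0].
have key z t : A z -> ~ unitA z -> A (z + t)^-1 -> z + t != 0 -> z != 0 -> ~ A (t / z).
  move=> Az nz zt zt0 z0 tz; apply: nz; split=> //.
  have -> : z^-1 = (1 + t / z) / (z + t).
    by rewrite -{1}(divff z0) -mulrDl mulrAC divff // mul1r.
  by apply: AM => //; apply: AD.
have x0 : x != 0.
  by apply: contra_notN ny => /eqP x0; move: AV xy0; rewrite x0 add0r => *; split.
have y0 : y != 0.
  by apply: contra_notN nx => /eqP y0; move: AV xy0; rewrite y0 addr0 => *; split.
have [yx|yx] := maximal_subring_valuation (y / x).
  exact: (key x y).
by rewrite invf_div in yx; apply: (key y x) => //; rewrite addrC.
Qed.

Let max_term (s : seq L) : s != [::] -> all (fun x => x != 0) s ->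
  exists2 m, m \in s & forall y, y \in s -> A (y / m).
Proof.
elim: s => // x [|y s] IHs _ /andP[x0 h].
  by exists x; rewrite ?mem_head // => z; rewrite inE => /eqP->; rewrite divff.
have [m ms mP] := IHs isT h; have m0 := @allP _ _ (y :: s) h m ms.
have [xm|mx] := maximal_subring_valuation (x / m).
  exists m; first by rewrite inE ms orbT.
  by move=> z; rewrite inE => /predU1P[->|/mP].
exists x; first exact: mem_head.
move=> z; rewrite inE => /predU1P[->|/mP zm]; first by rewrite divff.
rewrite invf_div in mx; have -> : z / x = (z / m) * (m / x) by rewrite mulrA divfK.
exact: AM.
Qed.

Let linear_relation (x : L) : exists (n : nat) (c : 'I_n -> rat),
  (exists i, c i != 0) /\ \sum_i c i *: x ^+ i = 0.
Proof.
pose n := (\dim {:L}).+1.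
have : ~~ free [tuple x ^+ i | i < n].
  apply/negP => f; have := dimvS (subvf <<[tuple x ^+ i | i < n]>>).
  by rewrite (eqP (f : \dim _ == _)) size_tuple ltnn.
move=> nf; exists n; apply: contrapT => no; move/negP: nf; apply; apply/freeP => c c0 i.
apply/eqP/negPn/negP => ci; apply: no; exists c; split; first by exists i.
by apply: etrans c0; apply: eq_bigr => j _; rewrite -tnth_nth tnth_mktuple.
Qed.

(** The valuation of [x], normalized so that [p] has valuation 1, is [(b - a) / e]; three naturals
    avoid negative and fractional exponents. *)
Definition has_order (x : L) (e a b : nat) : Prop :=
  (0 < e)%N /\ exists2 u, unitA u & x ^+ e * p%:R ^+ a = p%:R ^+ b * u.

(** In a rational linear relation between powers of [x], divide by a largest term. Some other
    quotient is a unit, since a sum of nonunits cannot be [-1]; comparing these two terms makes a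
    power of [x] a rational times a unit. *)
Lemma exists_order x : x != 0 -> exists e a b, has_order x e a b.
Proof.
move=> x0; have [n [c [[i0 ci0] c0]]] := linear_relation x.
pose s := [seq i <- enum 'I_n | c i != 0]; pose y (i : 'I_n) := c i *: x ^+ i.
have yn0 i : c i != 0 -> y i != 0.
  by move=> ci; rewrite scaler_eq0 negb_or ci expf_neq0.
have [||m ms hm] := @max_term [seq y i | i <- s].
- by rewrite -size_eq0 size_map size_filter -lt0n -has_count; apply/hasP; exists i0; rewrite ?mem_enum.
- by apply/allP => z /mapP[i is_ ->]; move: is_; rewrite mem_filter => /andP[ci _]; exact: yn0.
have [i is_ mE] := mapP ms; rewrite {m ms}mE in hm.
move: is_; rewrite mem_filter => /andP[ci _].
have Ay j : A (y j / y i).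
  have [cj|cj] := eqVneq (c j) 0; first by rewrite /y cj scale0r mul0r.
  by apply: hm; apply: map_f; rewrite mem_filter cj mem_enum.
have [j ji uA] : exists2 j, j != i & unitA (y j / y i).
  apply: contrapT => no.
  suff : ~ unitA (- 1) by apply; rewrite /unitA invrN1 oppr_eq0 oner_eq0; split=> //; exact: AN.
  have -> : -1 = \sum_(j | j != i) y j / y i.
    have := c0; rewrite (bigD1 i) //= -/(y i) => /eqP; rewrite addrC addr_eq0 => /eqP e.
    by rewrite -mulr_suml e mulNr divff // yn0.
  suff [] : A (\sum_(j | j != i) y j / y i) /\ ~ unitA (\sum_(j | j != i) y j / y i) by [].
  elim/big_ind: _ => [|a b [Aa na] [Ab nb]|j ji].
  - by split=> // -[_ _]; rewrite eqxx.
  - by split; [apply: AD|apply: nonunit_add].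
  by split=> // uj; apply: no; exists j.
have [_ _ yji] := uA; have cj : c j != 0.
  by apply: contraNneq yji => cj; rewrite /y cj scale0r mul0r.
have {yji} e : x ^+ j * (c j / c i)%:A = x ^+ i * (y j / y i).
  have ciL : (c i)%:A != 0 :> L by rewrite scaler_eq0 oner_eq0 orbF.
  have xi0 : x ^+ i != 0 by rewrite expf_neq0.
  rewrite /y -!(mulr_algl _ (x ^+ _)) [(_ / _)%:A](fmorph_div (in_alg L)) /=.
  move: (x ^+ i) (x ^+ j) (c i)%:A (c j)%:A xi0 ciL => X Y C D X0 C0.
  by rewrite invfM [X * _]mulrC -!mulrA mulVf // mulr1 mulrCA.
have unitM a b : unitA a -> unitA b -> unitA (a * b).
  by move=> [Aa aV a0] [Ab bV b0]; split; rewrite ?invfM ?mulf_neq0 //; apply: AM.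
have unitV a : unitA a -> unitA a^-1.
  by move=> [Aa aV a0]; split; rewrite ?invrK ?invr_eq0.
move: (y j / y i) uA e => u uA e; have [Au AuV u0] := uA.
have r0 : c j / c i != 0 by rewrite mulf_neq0 ?invr_eq0.
have [u' uA' rE] := ratE r0; set b := logn p _ in rE; set a := logn p _ in rE; have [_ _ u0'] := uA'.
have pk k : p%:R ^+ k != 0 :> L by rewrite expf_neq0.
have xk k : x ^+ k != 0 by rewrite expf_neq0.
case: (ltngtP i j) => [ij|ij|/val_inj ij]; last by rewrite ij eqxx in ji.
  exists (j - i)%N, a, b; split; first by rewrite subn_gt0.
  exists (u / u'); first by apply: unitM => //; apply: unitV.
  apply: (mulfI (xk i)); rewrite [LHS]mulrA -exprD subnKC ?(ltnW ij) //.
  apply: (mulIf u0').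
  have -> : x ^+ j * p%:R ^+ a * u' = x ^+ i * u * p%:R ^+ b by rewrite -mulrA -rE mulrA e.
  rewrite -!mulrA mulVf // mulr1.
  by rewrite (mulrC u).
exists (i - j)%N, b, a; split; first by rewrite subn_gt0.
exists (u' / u); first by apply: unitM => //; apply: unitV.
apply: (mulfI (xk j)); rewrite [LHS]mulrA -exprD subnKC ?(ltnW ij) //.
apply: (mulIf u0).
have -> : x ^+ i * p%:R ^+ b * u = x ^+ j * (p%:R ^+ a * u').
  by rewrite mulrAC -e -mulrA rE.
by rewrite -!mulrA mulVf // mulr1.
Qed.

(** Raising both relations to the same power of [x] makes a power of [p] a unit of [A], which only
    [p ^+ 0] is. *)
Lemma has_order_unique x e a b e' a' b' : has_order x e a b -> has_order x e' a' b' ->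
  (b * e' + a' * e)%N = (b' * e + a * e')%N.
Proof.
move=> [e0 [u [Au AuV u0] h]] [e0' [u' [Au' AuV' u0'] h']].
have pk k : p%:R ^+ k != 0 :> L by rewrite expf_neq0.
have pw k t : unitA t -> p%:R ^+ k = t -> k = 0%N.
  case: k => // k [_ tV t0] pt; case: ApV.
  have -> : p%:R^-1 = p%:R ^+ k * t^-1 by rewrite -pt exprS invfM mulrC divfK.
  by apply: AM => //; apply: AX; apply: Anat.
have unitX t k : unitA t -> unitA (t ^+ k).
  by move=> [At tV t0]; split; rewrite -?exprVn ?expf_neq0 //; exact: AX.
have E : p%:R ^+ (b * e' + a' * e) * u ^+ e' = p%:R ^+ (b' * e + a * e') * u' ^+ e.
  have := congr1 (fun z => z ^+ e') h; have := congr1 (fun z => z ^+ e) h'.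
  rewrite !exprMn -!exprM => h1 h2.
  rewrite !exprD mulrAC -h2 [RHS]mulrAC -h1 (mulnC e' e).
  by rewrite -!mulrA; congr (_ * _); rewrite mulrC.
have [uX uX'] : unitA (u ^+ e') /\ unitA (u' ^+ e) by split; apply: unitX.
have unitM s t : unitA s -> unitA t -> unitA (s / t).
  move=> [Aa aV a0'] [Ab bV b0]; split; rewrite ?invfM ?invrK ?mulf_neq0 ?invr_eq0 //; exact: AM.
wlog le : e a b e' a' b' u u' e0 Au AuV u0 h e0' Au' AuV' u0' h' E uX uX' /
   (b' * e + a * e' <= b * e' + a' * e)%N => [hw|].
  have [l|/ltnW l] := leqP (b' * e + a * e') (b * e' + a' * e).
    exact: (hw e a b e' a' b' u u').
  by apply/esym; apply: (hw e' a' b' e a b u' u).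
apply/eqP; rewrite eqn_leq le andbT -subn_eq0; apply/eqP.
apply: (pw _ (u' ^+ e / u ^+ e')); first exact: unitM.
apply: (mulfI (pk (b' * e + a * e')%N)); rewrite -exprD subnKC //.
by have [_ _ v0] := uX; rewrite mulrA -E mulfK.
Qed.

Lemma subring_le0 x e a b : has_order x e a b -> A x <-> (a <= b)%N.
Proof.
move=> [e0 [u [Au AuV u0] h]]; have pk k : p%:R ^+ k != 0 :> L by rewrite expf_neq0.
split=> [Ax|ab].
  rewrite leqNgt; apply/negP => ba; case: ApV.
  have -> : p%:R^-1 = p%:R ^+ (a - b.+1) * x ^+ e * u^-1.
    have E : p%:R ^+ b.+1 * (p%:R ^+ (a - b.+1) * x ^+ e) = p%:R ^+ b * u.
      by rewrite mulrA -exprD subnKC // mulrC h.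
    apply: (mulIf u0); rewrite mulfVK //; apply: (mulfI (pk b.+1)).
    by rewrite E exprSr -mulrA mulVKf.
  by apply: AM => //; apply: AM; apply: AX => //; exact: Anat.
have Axe : A (x ^+ e).
  have -> : x ^+ e = p%:R ^+ (b - a) * u.
    by apply: (mulIf (pk a)); rewrite h mulrAC -exprD subnK.
  by apply: AM => //; apply: AX; exact: Anat.
case: (maximal_subring_valuation x) => // AxV.
have [->//|x0] := eqVneq x 0; case: e e0 Axe {h} => // e _ Axe.
have -> : x = x ^+ e.+1 * x^-1 ^+ e by rewrite exprVn exprS mulfK // expf_neq0.
by apply: AM => //; exact: AX.
Qed.

Lemma has_orderM x y e a b e' a' b' : has_order x e a b -> has_order y e' a' b' ->
  has_order (x * y) (e * e') (a * e' + a' * e) (b * e' + b' * e).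
Proof.
move=> [e0 [u [Au AuV u0] h]] [e0' [u' [Au' AuV' u0'] h']].
split; first by rewrite muln_gt0 e0.
exists (u ^+ e' * u' ^+ e).
  by split; rewrite ?invfM -?exprVn ?mulf_neq0 ?expf_neq0 //; apply: AM; exact: AX.
have := congr1 (fun z => z ^+ e') h; have := congr1 (fun z => z ^+ e) h'.
rewrite !exprMn -!exprM => h1 h2.
rewrite !exprD [RHS]mulrACA -h1 -h2 (mulnC e' e).
by rewrite mulrACA.
Qed.

Lemma has_order_rat (q : rat) : q != 0 ->
  has_order q%:A 1 (logn p `|denq q|) (logn p `|numq q|).
Proof. by move=> /ratE[u uA qE]; split=> //; exists u. Qed.

End ValuationRing.

(** As each nonzero element has an order relative to [p], the valuation of the maximal subring is
    real-valued, and [p] to the opposite of the order is the absolute value. It is ultrametric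
    because [y / x] or [x / y] lies in the ring. *)
Lemma exists_place_over (R : realType) (L : fieldExtType rat) p : prime p ->
  exists w : L -> R, place_over (Some p) w.
Proof.
move=> pp; have [A [PA A1 Amax]] := exists_maximal_subring L pp.
have p1 : (1 : R) < p%:R by rewrite ltr1n prime_gt1.
have p0 : (0 : R) < p%:R by exact: lt_trans p1.
pose ord (e a b : nat) : R := (b%:R - a%:R) / e%:R.
have ordE e a b e' a' b' : (0 < e)%N -> (0 < e')%N ->
    (b * e' + a' * e)%N = (b' * e + a * e')%N -> ord e a b = ord e' a' b'.
  move=> e0 e0' h; have {h} : (b * e' + a' * e)%:R = (b' * e + a * e')%:R :> R by rewrite h.
  rewrite !natrD !natrM => h; apply/eqP.
  rewrite eqr_div ?pnatr_eq0 -?lt0n //; apply/eqP; lra.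
have /choice[w hw] x : exists r : R, (x = 0 -> r = 0) /\ forall e a b,
    has_order p A x e a b -> x <> 0 -> r = p%:R `^ (- ord e a b).
  have [->|x0] := eqVneq x 0; first by exists 0.
  have [e [a [b h]]] := exists_order pp PA A1 Amax x0.
  exists (p%:R `^ (- ord e a b)); split=> [/eqP|]; first by rewrite (negPf x0).
  move=> e' a' b' h' _; have [e0 _] := h; have [e0' _] := h'.
  by rewrite (ordE _ _ _ _ _ _ e0 e0' (has_order_unique pp PA A1 h h')).
have w0 : w 0 = 0 by have [-> //] := hw 0.
have wE x e a b : x != 0 -> has_order p A x e a b -> w x = p%:R `^ (- ord e a b).
  by move=> /eqP x0 h; have [_ /(_ e a b h x0)] := hw x.
have w_gt0 x : x != 0 -> 0 < w x.
  move=> x0; have [e [a [b h]]] := exists_order pp PA A1 Amax x0.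
  by rewrite (wE _ _ _ _ x0 h) powR_gt0.
have wM x y : w (x * y) = w x * w y.
  have [->|x0] := eqVneq x 0; first by rewrite mul0r w0 mul0r.
  have [->|y0] := eqVneq y 0; first by rewrite mulr0 w0 mulr0.
  have [e [a [b h]]] := exists_order pp PA A1 Amax x0.
  have [e' [a' [b' h']]] := exists_order pp PA A1 Amax y0.
  rewrite (wE _ _ _ _ (mulf_neq0 x0 y0) (has_orderM PA A1 h h')) (wE _ _ _ _ x0 h) (wE _ _ _ _ y0 h').
  rewrite -powRD; last by apply/implyP => _; rewrite gt_eqF.
  congr (_ `^ _); rewrite /ord !natrD !natrM.
  have e0 : (e%:R : R) != 0 by rewrite pnatr_eq0 -lt0n; case: h.
  have e0' : (e'%:R : R) != 0 by rewrite pnatr_eq0 -lt0n; case: h'.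
  by field; rewrite e0 e0'.
have w_le1 x : A x -> w x <= 1.
  have [->|x0] := eqVneq x 0; first by rewrite w0 ler01.
  have [e [a [b h]]] := exists_order pp PA A1 Amax x0.
  move/(subring_le0 pp PA A1 Amax h) => ab; rewrite (wE _ _ _ _ x0 h).
  rewrite -[leRHS](powRr0 p%:R); apply: (ler_powR (ltW p1)); rewrite oppr_le0.
  by rewrite divr_ge0 // subr_ge0 ler_nat.
have wD x y : w (x + y) <= Num.max (w x) (w y).
  have [->|x0] := eqVneq x 0; first by rewrite add0r w0 le_max lexx orbT.
  have [->|y0] := eqVneq y 0; first by rewrite addr0 w0 le_max lexx.
  wlog yx : x y x0 y0 / A (y / x) => [hw'|].
    have [|yx] := maximal_subring_valuation pp PA A1 Amax (y / x); first exact: hw'.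
    by rewrite addrC maxC; apply: hw' => //; rewrite -invf_div.
  have -> : x + y = x * (1 + y / x) by rewrite mulrDr mulr1 mulrCA mulfV ?mulr1.
  rewrite wM le_max; apply/orP; left; rewrite -[leRHS]mulr1 ler_pM2l ?w_gt0 //.
  apply: w_le1; have [_ AB _ _] := PA; rewrite -[y / x]opprK; apply: (AB) => //.
  by rewrite -sub0r -(subrr 1); do 2!apply: (AB) => //.
have w_ge0 x : 0 <= w x.
  by have [->|x0] := eqVneq x 0; [rewrite w0|apply/ltW/w_gt0].
exists w; split=> //; [split=> // x|].
- split=> [wx|->//]; apply/eqP/negPn/negP => x0; have := w_gt0 x x0.
  by rewrite wx ltxx.
- by move=> y; apply: le_trans (wD x y) _; rewrite ge_max lerDl lerDr !w_ge0.
move=> q; have [->|q0] := eqVneq q 0; first by rewrite scale0r w0 /= /padic_abs eqxx.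
have qL : q%:A != 0 :> L by rewrite scaler_eq0 oner_eq0 orbF.
rewrite (wE _ _ _ _ qL (has_order_rat pp PA A1 Amax q0)) /ord divr1 opprB.
rewrite powRB; last by apply/implyP => _; rewrite gt_eqF.
by rewrite !powR_mulrn ?ltW //= /padic_abs (negPf q0).
Qed.

Lemma exists_rmorphism (A B : nzRingType) (f : A -> B) :
  (forall x y, f (x - y) = f x - f y) -> f 1 = 1 ->
  (forall x y, f (x * y) = f x * f y) -> exists g : {rmorphism A -> B}, g =1 f.
Proof.
move=> fB f1 fM.
pose a := GRing.isZmodMorphism.Build A B f fB.
pose b := GRing.isMonoidMorphism.Build A B f (conj f1 fM).
pose g : {rmorphism A -> B} := HB.pack f a b.
by exists g.
Qed.

Lemma closed_field_embedding (L : fieldExtType rat) (C : numClosedFieldType) :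
  inhabited {rmorphism L -> C}.
Proof.
have [z zE] := primitive_element (sub1v {:L}%AS).
have /polyOver1P[q qE] := minPolyOver 1 z.
have [zeta zr] : exists zeta, root (map_poly (ratr : rat -> C) q) zeta.
  apply/closed_rootP; rewrite size_map_poly.
  have := size_minPoly 1 z; rewrite qE size_map_poly => ->.
  by rewrite eqSS -lt0n adjoin_degreeE divn_gt0 ?dimv1 // adim_gt0.
have rep x : exists a : {poly rat}, x = (map_poly (in_alg L) a).[z].
  have : x \in <<1; z>>%VS by rewrite zE memvf.
  by case/Fadjoin_polyP => p /polyOver1P[a ->] ->; exists a.
have [a aE] := choice rep.
have wd (b : {poly rat}) : (map_poly (in_alg L) b).[z] = 0 ->
    (map_poly (ratr : rat -> C) b).[zeta] = 0.
  move=> bz; have : minPoly 1 z %| map_poly (in_alg L) b.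
    by apply: minPoly_dvdp; [apply/polyOver1P; exists b|apply/rootP].
  rewrite qE dvdp_map => /dvdpP[c ->].
  by rewrite rmorphM hornerM (rootP zr) mulr0.
have wd2 (b c : {poly rat}) : (map_poly (in_alg L) b).[z] = (map_poly (in_alg L) c).[z] ->
    (map_poly (ratr : rat -> C) b).[zeta] = (map_poly (ratr : rat -> C) c).[zeta].
  move=> bc; apply/eqP; rewrite -subr_eq0 -hornerN -hornerD -rmorphB; apply/eqP/wd.
  by rewrite rmorphB hornerD hornerN bc subrr.
have [x y||x y|g _] := @exists_rmorphism L C (fun x => (map_poly (ratr : rat -> C) (a x)).[zeta]).
- rewrite -hornerN -hornerD -rmorphB; apply: wd2.
  by rewrite rmorphB hornerD hornerN -!aE.
- rewrite (wd2 _ 1) ?rmorph1 ?hornerC // -aE.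
- rewrite -hornerM -rmorphM; apply: wd2.
  by rewrite rmorphM hornerM -!aE.
by constructor.
Qed.

Lemma exists_archimedean_place (R : realType) (L : fieldExtType rat) :
  exists w : L -> R, place_over None w.
Proof.
have [g] := closed_field_embedding L (R[i] : numClosedFieldType).
have nC (x : R) : ComplexField.Normc.normc x%:C%C = `|x|.
  by rewrite /= expr0n addr0 sqrtr_sqr.
exists (fun x => ComplexField.Normc.normc (g x)); split=> //; [split=> [x|x|x y|x y]|].
- by case: (g x) => a b /=; rewrite sqrtr_ge0.
- split=> [/ComplexField.Normc.eq0_normc/eqP|->]; first by rewrite fmorph_eq0 => /eqP.
  by rewrite rmorph0 ComplexField.Normc.normc0.
- by rewrite rmorphM ComplexField.Normc.normcM.
- by rewrite rmorphD le_normcD.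
move=> q; rewrite alg_num_field fmorph_rat /= -nC; congr ComplexField.Normc.normc.
exact/esym/(fmorph_rat (real_complex R)).
Qed.

Lemma exists_places_over (R : realType) (L : fieldExtType rat) :
  exists w : option nat -> L -> R, forall u, valid_base u -> place_over u (w u).
Proof.
have /choice[w pw] u : exists w : L -> R, valid_base u -> place_over u w.
  case: u => [p|].
    have [pp|npp] := boolP (prime p); last by exists (fun=> 0); rewrite /= (negPf npp).
    by have [v pv] := exists_place_over R L pp; exists v.
  by have [v pv] := exists_archimedean_place R L; exists v.
by exists w.
Qed.

(** * Heights in a Galois extension *)

Lemma finite_places_over (R : realType) (L : fieldExtType rat) u :
  finite_set [set v : L -> R | place_over u v].
Proof.
apply: contrapT => inf; have [B BP] := infinite_set_fset (\dim {:L}).+1 inf.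
have := @size_places_over R L u (finmap.enum_fset B) (finmap.fset_uniq B) _.
by rewrite ltnNge => -> // v vB; apply: BP.
Qed.

Lemma place_le1 (R : realType) (L : fieldExtType rat) p (v : L -> R) (x : L) (q : {poly rat}) :
  place_over (Some p) v -> q \is monic -> root (map_poly (in_alg L) q) x ->
  (forall i, ~~ (p %| `|denq q`_i|)%N) -> v x <= 1.
Proof.
move=> pv mq rx pq; have [av pp vq] := pv; have uv := place_over_ultrametric pv.
rewrite leNgt; apply/negP => x1.
have q0 : q != 0 by rewrite monic_neq0.
have sq : size q = (size q).-1.+1 by rewrite prednK // size_poly_gt0.
have [e|d0] := posnP (size q).-1.
  move: rx; have -> : q = 1.
    have /size_poly1P[c c0 qE] : size q == 1%N by rewrite sq e.
    by move: mq; rewrite qE monicE lead_coefC => /eqP ->.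
  by rewrite rmorph1 rootC oner_eq0.
have sz : (size (map_poly (in_alg L) q) <= (size q).-1.+1)%N by rewrite size_map_poly -sq.
move/rootP: rx; rewrite (horner_coef_wide _ sz) big_ord_recr /=.
set d := (size q).-1; rewrite coef_map /= -[q`_d]/(lead_coef q) (monicP mq) scale1r mul1r.
move/eqP; rewrite addrC addr_eq0 => /eqP e.
have : v (x ^+ d) <= v x ^+ d.-1.
  rewrite e absN //; apply: ultra_sum_le => // [|i _].
    by rewrite exprn_ge0 // abs_ge0.
  rewrite coef_map absM // absX // vq -[leRHS]mul1r.
  rewrite ler_pM ?exprn_ge0 ?abs_ge0 ?padic_abs_ge0 //.
    have pd := pq i; have ppr : prime p := pp.
    have [->|qi0] := eqVneq q`_i 0; first by rewrite /= /padic_abs eqxx ler01.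
    have l0 : logn p `|denq q`_i| = 0%N.
      by rewrite lognE ppr absz_gt0 denq_eq0 /= (negPf pd).
    rewrite /= /padic_abs (negPf qi0) l0 expr0 mul1r invf_le1 ?exprn_gt0 ?ltr0n ?prime_gt0 //.
    by rewrite exprn_ege1 // ler1n prime_gt0.
  by rewrite ler_weXn2l // ?ltW // -ltnS prednK // ltn_ord.
rewrite absX // -{1}(prednK (d0 : (0 < d)%N)) exprS ger_pMl ?exprn_gt0 ?(lt_trans ltr01) //.
by rewrite leNgt x1.
Qed.

Section FieldHeight.
Variables (R : realType) (L : fieldExtType rat) (x : L).

Let phi (v : L -> R) : R :=
  Num.max 1 (v x) `^ ((local_degree v)%:R / (\dim {:L})%:R).

Let phi_ge1 v : 1 <= phi v.
Proof. by rewrite -[leLHS](powRr0 (Num.max 1 (v x))) ler_powR // le_max lexx. Qed.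

(** A place with a nontrivial factor is archimedean or lies over a prime dividing a denominator of
    the minimal polynomial, and each place of Q has finitely many places above it. *)
Let phi_supp : finite_set [set v | places v /\ phi v != 1].
Proof.
have /polyOver1P[q qE] := minPolyOver 1 x.
have mq : q \is monic by rewrite -(map_monic (in_alg L)) -qE monic_minPoly.
pose D := (\prod_(i < size q) `|denq q`_i|)%N.
have D0 : (0 < D)%N by rewrite prodn_gt0 // => i; rewrite absz_gt0 denq_eq0.
pose us := None :: map Some (primes D).
apply: sub_finite_set (_ : finite_set (\bigcup_(u in [set` us]) [set v : L -> R | place_over u v])); last first.
  by apply: bigcup_finite => [|u _]; [exact: finite_seq|exact: finite_places_over].
move=> v [/placesP[u pv] v1]; exists u => //=; rewrite inE.
case: u pv => [p|] // pv; rewrite mem_map; last by move=> ? ? [].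
rewrite mem_primes D0; have [_ pp _] := pv; rewrite (pp : prime p) /=.
apply: contraNT v1 => pD; apply/eqP; rewrite /phi.
suff -> : Num.max 1 (v x) = 1 by rewrite powR1.
apply/eqP; rewrite eq_maxl; apply: place_le1 pv mq _ _.
  by rewrite -qE root_minPoly.
move=> i; have [iq|iq] := ltnP i (size q).
  by apply: contra pD => pi; rewrite /D (bigD1 (Ordinal iq)) //= dvdn_mulr.
by rewrite nth_default // dvdn1; apply: contraTneq pp => ->.
Qed.

(** All factors are at least 1, so any finite set of places bounds the height from below. *)
Lemma field_height_ge (vs : seq (L -> R)) : uniq vs ->
  (forall v, v \in vs -> places v) -> \prod_(v <- vs) phi v <= field_height R x.
Proof.
move=> uvs pvs; have /finite_seqP[s sE] := phi_supp.
pose r := undup (vs ++ s).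
rewrite /field_height (fsbigE r) ?undup_uniq //; last 2 first.
- move=> v; rewrite /= mem_undup mem_cat => /orP[/pvs//|vs'].
  by have : [set` s] v by []; rewrite -sE => -[].
- move=> v pv; rewrite mem_undup mem_cat => /norP[_ vs'].
  apply/eqP; apply: contraNT vs' => v1; have : [set` s] v by rewrite -sE; split.
  by [].
rewrite [leRHS](bigID (mem vs)) /=.
rewrite -[leLHS]mulr1; apply: ler_pM; rewrite ?ler01 //.
- by apply: prodr_ge0 => v _; apply: le_trans (phi_ge1 v).
- rewrite -big_filter le_eqVlt; apply/orP; left; apply/eqP.
  rewrite -[RHS]big_filter; apply: perm_big; apply: uniq_perm; rewrite ?filter_uniq ?undup_uniq //.
  move=> v; rewrite !mem_filter mem_undup mem_cat.
  case vvs: (v \in vs) => //=; rewrite ?andbF // !andbT.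
  by apply/esym/asboolP/pvs.
elim/big_ind: _ => // [y z y1 z1|v _]; last exact: phi_ge1.
by rewrite -[leLHS]mulr1 ler_pM.
Qed.

End FieldHeight.

(** * Lower bounds for the height by Galois conjugates *)

Section HeightEstimate.
Variables (R : realType) (M : splittingFieldType rat).

(** With [w] a place over [u], the functions [w \o s] run over all places of [M] over [u]; this is
    the part of the height above one place of Q. *)
Definition conj_height (w : M -> R) (a : M) : R :=
  \prod_(s : gal_of {:M}) Num.max 1 (w (s a)).

Lemma embedding_matrix_unit n (c : 'I_n -> M) : injective c ->
  (\matrix_(a < n, i < n) c a ^+ i) \in unitmx.
Proof.
move=> ic; have -> : \matrix_(a < n, i < n) c a ^+ i = (Vandermonde n (\row_a c a))^T.
  by apply/matrixP => a i; rewrite !mxE.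
rewrite unitmx_tr unitmxE det_Vandermonde unitfE; apply/prodf_neq0 => i _.
apply/prodf_neq0 => j ij; rewrite !mxE subr_eq0 (inj_eq ic).
by apply: contraTneq ij => ->; rewrite ltnn.
Qed.

Variables (L : fieldExtType rat) (f : {rmorphism L -> M}) (x : L).
Let n : nat := \dim {:L}.
Let N : nat := #|{: gal_of {:M}}|.

(** Both sides are products over pairs of an embedding and an automorphism; each automorphism
    permutes the embeddings. *)
Lemma conj_height_embeddings (t : 'I_n -> gal_of {:M}) z (w : M -> R) :
  injective (fun a => t a (f z)) ->
  (forall s : gal_of {:M}, exists a, forall y, s (f y) = t a (f y)) ->
  conj_height w (f x) ^+ n = (\prod_a Num.max 1 (w (t a (f x)))) ^+ N.
Proof.
move=> tinj tex.
have -> : conj_height w (f x) ^+ n = \prod_(a < n) \prod_(s : gal_of {:M}) Num.max 1 (w (s (t a (f x)))).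
  rewrite -[n in LHS]card_ord -prodr_const; apply: eq_bigr => a _.
  rewrite /conj_height (reindex_inj (mulgI (t a))) /=.
  by apply: eq_bigr => s _; rewrite galMf.
rewrite exchange_big /= -[N]/(#|{: gal_of {:M}}|) -prodr_const; apply: eq_bigr => s _.
have /choice[pi hpi] a : exists b, forall y, s (t a (f y)) = t b (f y).
  by have [b hb] := tex (t a * s)%g; exists b => y; rewrite -hb galMf.
have pinj : injective pi.
  move=> a b ab; apply: tinj.
  have e : s (t a (f z)) = s (t b (f z)) by rewrite hpi ab -hpi.
  exact: fmorph_inj e.
rewrite [RHS](reindex_inj pinj); apply: eq_bigr => a _.
by rewrite hpi.
Qed.

(** The rows of the Vandermonde matrix of the conjugates of [z] that belong to embeddings inducing
    [v] have a right inverse, formed from columns of the full inverse; [size_completion_basis] then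
    bounds their number. *)
Lemma embeddings_le_local_degree (t : 'I_n -> gal_of {:M}) z u (w : M -> R) (v : L -> R) :
  place_over u w -> injective (fun a => t a (f z)) ->
  (count_mem v [seq (w \o t a \o f) | a : 'I_n] <= local_degree v)%N.
Proof.
move=> pw tinj; have [aw _ _] := pw; pose A := [pred a : 'I_n | (w \o t a \o f) == v].
have -> : count_mem v [seq (w \o t a \o f) | a : 'I_n] = #|A|.
  rewrite -sum1_count big_map big_enum_cond -sum1_card.
  by apply: eq_bigl.
have [->//|A0] := posnP #|A|.
have [a0 a0A] := card_gt0P A0.
have av : absolute_value v.
  have /eqP <- : (w \o t a0 \o f) == v := a0A.
  by do 2!apply: absolute_value_comp.
have [b hb] := local_degreeP av.
pose M0 := \matrix_(a < n, i < n) (t a (f z)) ^+ i.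
have uM : M0 \in unitmx by apply: embedding_matrix_unit.
apply: (@size_completion_basis R L M v w #|A| n _ (fun a => (t (enum_val a) \o f : {rmorphism L -> M}))
  (fun i : 'I_n => z ^+ i) (\matrix_(i, a) invmx M0 i (enum_val a)) b) => //.
  move=> a y; have /eqP <- // : (w \o t (enum_val a) \o f) == v := enum_valP a.
apply/matrixP => a c; rewrite !mxE.
have := congr1 (fun B : 'M[M]_n => B (enum_val a) (enum_val c)) (mulmxV uM).
rewrite !mxE (inj_eq enum_val_inj) => <-; apply: eq_bigr => i _.
by rewrite !mxE /= !rmorphXn.
Qed.

(** After raising to the power [n], group the embeddings of [L] by the place they induce: its
    multiplicity is at most the local degree. Places over different places of Q do not collide, so
    [field_height_ge] applies to all of them at once. *)
Lemma prod_conj_height_le (us : seq (option nat)) (w : option nat -> M -> R) :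
  uniq us -> (forall u, u \in us -> place_over u (w u)) ->
  \prod_(u <- us) conj_height (w u) (f x) <= field_height R x ^+ N.
Proof.
move=> uus pw; have [t [z [_ tinj tex]]] := embeddings f.
have n0 : (0 < n)%N by rewrite adim_gt0.
pose V u := undup [seq (w u \o t a \o f) | a : 'I_n].
have Vp u v : u \in us -> v \in V u -> place_over u v.
  move=> /pw pu; rewrite mem_undup => /mapP[a _ ->].
  by do 2!apply: place_over_comp.
pose phi (v : L -> R) : R := Num.max 1 (v x) `^ ((local_degree v)%:R / n%:R).
have phiX v : phi v ^+ n = Num.max 1 (v x) ^+ local_degree v.
  have m0 : 0 <= Num.max 1 (v x) by rewrite le_max ler01.
  rewrite /phi -[LHS]powR_mulrn ?powR_ge0 // -powRrM divfK ?pnatr_eq0 -?lt0n //.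
  by rewrite powR_mulrn.
have max1 y : (1 : R) <= Num.max 1 y by rewrite le_max lexx.
have max0 y : (0 : R) <= Num.max 1 y by rewrite le_max ler01.
have hV u : u \in us -> \prod_a Num.max 1 (w u (t a (f x))) <= \prod_(v <- V u) phi v ^+ n.
  move=> uu; have -> : \prod_a Num.max 1 (w u (t a (f x))) =
      \prod_(v <- [seq (w u \o t a \o f) | a : 'I_n]) Num.max 1 (v x).
    by rewrite big_map big_enum.
  rewrite -prodr_undup_exp_count; apply: ler_prod => v _.
  rewrite exprn_ge0 //= phiX ler_weXn2l //.
  exact: embeddings_le_local_degree (pw u uu) tinj.
have uflat : uniq (flatten [seq V u | u <- us]).
  elim: us uus pw Vp {hV} => //= u us IHus /andP[nu uus] pw' Vp.
  rewrite cat_uniq undup_uniq IHus //=; last 2 first.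
  - by move=> u' uu'; apply: pw'; rewrite inE uu' orbT.
  - by move=> u' v uu'; apply: Vp; rewrite inE uu' orbT.
  rewrite andbT; apply/hasPn => v /flatten_mapP[u' uu' vu']; apply/negP => vu.
  have p1 := Vp u v (mem_head _ _) vu.
  have p2 : place_over u' v by apply: Vp => //; rewrite inE uu' orbT.
  by rewrite (place_over_base p1 p2) uu' in nu.
have pflat v : v \in flatten [seq V u | u <- us] -> places v.
  by move=> /flatten_mapP[u uu vu]; apply/placesP; exists u; apply: Vp.
have := field_height_ge x uflat pflat.
rewrite -[X in X <= _]/(\prod_(v <- flatten [seq V u | u <- us]) phi v).
rewrite big_flatten big_map => hle.
have ch0 a u : 0 <= conj_height (w u) a by apply: prodr_ge0 => *.
rewrite -(@ler_pXn2r _ n) ?nnegrE ?prodr_ge0 //; last first.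
  apply: exprn_ge0; apply: le_trans hle.
  by apply: prodr_ge0 => u _; apply: prodr_ge0 => v _; apply: powR_ge0.
rewrite -prodrXl -exprM mulnC exprM.
apply: le_trans (_ : \prod_(u <- us) (\prod_(v <- V u) phi v ^+ n) ^+ N <= _).
  rewrite !big_seq; apply: ler_prod => u uu; rewrite exprn_ge0 //= (conj_height_embeddings _ tinj tex).
  rewrite lerXn2r ?nnegrE ?hV //; first by apply: prodr_ge0.
  by apply: prodr_ge0 => v _; rewrite exprn_ge0 // powR_ge0.
rewrite prodrXl; under eq_bigr do rewrite prodrXl.
rewrite prodrXl lerXn2r // ?nnegrE ?exprn_ge0 //.
- by apply: prodr_ge0 => u _; apply: prodr_ge0 => v _; apply: powR_ge0.
- by apply: le_trans hle; apply: prodr_ge0 => u _; apply: prodr_ge0 => v _; apply: powR_ge0.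
rewrite lerXn2r // ?nnegrE //.
- by apply: prodr_ge0 => u _; apply: prodr_ge0 => v _; apply: powR_ge0.
by apply: le_trans hle; apply: prodr_ge0 => u _; apply: prodr_ge0 => v _; apply: powR_ge0.
Qed.

Lemma prod_conj_height_le_expr (us : seq (option nat)) (w : option nat -> M -> R) (X : R) :
  field_height R x <= X -> uniq us -> (forall u, u \in us -> place_over u (w u)) ->
  \prod_(u <- us) conj_height (w u) (f x) <= X ^+ N.
Proof.
move=> hX uus pw; apply: le_trans (prod_conj_height_le uus pw) _.
have := @field_height_ge R L x [::] isT; rewrite big_nil => h.
have h0 : 0 <= field_height R x by rewrite (le_trans ler01) // h.
by rewrite lerXn2r // nnegrE // (le_trans h0).
Qed.

End HeightEstimate.

(** * Discriminants and unramified primes *)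

Section Trace.
Variables (L : fieldExtType rat) (M : splittingFieldType rat) (f : {rmorphism L -> M}).
Let n : nat := \dim {:L}.
Variables (t : 'I_n -> gal_of {:M}) (z : L).
Hypothesis tinj : injective (fun a => t a (f z)).

Lemma embedding_basis_unit (X : n.-tuple L) : basis_of {:L} X ->
  (\matrix_(i < n, a < n) t a (f (tnth X i))) \in unitmx.
Proof.
move=> bX; have := embedding_matrix_unit tinj.
have -> : \matrix_(a < n, i < n) t a (f z) ^+ i =
    ((\matrix_(k, i) (coord X i (z ^+ k))%:A) *m \matrix_(i < n, a < n) t a (f (tnth X i)))^T.
  apply/matrixP => a k; rewrite !mxE -!rmorphXn /= (coord_basis bX (memvf (z ^+ k))).
  rewrite !rmorph_sum; apply: eq_bigr => i _ /=; rewrite !mxE.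
  by rewrite !rmorph_ratZ -tnth_nth mulr_algl.
by rewrite unitmx_tr unitmx_mul => /andP[].
Qed.

(** Over [M] the matrix of the embeddings diagonalizes multiplication by [x], with the conjugates of
    [x] on the diagonal. *)
Lemma trace_embeddings x : (trace x)%:A = \sum_a t a (f x) :> M.
Proof.
pose X := vbasis {:L}; have bX : basis_of {:L} X by apply: vbasisP.
pose A := passmx.mxof X X (amull x).
pose N := \matrix_(i < n, a < n) t a (f (tnth X i)).
have uN : N \in unitmx by apply: embedding_basis_unit.
have AX i : \sum_j A i j *: tnth X j = x * tnth X i.
  have -> : x * tnth X i = amull x (tnth X i) by rewrite lfunE.
  rewrite [RHS](coord_basis bX (memvf _)); apply: eq_bigr => j _; rewrite -tnth_nth; congr (_ *: _).
  by rewrite passmx.coord_rVof (tnth_nth 0) -passmx.vecof_delta -passmx.mul_mxof -rowE [RHS]mxE.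
have AN : map_mx (in_alg M) A *m N = N *m diag_mx (\row_a t a (f x)).
  apply/matrixP => i a; rewrite mul_mx_diag !mxE mulrC -!rmorphM -AX !rmorph_sum.
  by apply: eq_bigr => j _; rewrite !mxE /= mulr_algl !rmorph_ratZ.
have -> : (trace x)%:A = \tr (map_mx (in_alg M) A).
  by rewrite -[LHS]/(in_alg M _) /trace /mxtrace rmorph_sum; apply: eq_bigr => i _; rewrite !mxE.
rewrite -[map_mx _ A](mulmxK uN) AN mxtrace_mulC mulmxA mulVmx // mul1mx mxtrace_diag.
by apply: eq_bigr => a _; rewrite mxE.
Qed.

(** The assumption rules out the default value 0 of [discriminant], and so provides an integral
    basis; the trace form is the product of the embedding matrix with its transpose. *)
Lemma discriminant_embeddings : discriminant L != 0 ->
  exists2 e : n.-tuple L, integral_basis e &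
    (discriminant L)%:~R = \det (\matrix_(a < n, b < n) t a (f (tnth e b))) ^+ 2.
Proof.
rewrite /discriminant; case: xgetP => [D _ [e be De] _|_]; last by rewrite eqxx.
exists e => //; set S := \matrix_(a, b) _.
have -> : D%:~R = in_alg M D%:~R by rewrite rmorph_int.
rewrite De -det_map_mx expr2 -[X in _ = X * _]det_tr -det_mulmx; congr (\det _).
apply/matrixP => i j; rewrite !mxE /= trace_embeddings; apply: eq_bigr => a _.
by rewrite !mxE !rmorphM.
Qed.

End Trace.

Lemma integral_abs_le1 (R : realType) (L : fieldExtType rat) p (v : L -> R) x :
  place_over (Some p) v -> integralOver (intr : int -> L) x -> v x <= 1.
Proof.
move=> pv [P mP rP]; have [_ pp _] := pv.
apply: (@place_le1 R L p v x (map_poly (intr : int -> rat) P)) => //.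
- exact: monic_map.
- rewrite -map_poly_comp (_ : map_poly _ P = map_poly (intr : int -> L) P) //.
  by apply: eq_map_poly => k /=; rewrite -[LHS]/(in_alg L _) rmorph_int.
by move=> i; rewrite coef_map /= denq_int dvdn1; apply: contraTneq pp => ->.
Qed.

Lemma integral_basis_integral (L : fieldExtType rat) (e : (\dim {:L}).-tuple L) i :
  integral_basis e -> integralOver (intr : int -> L) (tnth e i).
Proof.
move=> [_ he]; apply/he; exists (fun j => (j == i)%:R).
rewrite (bigD1 i) //= eqxx mulr1z big1 ?addr0 // => j /negPf ->.
by rewrite mulr0z.
Qed.

Lemma ultra_det_le1 (R : realType) (M : fieldExtType rat) (w : M -> R) n (A : 'M[M]_n) :
  absolute_value w -> ultrametric w -> (forall i j, w (A i j) <= 1) -> w (\det A) <= 1.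
Proof.
move=> aw uw hA; apply: ultra_sum_le => // s _.
rewrite absM // absX // absN // abs1 // expr1n mul1r abs_prod //.
by apply: prodr_ile1 => i _; rewrite abs_ge0 //=.
Qed.

(** * Unramified subfields and inertia *)

Section Splitting.
Variables (R : realType) (M : splittingFieldType rat) (p : nat).
Implicit Types (w : M -> R) (E : {subfield M}) (s g : gal_of {:M}).

Lemma place_over_gal u w s : place_over u w -> place_over u (w \o s).
Proof. exact: place_over_comp. Qed.

(* Over the valuation ring of [w], the integral elements [x] of [E] separate the identity
   from the other embeddings of [E] into [M]: this is how unramifiedness is used. *)
Definition splits_at w E : Prop := exists (I : finType) (x c : I -> M),
  [/\ forall b, x b \in E, forall b s, w (s (x b)) <= 1, forall b, w (c b) <= 1 &
      forall s, \sum_b c b * s (x b) = (s \in 'Gal({:M} / E)%g)%:R].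

(** Products of separating elements separate for the compositum, as an automorphism fixes it exactly
    when it fixes both factors. *)
Lemma splits_at_prodv w (E1 E2 : {subfield M}) : absolute_value w ->
  splits_at w E1 -> splits_at w E2 -> splits_at w (E1 * E2)%AS.
Proof.
move=> aw [I [x [c [xE xs cs xc]]]] [J [y [d [yE ys ds yd]]]].
have le1 a b : w a <= 1 -> w b <= 1 -> w (a * b) <= 1.
  by move=> a1 b1; rewrite absM // -[leRHS]mulr1 ler_pM ?abs_ge0.
exists (I * J)%type, (fun k => x k.1 * y k.2), (fun k => c k.1 * d k.2); split.
- by move=> [i j] /=; apply: memv_mul.
- by move=> [i j] s /=; rewrite rmorphM; apply: le1; [exact: xs|exact: ys].
- by move=> [i j] /=; rewrite le1.
move=> s; rewrite -(pair_bigA _ (fun i j => c i * d j * s (x i * y j))) /=.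
have -> : s \in 'Gal({:M} / E1 * E2)%g = (s \in 'Gal({:M} / E1)%g) && (s \in 'Gal({:M} / E2)%g).
  apply/idP/andP => [sE|[/mem_galP s1 /mem_galP s2]].
    split; apply/mem_galP => a aE; apply: (mem_galP _ _ sE).
      by rewrite -[a]mulr1 memv_mul ?mem1v.
    by rewrite -[a]mul1r memv_mul ?mem1v.
  apply/mem_galP => a aE; have : (E1 * E2 <= fixedField [set s]%SET)%VS.
    apply: prodv_sub; apply/subvP => b bE; apply/fixedFieldP; rewrite ?memvf //.
      by move=> s'; rewrite inE => /eqP->; apply: s1.
    by move=> s'; rewrite inE => /eqP->; apply: s2.
  by move/subvP/(_ a aE)/fixedFieldP; apply; rewrite ?memvf ?inE.
rewrite -mulnb natrM -xc -yd mulr_suml; apply: eq_bigr => i _.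
by rewrite mulr_sumr; apply: eq_bigr => j _; rewrite rmorphM mulrACA.
Qed.

Definition inertia w g : Prop := forall x, w x <= 1 -> w (g x - x) < 1.

(** If [g] moved [E], the separating sums at [g] and at the identity would be 0 and 1, yet inertia
    makes their difference smaller than 1 in absolute value. *)
Lemma inertia_fixes w E g : absolute_value w -> ultrametric w -> splits_at w E -> inertia w g ->
  {in E, forall x, g x = x}.
Proof.
move=> aw uw [I [x [c [xE xs cs xc]]]] ig; apply/mem_galP.
apply: contraT => gE; have x1 b : w (x b) <= 1.
  by have := xs b 1%g; rewrite gal_id.
have : w (\sum_b c b * g (x b) - \sum_b c b * x b) < 1.
  rewrite -sumrB; apply: ultra_sum_lt => // b _; rewrite -mulrBr absM //.
  by apply: le_lt_trans (ig _ (x1 b)); rewrite ler_piMl ?abs_ge0.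
have -> : \sum_b c b * x b = 1.
  transitivity (\sum_b c b * (1%g : gal_of {:M}) (x b)).
    by apply: eq_bigr => b _; rewrite gal_id.
  by rewrite xc group1.
by rewrite xc (negPf gE) sub0r absN // abs1 // ltxx.
Qed.

(** The [s] to be made small are those for which [w \o s] and [w] differ on [E]; [artin_whaples]
    gives [y] in [E] large at [w] and small at all these. *)
Lemma place_approx w E (eps : gal_of {:M} -> R) : place_over (Some p) w ->
  (forall s, 0 < eps s) -> exists z, [/\ z \in E, w z = 1 &
    forall s, (exists2 y, y \in E & w (s y) != w y) -> w (s z) < eps s].
Proof.
move=> pw eps0; have [aw _ _] := pw; have uw := place_over_ultrametric pw.
pose bad s := `[< exists2 y, y \in E & w (s y) != w y >].
pose S := [seq s <- enum {: gal_of {:M}} | bad s].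
have [|v|y yE [y1 hy]] := @artin_whaples R M E w [seq (w \o s : M -> R) | s : gal_of {:M} <- S] aw.
- have [a a1] := place_over_gt1 pw; exists a%:A => //.
  by rewrite rpredZ ?mem1v.
- move=> /mapP[s]; rewrite mem_filter => /andP[/asboolP[y yE ys] _] ->.
  have pws := place_over_gal s pw; split; first by case: pws.
  exact: (@place_separate _ _ E (Some p) (w \o s) w y).
have [n hn] : exists n, forall s, s \in S -> w (s y) ^+ n.+1 < Num.min 1 (eps s).
  have : \forall n \near \oo, forall s, s \in S -> w (s y) ^+ n < Num.min 1 (eps s).
    apply: near_all_seq => s sS; apply: near_expr_lt; rewrite ?abs_ge0 ?lt_min ?ltr01 //=.
    by apply: (hy (w \o s)); apply: map_f.
  by case=> n _ hn; exists n => s; apply: hn => /=.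
have yn : 1 < w (y ^+ n.+1) by rewrite absX // exprn_egt1.
have wy : w (1 + y ^+ n.+1) = w (y ^+ n.+1) by rewrite ultra_eq // abs1.
(* Numerator and denominator have equal size where [y] is large; where [y ^+ n.+1] is below 1, the
   denominator has absolute value 1 and the quotient is as small as the numerator. *)
exists (y ^+ n.+1 / (1 + y ^+ n.+1)); split.
- by rewrite rpred_div ?rpredX // rpredD ?rpred1 // rpredX.
- by rewrite absM // absV // wy divff // gt_eqF // (lt_trans ltr01).
move=> s hs; have sS : s \in S by rewrite mem_filter mem_enum andbT; apply/asboolP.
have [aws _ _] := place_over_gal s pw; have uws := place_over_ultrametric (place_over_gal s pw).
have := hn s sS; rewrite lt_min => /andP[l1 l2].
rewrite -[w _]/((w \o s) _) absM // absV // addrC ultra_eq // ?abs1 //.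
  by rewrite divr1 absX.
by rewrite absX.
Qed.

(* A uniformizer of [E] can be chosen close to 0 at the other places; its coordinates in
   the splitting relation are then traces in [p Z_(p)]. *)
Lemma splits_at_discrete w E y : place_over (Some p) w -> splits_at w E -> y \in E ->
  w y < 1 -> w y <= p%:R^-1.
Proof.
move=> pw [I [x [c [xE xs cs xc]]]] yE y1.
have [aw pp wq] := pw; have uw := place_over_ultrametric pw.
have [|z [zE z1 hz]] := @place_approx w E (fun s => (1 + w (s y))^-1) pw.
  by move=> s; rewrite invr_gt0 ltr_pwDl ?abs_ge0.
have yz s : w (s (y * z)) < 1.
  rewrite rmorphM absM //.
  have [h|h] := pselect (exists2 y, y \in E & w (s y) != w y).
    have y0 := abs_ge0 aw (s y); have hs := hz s h.
    have : w (s z) * (1 + w (s y)) < 1 by rewrite -ltr_pdivlMr ?mul1r // ltr_pwDl.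
    by have := abs_ge0 aw (s z); lra.
  have e a : a \in E -> w (s a) = w a.
    by move=> aE; apply/eqP; apply: contrapT => /negP ne; apply: h; exists a.
  by rewrite !e // z1 mulr1.
pose f : {rmorphism subvs_of E -> M} := vsval.
have [t [zeta [_ tinj tex]]] := embeddings f.
have [a0 ha0] := tex 1%g.
pose T b := \sum_a t a (y * z * x b).
have T1 b : w (T b) <= p%:R^-1.
  have yzE : y * z * x b \in E by rewrite !rpredM.
  have -> : T b = (trace (Subvs yzE))%:A.
    by rewrite (trace_embeddings tinj).
  have : w (trace (Subvs yzE))%:A < 1.
    rewrite (trace_embeddings tinj); apply: ultra_sum_lt => // a _.
    rewrite /= rmorphM absM //; apply: le_lt_trans (yz (t a)).
    by apply: ler_piMr; [exact: abs_ge0|exact: xs].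
  by rewrite wq; apply: padic_abs_lt1_le.
have -> : w y = w (y * z) by rewrite absM // z1 mulr1.
have -> : y * z = \sum_b c b * T b.
  under eq_bigr do rewrite /T mulr_sumr.
  rewrite exchange_big /=.
  have e a : \sum_b c b * t a (y * z * x b) = t a (y * z) * (a == a0)%:R.
    have -> : (a == a0)%:R = (t a \in 'Gal({:M} / E)%g)%:R :> M.
      congr (nat_of_bool _)%:R; apply/eqP/mem_galP => [-> u uE|ta].
        by have := ha0 (Subvs uE); rewrite gal_id /=.
      apply: tinj; have := ha0 zeta; rewrite gal_id => <-.
      by apply: ta; apply: subvsP.
    by rewrite -xc mulr_sumr; apply: eq_bigr => b _; rewrite rmorphM mulrCA.
  under eq_bigr do rewrite e.
  rewrite (bigD1 a0) //= eqxx mulr1 big1 ?addr0 => [|a /negPf->]; last by rewrite mulr0.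
  have yzE : y * z \in E by rewrite rpredM.
  by have := ha0 (Subvs yzE); rewrite gal_id.
apply: ultra_sum_le => // b _.
by rewrite absM // -[leRHS]mul1r ler_pM ?abs_ge0.
Qed.

(** The embedding matrix of an integral basis has the discriminant as squared determinant, of
    absolute value 1 at [w]. By Cramer's rule its inverse is integral, and the column of the
    identity embedding gives the coefficients [c]. *)
Lemma unramified_splits_at (L : fieldExtType rat) (f : {rmorphism L -> M}) w E :
  place_over (Some p) w -> (forall y, y \in E <-> exists x, y = f x) ->
  ~~ (p%:Z %| discriminant L)%Z -> splits_at w E.
Proof.
move=> pw Ef pD; have [aw pp wq] := pw; have uw := place_over_ultrametric pw.
have D0 : discriminant L != 0 by apply: contraNneq pD => ->; rewrite dvdz0.
have [t [z [_ tinj tex]]] := embeddings f.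
have [e be De] := discriminant_embeddings tinj D0.
set S := \matrix_(a, b) _ in De.
have Sle1 a b : w (S a b) <= 1.
  rewrite mxE -[w _]/((w \o t a \o f) (tnth e b)); apply: (@integral_abs_le1 _ _ p).
    by do 2!apply: place_over_comp.
  exact: integral_basis_integral.
have wD : w (\det S) = 1.
  apply/eqP; rewrite eq_le ultra_det_le1 //= leNgt; apply: contra pD => d1.
  rewrite -(padic_abs_int_lt1 R pp) -[padic_abs _ _ _]/(usual_abs R (Some p) _) -wq.
  rewrite -[_%:A]/(in_alg M _) rmorph_int De absX // expr2.
  by rewrite mulr_ilt1 ?abs_ge0.
have Su : S \in unitmx by rewrite unitmxE unitfE -(abs_eq0 aw) wD oner_eq0.
have [a0 ha0] := tex 1%g.
have Vle1 a b : w (invmx S a b) <= 1.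
  rewrite /invmx Su !mxE absM // absV // wD invr1 mul1r /cofactor absM // absX // absN // abs1 //.
  rewrite expr1n mul1r; apply: ultra_det_le1 => // i j.
  by rewrite mxE mxE.
exists 'I_(\dim {:L}), (fun b => f (tnth e b)), (fun b => invmx S b a0); split => //.
- by move=> b; apply/Ef; exists (tnth e b).
- move=> b s; have [a sa] := tex s; rewrite sa.
  by have := Sle1 a b; rewrite mxE.
move=> s; have [a sa] := tex s.
have -> : (s \in 'Gal({:M} / E)%g) = (a == a0).
  apply/mem_galP/eqP => [sE|aa y /Ef[x ->]].
    apply: tinj; rewrite -sa -ha0 gal_id; apply: sE; apply/Ef.
    by exists z.
  by rewrite sa aa -ha0 gal_id.
have := congr1 (fun B : 'M[M]_(\dim {:L}) => B a a0) (mulmxV Su).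
rewrite !mxE => <-; apply: eq_bigr => b _; rewrite !mxE mulrC.
by rewrite sa.
Qed.

End Splitting.

(** * Gauss norms *)

Section SubringPredicate.

(** Subrings are [Prop]-valued here so as to cover [integralOver], [conj_integral] and polynomials
    over either. *)
Definition is_subring (A : comNzRingType) (B : A -> Prop) : Prop :=
  [/\ B 1, forall x y, B x -> B y -> B (x - y) & forall x y, B x -> B y -> B (x * y)].

Variables (A : comNzRingType) (B : A -> Prop).
Hypothesis sB : is_subring B.

Lemma subring_1 : B 1. Proof. by case: sB. Qed.
Lemma subring_M x y : B x -> B y -> B (x * y). Proof. by case: sB => _ _; apply. Qed.
Lemma subring_B x y : B x -> B y -> B (x - y). Proof. by case: sB => _ h _; apply: h. Qed.
Lemma subring_0 : B 0. Proof. by rewrite -(subrr 1); apply: subring_B; apply: subring_1. Qed.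
Lemma subring_N x : B x -> B (- x).
Proof. by rewrite -sub0r => Bx; apply: subring_B => //; apply: subring_0. Qed.
Lemma subring_D x y : B x -> B y -> B (x + y).
Proof. by move=> Bx By; rewrite -[y]opprK; apply/subring_B/subring_N. Qed.

Lemma subring_sum I (r : seq I) (P : pred I) (F : I -> A) :
  (forall i, P i -> B (F i)) -> B (\sum_(i <- r | P i) F i).
Proof. by move=> BF; elim/big_ind: _ => //; [apply: subring_0|apply: subring_D]. Qed.

Lemma subring_prod I (r : seq I) (P : pred I) (F : I -> A) :
  (forall i, P i -> B (F i)) -> B (\prod_(i <- r | P i) F i).
Proof. by move=> BF; elim/big_ind: _ => //; [apply: subring_1|apply: subring_M]. Qed.

Lemma subring_X x k : B x -> B (x ^+ k).
Proof. by move=> Bx; elim: k => [|k IHk]; rewrite ?exprS; [apply: subring_1|apply: subring_M]. Qed.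

Lemma subring_det n (S : 'M[A]_n) : (forall i j, B (S i j)) -> B (\det S).
Proof.
move=> BS; apply: subring_sum => s _; apply: subring_M; last by apply: subring_prod.
by apply: subring_X; apply: subring_N; apply: subring_1.
Qed.

Definition poly_over_subring (P : {poly A}) : Prop := forall i, B P`_i.

Lemma poly_over_subringP : is_subring poly_over_subring.
Proof.
split=> [i|P Q BP BQ i|P Q BP BQ i].
- by rewrite coef1; case: (i == _); [apply: subring_1|apply: subring_0].
- by rewrite coefB; apply: subring_B.
by rewrite coefM; apply: subring_sum => j _; apply: subring_M.
Qed.

End SubringPredicate.

Section GaussNorm.
Variables (R : realType) (M : fieldExtType rat) (w : M -> R).
Hypotheses (aw : absolute_value w) (uw : ultrametric w).

Implicit Types P Q : {poly M}.

Definition gnorm P : R := \big[Num.max/0]_(i < size P) w P`_i.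

Lemma gnorm_ge0 P : 0 <= gnorm P.
Proof.
rewrite /gnorm; elim/big_ind: _ => // [x y x0 y0|i _]; last exact: abs_ge0.
by rewrite le_max x0.
Qed.

Lemma gnorm_ge_coef P i : w P`_i <= gnorm P.
Proof.
have [iP|iP] := ltnP i (size P); first exact: (le_bigmax _ (fun j : 'I_(size P) => w P`_j) (Ordinal iP)).
by rewrite nth_default // abs0 // gnorm_ge0.
Qed.

Lemma gnorm_le P c : 0 <= c -> (forall i, w P`_i <= c) -> gnorm P <= c.
Proof.
move=> c0 Pc; rewrite /gnorm; elim/big_ind: _ => // x y xc yc.
by rewrite ge_max xc.
Qed.

Lemma gnorm_lt P c : 0 < c -> (forall i, w P`_i < c) -> gnorm P < c.
Proof.
move=> c0 Pc; rewrite /gnorm; elim/big_ind: _ => // x y xc yc.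
by rewrite gt_max xc.
Qed.

Lemma gnorm_polyC (c : M) : gnorm c%:P = w c.
Proof.
apply/eqP; rewrite eq_le; apply/andP; split; last first.
  by have := gnorm_ge_coef c%:P 0; rewrite coefC.
apply: gnorm_le => [|i]; first exact: abs_ge0.
by rewrite coefC; case: ifP => // _; rewrite abs0 // abs_ge0.
Qed.

Lemma gnorm_attained P : exists i, w P`_i = gnorm P /\ forall j, (j < i)%N -> w P`_j < gnorm P.
Proof.
have ex : exists i, `[< w P`_i = gnorm P >].
  apply: contrapT => no; have hlt i : w P`_i < gnorm P.
    rewrite lt_neqAle gnorm_ge_coef andbT; apply/eqP => e; apply: no.
    by exists i; apply/asboolP.
  have g0 : 0 < gnorm P by apply: le_lt_trans (hlt 0%N); apply: abs_ge0.
  by have := gnorm_lt g0 hlt; rewrite ltxx.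
have [i /asboolP ie imin] := ex_minnP ex; exists i; split=> // j ji.
rewrite lt_neqAle gnorm_ge_coef andbT; apply/eqP => e.
by have := imin j; rewrite leqNgt ji => h; have : false by apply/h/asboolP.
Qed.

(** Gauss's lemma: if [i] and [j] are the least indices where [P] and [Q] attain their norms, the
    coefficient of index [i + j] of the product has a single dominant term. *)
Lemma gnormM P Q : gnorm (P * Q) = gnorm P * gnorm Q.
Proof.
apply/eqP; rewrite eq_le; apply/andP; split.
  apply: gnorm_le => [|i]; first by rewrite mulr_ge0 ?gnorm_ge0.
  rewrite coefM; apply: ultra_sum_le => // [|j _]; first by rewrite mulr_ge0 ?gnorm_ge0.
  by rewrite absM // ler_pM ?abs_ge0 ?gnorm_ge_coef.
have [i [ie ilt]] := gnorm_attained P; have [j [je jlt]] := gnorm_attained Q.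
have [PQ0|] := ltP 0 (gnorm P * gnorm Q); last first.
  by move=> h; apply: le_trans h _; apply: gnorm_ge0.
have P0 : 0 < gnorm P by rewrite lt_neqAle gnorm_ge0 andbT; apply: contraTneq PQ0 => <-; rewrite mul0r ltxx.
have Q0 : 0 < gnorm Q by rewrite lt_neqAle gnorm_ge0 andbT; apply: contraTneq PQ0 => <-; rewrite mulr0 ltxx.
have ij : (i < (i + j).+1)%N by rewrite ltnS leq_addr.
apply: le_trans (gnorm_ge_coef _ (i + j)).
rewrite coefM (bigD1 (Ordinal ij)) //= addKn.
have e : w (P`_i * Q`_j) = gnorm P * gnorm Q by rewrite absM // ie je.
rewrite addrC ultra_eq // ?e //; apply: ultra_sum_lt => // k kij.
rewrite absM //; have [ki|ik|ki] := ltngtP k i.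
- apply: le_lt_trans (_ : w P`_k * gnorm Q < _); first by rewrite ler_wpM2l ?abs_ge0 ?gnorm_ge_coef.
  by rewrite ltr_pM2r // ilt.
- apply: le_lt_trans (_ : gnorm P * w Q`_(i + j - k) < _); first by rewrite ler_wpM2r ?abs_ge0 ?gnorm_ge_coef.
  rewrite ltr_pM2l // jlt // ltn_subLR; last by rewrite -ltnS ltn_ord.
  by rewrite ltn_add2r.
by case/eqP: kij; apply: val_inj.
Qed.

Lemma gnorm_prod I (r : seq I) (P : pred I) (F : I -> {poly M}) :
  gnorm (\prod_(i <- r | P i) F i) = \prod_(i <- r | P i) gnorm (F i).
Proof.
by rewrite (big_morph gnorm gnormM (_ : gnorm 1 = 1)) // gnorm_polyC abs1.
Qed.

Lemma gnorm_XsubC (a : M) : gnorm ('X - a%:P) = Num.max 1 (w a).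
Proof.
apply/eqP; rewrite eq_le; apply/andP; split.
  apply: gnorm_le => [|i]; first by rewrite le_max ler01.
  rewrite coefB coefX coefC; case: eqP => [->|_].
    by rewrite subr0 abs1 // le_max lexx.
  by rewrite sub0r absN //; case: eqP => _; rewrite ?abs0 // le_max ?lexx ?ler01 ?orbT.
rewrite ge_max; apply/andP; split.
  by have := gnorm_ge_coef ('X - a%:P) 1; rewrite coefB coefX coefC subr0 abs1.
by have := gnorm_ge_coef ('X - a%:P) 0; rewrite coefB coefX coefC sub0r absN.
Qed.

End GaussNorm.

(** * Ramified primes and inertia *)

Lemma integral_scale (L : fieldExtType rat) (q : {poly rat}) (m : nat) (x : L) :
  q \is monic -> root (map_poly (in_alg L) q) x -> (0 < m)%N ->
  (forall i, `|denq q`_i| %| m)%N -> integralOver (intr : int -> L) (m%:R * x).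
Proof.
move=> mq rx m0 dm; pose d := (size q).-1.
have sq : size q = d.+1 by rewrite prednK // size_poly_gt0 monic_neq0.
(* Scaling the root by [m] multiplies the coefficient of index [i] by [m ^ (d - i)]; one of these
   factors clears its denominator. *)
pose k i : int := numq q`_i * (m %/ `|denq q`_i|)%N * (m ^ (d - i.+1))%N.
have kE i : (i < d)%N -> (k i)%:~R = (q`_i)%:A * m%:R ^+ (d - i) :> L.
  move=> id; have : (k i)%:~R = q`_i * m%:R ^+ (d - i) :> rat.
    rewrite /k !rmorphM /= -[in RHS](divq_num_den q`_i).
    have dq : `|denq q`_i|%N%:R = (denq q`_i)%:~R :> rat.
      by rewrite -[in RHS](gtz0_abs (denq_gt0 q`_i)).
    have mE : m%:R = (m %/ `|denq q`_i|)%N%:R * (denq q`_i)%:~R :> rat.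
      by rewrite -dq -natrM divnK.
    have d0 : (denq q`_i)%:~R != 0 :> rat by rewrite intr_eq0 denq_eq0.
    have iN (a : nat) : (a%:Z)%:~R = a%:R :> rat by [].
    rewrite !iN -(subnSK id) exprS natrX {2}mE mulrA; congr (_ * _).
    by rewrite [X in _ = _ * X]mulrC mulrA divfK.
  move/(congr1 (in_alg L)); rewrite rmorph_int => ->.
  by rewrite rmorphM rmorphXn rmorph_nat.
pose P : {poly int} := 'X^d + \poly_(i < d) k i.
have sP : (size (\poly_(i < d) k i) < size ('X^d : {poly int}))%N.
  by rewrite size_polyXn ltnS size_poly.
exists P; first by rewrite monicE lead_coefDl // lead_coefXn.
rewrite /root /P rmorphD /= map_polyXn hornerD hornerXn.
rewrite (@horner_coef_wide _ d); last exact: leq_trans (size_poly _ _) (size_poly _ _).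
have -> : \sum_(i < d) (map_poly intr (\poly_(i < d) k i))`_i * (m%:R * x) ^+ i =
    m%:R ^+ d * \sum_(i < d) (q`_i)%:A * x ^+ i.
  rewrite mulr_sumr; apply: eq_bigr => i _.
  rewrite coef_map coef_poly ltn_ord /= kE //.
  have -> : m%:R ^+ d = m%:R ^+ (d - i) * m%:R ^+ i :> L by rewrite -exprD subnK // ltnW.
  by rewrite exprMn; ring.
have sz : (size (map_poly (in_alg L) q) <= d.+1)%N by rewrite size_map_poly sq.
move/rootP: rx; rewrite (horner_coef_wide _ sz) big_ord_recr /=.
rewrite coef_map /= -[q`_d]/(lead_coef q) (monicP mq) scale1r mul1r => /eqP.
rewrite addr_eq0 => /eqP e.
have -> : \sum_(i < d) (q`_i)%:A * x ^+ i = - x ^+ d.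
  by rewrite -e; apply: eq_bigr => i _; rewrite coef_map.
by rewrite exprMn mulrN subrr.
Qed.

Lemma padic_abs_le1_denq (R : realType) p (q : rat) : prime p -> padic_abs R p q <= 1 ->
  ~~ (p %| `|denq q|)%N.
Proof.
move=> pp q1; have := padic_abs_denq R pp q; rewrite maxEle.
have -> : (1 <= padic_abs R p q) = (padic_abs R p q == 1) by rewrite eq_le q1.
have -> : (if padic_abs R p q == 1 then padic_abs R p q else 1) = 1 by case: eqP.
move=> h; apply/negP => pd; move: h; apply/negP; rewrite -ltNge exprn_egt1 ?ltr1n ?prime_gt1 //.
by rewrite -lt0n logn_gt0 mem_primes pp absz_gt0 denq_eq0.
Qed.

Section Ramified.
Variables (R : realType) (M : splittingFieldType rat) (p : nat) (w : M -> R).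
Hypothesis pw : place_over (Some p) w.
Implicit Types (s g h : gal_of {:M}).

Let aw : absolute_value w. Proof. by case: pw. Qed.
Let uw : ultrametric w. Proof. exact: place_over_ultrametric pw. Qed.
Let pp : prime p. Proof. by case: pw. Qed.

(** Integrality at all places over [p] at once, which unlike [w x <= 1] is stable under the Galois
    group. *)
Definition conj_integral (x : M) : Prop := forall s, w (s x) <= 1.

Lemma conj_integral_subring : is_subring conj_integral.
Proof.
split=> [s|x y xB yB s|x y xB yB s].
- by rewrite rmorph1 abs1.
- by rewrite rmorphB; apply: le_trans (ultra_leB aw uw _ _) _; rewrite ge_max; apply/andP; split; [exact: xB|exact: yB].
by rewrite rmorphM absM // -[leRHS]mulr1 ler_pM ?abs_ge0 //; [exact: xB|exact: yB].
Qed.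

Lemma conj_integral_gal x s : conj_integral x -> conj_integral (s x).
Proof. by move=> xB s'; rewrite -galMf. Qed.

Variables (L : fieldExtType rat) (f : {rmorphism L -> M}).

(** The characteristic polynomial of [x] has p-integral rational coefficients, so a multiplier prime
    to [p] clears its denominators. *)
Lemma conj_integral_scale (x : L) : conj_integral (f x) ->
  exists2 m : nat, ~~ (p %| m)%N & integralOver (intr : int -> L) (m%:R * x).
Proof.
move=> xB; have [t [z [_ tinj tex]]] := embeddings f.
pose Q : {poly M} := \prod_a ('X - (t a (f x))%:P).
have Qfix s : map_poly s Q = Q.
  have /choice[pi hpi] a : exists b, forall y, s (t a (f y)) = t b (f y).
    by have [b hb] := tex (t a * s)%g; exists b => y; rewrite -hb galMf.
  have pinj : injective pi.
    move=> a b ab; apply: tinj.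
    have e : s (t a (f z)) = s (t b (f z)) by rewrite hpi ab -hpi.
    exact: fmorph_inj e.
  rewrite rmorph_prod [RHS](reindex_inj pinj) /=; apply: eq_bigr => a _.
  by rewrite rmorphB /= map_polyX map_polyC /= hpi.
have /polyOver1P[q qE] : Q \is a polyOver 1%VS.
  apply/polyOverP => i; have [s|c ->] := @gal_fixed_rat M Q`_i; last by rewrite rpredZ ?mem1v.
  by have := congr1 (fun P : {poly M} => P`_i) (Qfix s); rewrite coef_map.
have mq : q \is monic by rewrite -(map_monic (in_alg M)) -qE monic_prod_XsubC.
have q1 i : padic_abs R p q`_i <= 1.
  have [_ _ wq] := pw; rewrite -[padic_abs _ _ _]/(usual_abs R (Some p) _) -wq.
  have -> : (q`_i)%:A = Q`_i by rewrite qE coef_map.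
  apply: le_trans (gnorm_ge_coef aw _ _) _; rewrite gnorm_prod //.
  rewrite big1 // => a _; rewrite gnorm_XsubC //; apply/eqP; rewrite eq_maxl.
  exact: xB.
pose m := (\prod_(i < size q) `|denq q`_i|)%N.
exists m.
  rewrite /m; elim/big_ind: _ => [|a b na nb|i _].
  - by rewrite dvdn1; apply: contraTneq pp => ->.
  - by rewrite Euclid_dvdM // negb_or na.
  exact: padic_abs_le1_denq (q1 i).
apply: (@integral_scale L q) => //.
- have [a ha] := tex 1%g; have : root Q (f x).
    by rewrite /Q /root horner_prod (bigD1 a) //= hornerXsubC -ha gal_id subrr mul0r.
  rewrite qE => rQ; rewrite -(fmorph_root f) -map_poly_comp.
  rewrite (_ : map_poly _ q = map_poly (in_alg M) q) //.
  by apply: eq_map_poly => c /=; rewrite rmorph_ratA.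
- by rewrite prodn_gt0 // => i; rewrite absz_gt0 denq_eq0.
move=> i; have [iq|iq] := ltnP i (size q).
  by rewrite /m (bigD1 (Ordinal iq)) //= dvdn_mulr.
by rewrite nth_default.
Qed.

Section CongruentEmbeddings.
Let n : nat := \dim {:L}.
Variables (t : 'I_n -> gal_of {:M}) (z : L).
Hypothesis tinj : injective (fun a => t a (f z)).

(* With [xi = \sum_b e_b X^b] for an integral basis [e], the product of the differences of
   the conjugates of [xi] is a Vandermonde determinant, hence a multiple in Z[X] of
   [det (t_a (f e_b))], whose square is the discriminant. *)
Lemma congruent_embeddings : discriminant L != 0 -> (p%:Z %| discriminant L)%Z ->
  exists a b, a != b /\ forall x, integralOver (intr : int -> L) x -> w (t a (f x) - t b (f x)) < 1.
Proof.
move=> D0 pD; have [e be De] := discriminant_embeddings tinj D0.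
have [_ _ wq] := pw; set S := \matrix_(a, b) _ in De.
have wS : w (\det S) < 1.
  have : w (\det S) ^+ 2 < 1.
    by rewrite -absX // -De -(rmorph_int (in_alg M)) wq /= padic_abs_int_lt1.
  by rewrite expr_lt1 ?abs_ge0.
have [_ he] := be; have ei c : integralOver (intr : int -> L) (tnth e c) by exact: integral_basis_integral.
pose xi : {poly L} := \sum_(b < n) tnth e b *: 'X^b.
have xic (b : 'I_n) : xi`_b = tnth e b.
  rewrite coef_sum (bigD1 b) //= coefZ coefXn eqxx mulr1 big1 ?addr0 // => c cb.
  by rewrite coefZ coefXn -(inj_eq val_inj) eq_sym in cb *; rewrite (negPf cb) mulr0.
have iS : is_subring (integralOver (intr : int -> L)).
  split; [exact: integral1|exact: integral_sub|exact: integral_mul].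
have xiX j k : integralOver (intr : int -> L) (xi ^+ j)`_k.
  apply: (subring_X (poly_over_subringP iS)) => i; rewrite coef_sum.
  apply: subring_sum => // b _; rewrite coefZ coefXn; apply: subring_M => //.
  by case: (i == b); [apply: subring_1|apply: subring_0].
have /choice[Z hZ] jk : exists c : 'I_n -> int, (xi ^+ jk.1)`_(jk.2) = \sum_b tnth e b *~ c b.
  by apply/he; apply: xiX.
pose C := \matrix_(b < n, j < n) \poly_(k < size (xi ^+ j)) ((Z (val j, k) b)%:~R : M).
pose xia a := map_poly (t a \o f) xi.
have VE : \matrix_(a < n, j < n) (xia a) ^+ j = map_mx polyC S *m C.
  apply/matrixP => a j; rewrite !mxE; apply/polyP => k.
  rewrite /xia -rmorphXn coef_map coef_sum /=.
  under eq_bigr do rewrite !mxE coefCM coef_poly.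
  have [kj|kj] := ltnP k (size (xi ^+ j)); last first.
    by rewrite nth_default // !rmorph0 big1 // => b _; rewrite mulr0.
  rewrite (hZ (val j, k)) !rmorph_sum; apply: eq_bigr => b _ /=.
  by rewrite !rmorphMz -mulrzr.
have gC : gnorm w (\det C) <= 1.
  have sub : is_subring (fun x : M => w x <= 1).
    split=> [|x y x1 y1|x y x1 y1]; first by rewrite abs1.
      by apply: le_trans (ultra_leB aw uw _ _) _; rewrite ge_max x1.
    by rewrite absM // -[leRHS]mulr1 ler_pM ?abs_ge0.
  apply: gnorm_le => // i; apply: (subring_det (poly_over_subringP sub)) => b j k.
  rewrite mxE coef_poly; case: ifP => _; last by rewrite abs0.
  rewrite -(rmorph_int (in_alg M)) wq; exact: padic_abs_int_le1.
have : gnorm w (\det (\matrix_(a < n, j < n) (xia a) ^+ j)) < 1.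
  rewrite VE det_mulmx gnormM // det_map_mx gnorm_polyC //.
  by apply: le_lt_trans wS; rewrite ler_piMr ?abs_ge0.
have -> : \matrix_(a < n, j < n) (xia a) ^+ j = (Vandermonde n (\row_a xia a))^T.
  by apply/matrixP => a i; rewrite !mxE.
rewrite det_tr det_Vandermonde gnorm_prod // => g1.
have [a [b [ab gab]]] : exists a b : 'I_n, a != b /\ gnorm w (xia a - xia b) < 1.
  apply: contrapT => no; move: g1; apply/negP; rewrite -leNgt.
  elim/big_ind: _ => // [x y x1 y1|b _]; first by rewrite -[leLHS]mulr1 ler_pM.
  rewrite gnorm_prod //; elim/big_ind: _ => // [x y x1 y1|a ba]; first by rewrite -[leLHS]mulr1 ler_pM.
  rewrite !mxE leNgt; apply/negP => lt; apply: no; exists a, b; split=> //.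
  by apply: contraTneq ba => ->; rewrite ltnn.
exists a, b; split=> // x /he[c ->].
rewrite !rmorph_sum -sumrB; apply: ultra_sum_lt => // i _.
rewrite !rmorphMz -mulrzBl -mulrzr absM // -(rmorph_int (in_alg M)) wq.
apply: le_lt_trans (_ : w (t a (f (tnth e i)) - t b (f (tnth e i))) < _).
  by rewrite ler_piMr ?abs_ge0 // padic_abs_int_le1.
apply: le_lt_trans gab; have := gnorm_ge_coef aw (xia a - xia b) i.
by rewrite coefB !coef_map /= xic.
Qed.

End CongruentEmbeddings.

Variable (E : {subfield M}).
Hypothesis Ef : forall y, (y \in E) <-> exists x, y = f x.
Local Notation H := ('Gal({:M} / E)%g).

(* If no [h] worked for all [x], take a polynomial [xi] having as coefficients a
   counterexample for each [h]; then [\prod_h (s0 xi - s1 (h xi))] has Gauss norm 1,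
   although it is the value at [s0 xi] of [s1 F - s0 F], where [F = \prod_h (Y - h xi)]
   has its coefficients in [E]. *)
Lemma lift_congruence (s0 s1 : gal_of {:M}) :
  (forall x, integralOver (intr : int -> L) x -> w (s0 (f x) - s1 (f x)) < 1) ->
  exists2 h, h \in H & forall x, conj_integral x -> w (s0 x - s1 (h x)) < 1.
Proof.
move=> cong; have sB := conj_integral_subring.
have congB y : y \in E -> conj_integral y -> w (s0 y - s1 y) < 1.
  move=> /Ef[x ->] /conj_integral_scale[m pm /cong].
  rewrite !rmorphM !rmorph_nat -mulrBr absM //.
  have -> : w m%:R = 1; last by rewrite mul1r.
  have [_ _ wq] := pw; rewrite -(rmorph_nat (in_alg M)) wq /= -[m%:R]/(m%:Z%:~R).
  apply/eqP; rewrite eq_le padic_abs_int_le1 //= leNgt padic_abs_int_lt1 //.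
apply: contrapT => no.
have /choice[X hX] h : exists x, conj_integral x /\ (h \in H -> 1 <= w (s0 x - s1 (h x))).
  have [hH|hH] := boolP (h \in H); last by exists 0; split=> //; exact: (subring_0 sB).
  apply: contrapT => nox; apply: no; exists h => // x xB; rewrite ltNge; apply/negP => x1.
  by apply: nox; exists x.
pose xi : {poly M} := \sum_(h : gal_of {:M}) X h *: 'X^(enum_rank h).
have xic h : xi`_(enum_rank h) = X h.
  rewrite coef_sum (bigD1 h) //= coefZ coefXn eqxx mulr1 big1 ?addr0 // => g gh.
  rewrite coefZ coefXn (inj_eq val_inj) (inj_eq enum_rank_inj) eq_sym.
  by rewrite (negPf gh) mulr0.
have xiB : poly_over_subring conj_integral xi.
  move=> i; rewrite coef_sum; apply: (subring_sum sB) => h _; rewrite coefZ coefXn.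
  apply: (subring_M sB); first by case: (hX h).
  by case: (i == _); [apply: (subring_1 sB)|apply: (subring_0 sB)].
have mapB s P : poly_over_subring conj_integral P -> poly_over_subring conj_integral (map_poly s P).
  by move=> PB i; rewrite coef_map; apply: conj_integral_gal.
pose F : {poly {poly M}} := \prod_(h in H) ('X - (map_poly h xi)%:P).
have FB : poly_over_subring (poly_over_subring conj_integral) F.
  have sB1 := poly_over_subringP sB; have sB2 := poly_over_subringP sB1.
  apply: (subring_prod sB2) => h _ i; rewrite coefB coefX coefC; apply: (subring_B sB1).
    by case: (i == _); [apply: (subring_1 sB1)|apply: (subring_0 sB1)].
  by case: (i == _); [apply: mapB|apply: (subring_0 sB1)].
have Ffix h0 : h0 \in H -> map_poly (map_poly h0) F = F.
  move=> h0H; rewrite rmorph_prod [RHS](reindex_inj (mulIg h0)) /=.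
  apply: eq_big => h; first by rewrite groupMr.
  move=> _; rewrite rmorphB /= map_polyX map_polyC /=; congr (_ - _%:P).
  by rewrite -map_poly_comp; apply: eq_map_poly => x /=; rewrite galMf.
have FE i j : F`_i`_j \in E.
  apply: mem_galC => h hH; have := congr1 (fun P : {poly {poly M}} => P`_i`_j) (Ffix h hH).
  by rewrite !coef_map.
pose K := map_poly (map_poly s0) F - map_poly (map_poly s1) F.
have K1 i : gnorm w K`_i < 1.
  by apply: gnorm_lt => // j; rewrite coefB !coef_map coefB !coef_map /=; apply: congB; [exact: FE|exact: FB].
pose zeta := map_poly s0 xi.
have zeta1 : gnorm w zeta <= 1.
  by apply: gnorm_le => // j; rewrite coef_map /=; apply: xiB.
have Kz : gnorm w K.[zeta] < 1.
  apply: gnorm_lt => // j; rewrite horner_coef coef_sum; apply: ultra_sum_lt => // i _.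
  apply: le_lt_trans (gnorm_ge_coef aw _ _) _; rewrite gnormM //.
  apply: le_lt_trans (K1 i); rewrite ler_piMr ?gnorm_ge0 //.
  rewrite (_ : gnorm w (zeta ^+ i) = gnorm w zeta ^+ i).
    by rewrite exprn_ile1 ?gnorm_ge0.
  elim: (nat_of_ord i) => [|k IHk]; last by rewrite !exprS gnormM // IHk.
  by rewrite !expr0 gnorm_polyC // abs1.
have mapF s : (map_poly (map_poly s) F).[zeta] = \prod_(h in H) (zeta - map_poly s (map_poly h xi)).
  rewrite rmorph_prod horner_prod; apply: eq_bigr => h _.
  by rewrite rmorphB /= map_polyX map_polyC /= hornerXsubC.
have : gnorm w (\prod_(h in H) (zeta - map_poly s1 (map_poly h xi))) < 1.
  move: Kz; rewrite /K hornerD hornerN !mapF.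
  rewrite (bigD1 1%g) ?group1 //= (_ : zeta - _ = 0) ?mul0r ?sub0r.
    rewrite -mulN1r gnormM // (_ : gnorm w (-1) = 1) ?mul1r //.
    by rewrite -polyC1 -polyCN gnorm_polyC // absN // abs1.
  apply/eqP; rewrite subr_eq0 /zeta; apply/eqP; congr (map_poly _ _).
  by apply/polyP => i; rewrite coef_map /= gal_id.
rewrite gnorm_prod //; apply/negP; rewrite -leNgt.
elim/big_ind: _ => // [x y x1 y1|h hH]; first by rewrite -[leLHS]mulr1 ler_pM.
have [_ /(_ hH) h1] := hX h; apply: le_trans h1 _.
have := gnorm_ge_coef aw (zeta - map_poly s1 (map_poly h xi)) (enum_rank h).
by rewrite coefB !coef_map /= xic.
Qed.

(** Multiply [x] by some [z] that is a unit at [w] and small enough elsewhere to make both [z] and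
    [z * x] integral at every place over [p]; the congruences for these two give that for [x]. *)
Lemma inertia_of_conj_integral g : (forall x, conj_integral x -> w (g x - x) < 1) -> inertia w g.
Proof.
move=> hg x x1.
have [s|z [_ z1 hz]] := @place_approx R M p w {:M}%AS (fun s => (1 + w (s x))^-1) pw.
  by rewrite invr_gt0 ltr_pwDl ?abs_ge0.
have hs s : w (s z) <= 1 /\ w (s (z * x)) <= 1.
  have [h|h] := pselect (exists2 y, y \in {:M}%AS & w (s y) != w y); last first.
    have e a : w (s a) = w a.
      apply/eqP; apply: contrapT => /negP ne; apply: h; exists a; rewrite ?memvf //.
    by rewrite !e absM // z1 mul1r.
  have s0 := abs_ge0 aw (s x); have sz0 := abs_ge0 aw (s z).
  have : w (s z) * (1 + w (s x)) < 1 by rewrite -ltr_pdivlMr ?mul1r ?hz // ltr_pwDl.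
  have m0 : 0 <= w (s z) * w (s x) by rewrite mulr_ge0.
  by rewrite rmorphM absM // mulrDr mulr1 => l; split; lra.
have zB : conj_integral z by move=> s; case: (hs s).
have zxB : conj_integral (z * x) by move=> s; case: (hs s).
have gz : w (g z) = 1.
  by rewrite -(subrK z (g z)) ultra_eq ?z1 // hg.
rewrite -[w (g x - x)]mul1r -{1}gz -absM //.
have -> : g z * (g x - x) = (g (z * x) - z * x) - (g z - z) * x by rewrite rmorphM; ring.
apply: le_lt_trans (ultra_leB aw uw _ _) _; rewrite gt_max; apply/andP; split; first exact: hg.
rewrite absM //; apply: le_lt_trans (hg z zB).
by rewrite ler_piMr ?abs_ge0.
Qed.

(** Two embeddings [t a] and [t b] of [L] agree modulo [w] on integers. Once [t b] is corrected by
    some [h] fixing [E], the congruence holds on all of [M], so going back along [t a] and forward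
    along [h] and [t b] is inertia; it sends [t a (f z)] to [t b (f z)]. *)
Lemma ramified_inertia : discriminant L != 0 -> (p%:Z %| discriminant L)%Z ->
  exists g s, inertia w g /\ exists x, g (s (f x)) != s (f x).
Proof.
move=> D0 pD; have [t [z [_ tinj tex]]] := embeddings f.
have [a [b [ab cong]]] := congruent_embeddings tinj D0 pD.
have [h hH hB] := lift_congruence cong.
have gE x : ((t a)^-1 * h * t b)%g x = t b (h ((t a)^-1%g x)) by rewrite !galMf.
exists ((t a)^-1 * h * t b)%g, (t a); split.
  apply: inertia_of_conj_integral => x xB; rewrite gE absB //.
  have := hB ((t a)^-1%g x); rewrite -(galMf (t a)^-1%g (t a)) mulVg gal_id; apply.
  exact: conj_integral_gal.
exists z; rewrite gE -(galMf (t a) (t a)^-1%g) mulgV gal_id.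
have -> : h (f z) = f z by apply: (mem_galP _ _ hH); apply/Ef; exists z.
by apply: contra ab => /eqP/esym/tinj->.
Qed.

End Ramified.

(** * Differences of relative conjugates *)

Section MovedConjugate.
Variables (R : realType) (M : splittingFieldType rat) (p : nat) (w : M -> R).
Variables (E0 K E1 : {subfield M}) (alpha : M) (g s0 : gal_of {:M}).
Hypotheses (pw : place_over (Some p) w) (ig : inertia w g).
Hypotheses (E0K : (E0 <= K)%VS) (E0E1 : (E0 <= E1)%VS).
Hypothesis dimE1 : (\dim E1 <= 3 * \dim E0)%N.
Hypotheses (aK : alpha \notin K) (aKE : alpha \in (K * E1)%VS).
Hypothesis splitK : forall v : M -> R, place_over (Some p) v -> splits_at v K.
Hypothesis moved : exists2 x, x \in E1 & g (s0 x) != s0 x.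

Implicit Types (s h : gal_of {:M}) (x y : M).

(** The conjugate of [g] by [s] is inertia for the place [w \o s], where [K] splits as well. *)
Lemma inertia_fixes_conj s x : x \in K -> g (s x) = s x.
Proof.
move=> xK; have pws := place_over_gal s pw; have [aws _ _] := pws.
have := inertia_fixes aws (place_over_ultrametric pws) (splitK pws) (g := (s * g * s^-1)%g).
move=> /(_ _ x xK) h; have {h} : (s * g * s^-1)%g x = x.
  apply: h => y y1; have e : s ((s * g * s^-1)%g y) = g (s y) by rewrite -galMf mulgKV galMf.
  have e' : s ((s * g * s^-1)%g y - y) = g (s y) - s y by rewrite -e; apply: rmorphB.
  by rewrite /= e'; apply: ig.
by move/(congr1 s); rewrite -galMf mulgKV galMf.
Qed.

Lemma inertia_fixes_adjoin s y x : g (s y) = s y -> x \in <<K; y>>%VS -> g (s x) = s x.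
Proof.
move=> gy /Fadjoin_polyP[P /polyOverP PK ->].
rewrite !horner_coef !rmorph_sum; apply: eq_bigr => i _.
rewrite !rmorphM !rmorphXn /=; congr (_ * _); first exact: inertia_fixes_conj.
by congr (_ ^+ _).
Qed.

(* Otherwise [g] fixes the conjugates over [K] of a generator [theta] of [E1] over [E0]; as
   [theta] has degree at most 3 over [E0], at most one of its other conjugates over [E0]
   remains, and it is fixed as well. *)
Lemma inertia_moves_conjugate s : {in E0, forall x, s x = s0 x} ->
  exists2 h, h \in 'Gal({:M} / K)%g & g (s (h alpha)) != s (h alpha).
Proof.
move=> ss0; apply: contrapT => no.
have fixa h : h \in 'Gal({:M} / K)%g -> g (s (h alpha)) = s (h alpha).
  by move=> hK; apply/eqP; apply: contrapT => /negP ne; apply: no; exists h.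
have [theta tE] := primitive_element E0E1.
have tE1 : theta \in E1 by rewrite -tE memv_adjoin.
pose d := adjoin_degree K theta; pose d0 := adjoin_degree E0 theta.
have k0 : (0 < \dim K)%N by rewrite adim_gt0.
have d03 : (d0 <= 3)%N.
  by rewrite -(leq_pmul2r (adim_gt0 E0)) -dim_Fadjoin tE.
have mdvd : minPoly K theta %| minPoly E0 theta by apply: minPolyS.
have dd0 : (d <= d0)%N.
  by have := dvdp_leq (monic_neq0 (monic_minPoly E0 theta)) mdvd; rewrite !size_minPoly ltnS.
have KE : (K * E1 <= <<K; theta>>)%VS.
  apply: prodv_sub; first exact: subv_adjoin.
  by rewrite -tE; apply/FadjoinP; split; [apply: subv_trans E0K (subv_adjoin _ _)|apply: memv_adjoin].
have aKt : alpha \in <<K; theta>>%VS by apply: (subvP KE).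
have Kat : (<<K; alpha>> <= <<K; theta>>)%VS by apply/FadjoinP; rewrite subv_adjoin.
have da1 : adjoin_degree K alpha != 1%N.
  apply: contra aK => /eqP e; have := dim_Fadjoin K alpha; rewrite e mul1n => ed.
  have /eqP -> : K == <<K; alpha>>%VS :> {vspace M} by rewrite eqEdim subv_adjoin ed /=.
  exact: memv_adjoin.
have dad : (adjoin_degree K alpha %| d)%N.
  by have := field_dimS Kat; rewrite !dim_Fadjoin dvdn_pmul2r.
(* [d] is 2 or 3, a prime, and the degree of [alpha] over [K] is a divisor of it other than 1: so
   [alpha] and [theta] generate the same field over [K]. *)
have [dd d2] : adjoin_degree K alpha = d /\ (1 < d)%N.
  have dgt0 : (0 < d)%N by rewrite /d adjoin_degreeE divn_gt0 // dimvS // subv_adjoin.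
  move: da1 dad (leq_trans dd0 d03) dgt0.
  move: (adjoin_degree K alpha) (d) => a [|[|[|[|d']]]] //= a1 ad _ _.
  - by move: ad; rewrite dvdn1 (negPf a1).
  - by split=> //; apply/(prime_nt_dvdP (isT : prime 2) a1).
  by split=> //; apply/(prime_nt_dvdP (isT : prime 3) a1).
have tKa : theta \in <<K; alpha>>%VS.
  have /eqP -> : <<K; alpha>>%VS == <<K; theta>>%VS :> {vspace M}.
    by rewrite eqEdim Kat !dim_Fadjoin dd /=.
  exact: memv_adjoin.
have fixt h : h \in 'Gal({:M} / K)%g -> g (s (h theta)) = s (h theta).
  move=> hK; have := @inertia_fixes_adjoin (h * s)%g alpha theta.
  by rewrite !galMf; apply => //; apply: fixa.
suff fixs0 : g (s0 theta) = s0 theta.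
  have [x xE1 /eqP] := moved; apply; apply: (@inertia_fixes_adjoin _ theta) => //.
  move: x xE1; apply/subvP; rewrite -tE; apply/FadjoinP.
  by split; [apply: subv_trans E0K (subv_adjoin _ _)|apply: memv_adjoin].
have fix_root y : y \in K -> root (minPoly E0 theta) y -> g (s0 theta) = s0 theta.
  move=> yK; have [r [rG _ -> _]] := minPoly_factors E0 theta.
  rewrite -(big_map (fun t : gal_of {:M} => t theta) xpredT (fun y => 'X - y%:P)).
  rewrite root_prod_XsubC => /mapP[t _ yE].
  have -> : s0 theta = (t^-1 * s0)%g y by rewrite galMf yE -(galMf t t^-1%g) mulgV gal_id.
  exact: inertia_fixes_conj.
case/dvdpP: (mdvd) => q qE.
have m0_neq0 : minPoly E0 theta != 0 by rewrite monic_neq0 ?monic_minPoly.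
have mK_neq0 : minPoly K theta != 0 by rewrite monic_neq0 ?monic_minPoly.
have q_neq0 : q != 0 by apply: contraNneq m0_neq0 => q0; rewrite qE q0 mul0r.
have sq : (size q + d = d0.+1)%N.
  have := size_mul q_neq0 mK_neq0; rewrite -qE !size_minPoly addnS /=.
  by rewrite -/d -/d0 => ->.
(* Since [d >= 2] and [d0 <= 3], the cofactor [q] is constant or linear. If constant, all conjugates
   of [theta] over [E0] are conjugates over [K]; if linear, its root lies in [K], whose conjugates
   [g] fixes. *)
have [q1|q2] : size q = 1%N \/ size q = 2%N.
  have q0 : (0 < size q)%N by rewrite size_poly_gt0.
  by move: sq q0 d2 d03; move: (size q) (d) (d0) => a b c; clear; lia.
  have m0K : minPoly E0 theta = minPoly K theta.
    apply/eqP; rewrite -eqp_monic ?monic_minPoly // eqp_sym -dvdp_size_eqp //.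
    by rewrite !size_minPoly -/d -/d0; move: sq; rewrite q1 add1n => ->.
  have tG : (s0 * s^-1)%g \in 'Gal({:M} / E0)%g.
    apply/mem_galP => x xE0; rewrite galMf -ss0 // -galMf mulgV gal_id //.
  have := root_minPoly_gal (subvf E0) tG (memvf theta).
  have [r [rG _ mE _]] := minPoly_factors K theta; rewrite m0K mE.
  rewrite -(big_map (fun t : gal_of {:M} => t theta) xpredT (fun y => 'X - y%:P)).
  rewrite root_prod_XsubC => /mapP[h hr hE].
  have -> : s0 theta = s (h theta) by rewrite -hE -galMf mulgKV.
  by apply: fixt; apply: rG.
have qK : q \is a polyOver K.
  have -> : q = minPoly E0 theta %/ minPoly K theta by rewrite qE mulpK.
  rewrite divp_polyOver ?minPolyOver //.
  by apply: polyOverSv (minPolyOver E0 theta).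
have q1 : q`_1 != 0 by have := lead_coef_eq0 q; rewrite lead_coefE q2 /= (negPf q_neq0) => ->.
apply: (@fix_root (- q`_0 / q`_1)).
  by rewrite rpred_div ?rpredN ?(polyOverP qK).
rewrite /root qE hornerM [q.[_]](_ : _ = 0) ?mul0r //.
rewrite horner_coef q2 !big_ord_recr big_ord0 /= add0r expr0 mulr1 expr1 mulrC divfK //.
by rewrite subrr.
Qed.

End MovedConjugate.

Lemma abs_sub_le_max (R : realType) (L : fieldExtType rat) (w : L -> R) x y : absolute_value w ->
  w (x - y) <= 2 * Num.max 1 (w x) * Num.max 1 (w y).
Proof.
move=> aw; have max1 (z : R) : 1 <= Num.max 1 z by rewrite le_max lexx.
have maxr (z : R) : z <= Num.max 1 z by rewrite le_max lexx orbT.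
have := abs_leD aw x (- y); rewrite absN // => h; apply: le_trans h _.
rewrite -mulrA mulr_natl mulr2n lerD //.
  by rewrite -[leLHS]mulr1 ler_pM ?abs_ge0.
by rewrite -[leLHS]mul1r ler_pM ?abs_ge0.
Qed.

Lemma ultra_sub_le_max (R : realType) (L : fieldExtType rat) (w : L -> R) x y :
  absolute_value w -> ultrametric w ->
  w (x - y) <= 1 * Num.max 1 (w x) * Num.max 1 (w y).
Proof.
move=> aw uw; have max1 (z : R) : 1 <= Num.max 1 z by rewrite le_max lexx.
have maxr (z : R) : z <= Num.max 1 z by rewrite le_max lexx orbT.
apply: le_trans (ultra_leB aw uw x y) _; rewrite mul1r ge_max; apply/andP; split.
  by rewrite -[leLHS]mulr1 ler_pM ?abs_ge0.
by rewrite -[leLHS]mul1r ler_pM ?abs_ge0.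
Qed.

(** Where [w x > 1], inertia is applied to the integral element [x^-1]. *)
Lemma inertia_lt (R : realType) (M : splittingFieldType rat) (w : M -> R) (g : gal_of {:M}) x :
  absolute_value w -> inertia w g ->
  w (x - g x) < Num.max 1 (w x) * Num.max 1 (w (g x)).
Proof.
move=> aw ig; have max1 (y : R) : 1 <= Num.max 1 y by rewrite le_max lexx.
have wC y z : w (y - z) = w (z - y) by rewrite -absN // opprB.
have [x1|x1] := leP (w x) 1.
  rewrite wC; apply: lt_le_trans (ig x x1) _.
  by rewrite -[leLHS]mulr1 ler_pM.
have x0 : x != 0 by apply: contraTneq x1 => ->; rewrite abs0 // -leNgt.
have gx0 : g x != 0 by rewrite fmorph_eq0.
have : w (g x^-1 - x^-1) < 1 by apply: ig; rewrite absV // invf_le1 ?ltW // (lt_trans _ x1).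
have -> : g x^-1 - x^-1 = (x - g x) / (x * g x).
  have -> : g x^-1 = (g x)^-1 by apply: fmorphV.
  by rewrite mulrBl invfM mulrA divff // mul1r mulrCA divff // mulr1.
have x00 : 0 < w (x * g x) by rewrite abs_gt0 // mulf_neq0.
rewrite absM // absV // ltr_pdivrMr // mul1r => lt; apply: lt_le_trans lt _.
by rewrite absM // ler_pM ?abs_ge0 // le_max lexx ?orbT.
Qed.

Lemma prod_lt (R : realType) (I : finType) (P : pred I) (F G : I -> R) i0 : P i0 ->
  (forall i, P i -> 0 <= F i <= G i) -> (forall i, P i -> 0 < G i) -> F i0 < G i0 ->
  \prod_(i | P i) F i < \prod_(i | P i) G i.
Proof.
move=> Pi0 FG G0 lt; rewrite (bigD1 i0) // [ltRHS](bigD1 i0) //=.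
apply: le_lt_trans (_ : F i0 * \prod_(i | P i && (i != i0)) G i < _).
  have /andP[F0 _] := FG i0 Pi0; rewrite ler_wpM2l //; apply: ler_prod => i /andP[Pi _].
  exact: FG.
rewrite ltr_pM2r //; apply: prodr_gt0 => i /andP[Pi _]; exact: G0.
Qed.

(** Each index lies in [2 * d.-1] of the [d * d.-1] ordered pairs. *)
Lemma prod_pairs (R : realType) d (C : R) (m : 'I_d -> R) :
  \prod_(i < d) \prod_(j < d | j != i) (C * m i * m j) =
  C ^+ (d * d.-1) * (\prod_i m i) ^+ (2 * d.-1).
Proof.
have cd (i : 'I_d) (y : R) : \prod_(j < d | j != i) y = y ^+ d.-1.
  by rewrite prodr_const (cardC1 i) card_ord.
have e (i : 'I_d) : \prod_(j < d | j != i) (C * m i * m j) =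
    C ^+ d.-1 * m i ^+ d.-1 * \prod_(j < d | j != i) m j.
  by rewrite -exprMn -(cd i) -big_split.
rewrite (eq_bigr _ (fun i _ => e i)).
rewrite !big_split /= prodr_const card_ord -exprM mulnC -mulrA; congr (_ * _).
rewrite (exchange_big_dep xpredT) //= mul2n -addnn exprD -prodrXl; congr (_ * _).
apply: eq_bigr => j _; rewrite -[RHS](cd j).
by apply: eq_bigl => i; rewrite eq_sym.
Qed.

(** * Absolute values of the discriminant of a relative minimal polynomial *)

Section RelativeDiscriminant.
Variables (R : realType) (M : splittingFieldType rat) (K : {subfield M}) (alpha : M).
Let d := adjoin_degree K alpha.

Lemma relative_conjugates : exists c : 'I_d -> M,
  [/\ injective c, minPoly K alpha = \prod_i ('X - (c i)%:P),
      forall i, exists2 h, h \in 'Gal({:M} / K)%g & c i = h alpha &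
      forall h, h \in 'Gal({:M} / K)%g -> exists i, h alpha = c i].
Proof.
have [r [rG ur mE rex]] := minPoly_factors K alpha.
have szr : size r = d.
  by have := size_minPoly K alpha; rewrite mE size_prod_XsubC => -[].
exists (fun i => nth 1%g r i alpha); split.
- move=> a b /eqP; rewrite -!(nth_map _ 0 (fun s : gal_of {:M} => s alpha)) ?szr ?ltn_ord //.
  by rewrite nth_uniq ?size_map ?szr ?ltn_ord // => /eqP/val_inj.
- by rewrite mE (big_nth 1%g) big_mkord szr.
- by move=> i; exists (nth 1%g r i) => //; apply/rG/mem_nth; rewrite szr.
move=> h /rex[t tr ->]; have ti : (index t r < d)%N by rewrite -szr index_mem.
by exists (Ordinal ti); rewrite /= nth_index.
Qed.

Variable c : 'I_d -> M.
Hypotheses (cinj : injective c) (cE : minPoly K alpha = \prod_i ('X - (c i)%:P)).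
Hypothesis cG : forall i, exists2 h, h \in 'Gal({:M} / K)%g & c i = h alpha.
Hypothesis Gc : forall h, h \in 'Gal({:M} / K)%g -> exists i, h alpha = c i.
Implicit Types (s h : gal_of {:M}) (w : M -> R).

(** Up to sign, the discriminant of the minimal polynomial of [alpha] over [K]. *)
Definition rel_disc : M := \prod_(i < d) \prod_(j < d | j != i) (c i - c j).

Lemma conj_permuted h : h \in 'Gal({:M} / K)%g -> exists2 pi : 'I_d -> 'I_d, injective pi &
  forall i, h (c i) = c (pi i).
Proof.
move=> hK; have /choice[pi hpi] i : exists j, h (c i) = c j.
  have [h' h'K ->] := cG i; have [|j hj] := Gc (h := (h' * h)%g); first by rewrite groupM.
  by exists j; rewrite -hj galMf.
exists pi => // i j ij; apply: cinj.
have e : h (c i) = h (c j) by rewrite !hpi ij.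
exact: fmorph_inj e.
Qed.

Lemma rel_disc_in : rel_disc \in K.
Proof.
apply: mem_galC => h hK; have [pi pinj hpi] := conj_permuted hK.
rewrite /rel_disc rmorph_prod [RHS](reindex_inj pinj) /=; apply: eq_bigr => i _.
rewrite rmorph_prod [RHS](reindex_inj pinj) /=.
apply: eq_big => [j|j _]; first by rewrite (inj_eq pinj).
by rewrite -!hpi; apply: rmorphB.
Qed.

Lemma rel_disc_neq0 : rel_disc != 0.
Proof.
apply/prodf_neq0 => i _; apply/prodf_neq0 => j ji.
by rewrite subr_eq0 (inj_eq cinj) eq_sym.
Qed.

(** A local Mahler measure of the minimal polynomial conjugated by [s]; for ultrametric [w] it is
    the Gauss norm. *)
Definition conj_prod w s : R := \prod_i Num.max 1 (w (s (c i))).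

Lemma conj_prod_ge1 w s : 1 <= conj_prod w s.
Proof.
rewrite /conj_prod; elim/big_ind: _ => // [x y x1 y1|i _]; last by rewrite le_max lexx.
by rewrite -[leLHS]mulr1 ler_pM.
Qed.

Let max1 (y : R) : 1 <= Num.max 1 y. Proof. by rewrite le_max lexx. Qed.

Lemma rel_disc_gal s : s rel_disc = \prod_(i < d) \prod_(j < d | j != i) (s (c i) - s (c j)).
Proof.
rewrite /rel_disc rmorph_prod; apply: eq_bigr => i _ /=.
by rewrite rmorph_prod; apply: eq_bigr => j _; apply: rmorphB.
Qed.

Lemma abs_rel_disc_le w s (C : R) : absolute_value w ->
  (forall x y, w (x - y) <= C * Num.max 1 (w x) * Num.max 1 (w y)) ->
  w (s rel_disc) <= C ^+ (d * d.-1) * conj_prod w s ^+ (2 * d.-1).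
Proof.
move=> aw hC; rewrite rel_disc_gal -prod_pairs abs_prod //.
apply: ler_prod => i _; rewrite abs_ge0 // abs_prod //.
by apply: ler_prod => j _; rewrite abs_ge0 //=.
Qed.

Lemma prod_conj_prod w : \prod_s conj_prod w s = conj_height w alpha ^+ d.
Proof.
rewrite /conj_prod exchange_big /= -[d in RHS]card_ord -prodr_const; apply: eq_bigr => i _.
have [h _ ->] := cG i; rewrite /conj_height [RHS](reindex_inj (mulgI h)) /=.
by apply: eq_bigr => s _; rewrite galMf.
Qed.

(** The Gauss norm is the absolute value of some coefficient, and coefficients lie in [K]: one can
    divide by it without leaving [K]. *)
Lemma conj_prod_attained p w s : place_over (Some p) w -> exists2 k, k \in K & w (s k) = conj_prod w s.
Proof.
move=> pw; have [aw _ _] := pw; have uw := place_over_ultrametric pw.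
have [k [kE _]] := gnorm_attained aw (map_poly s (minPoly K alpha)).
exists (minPoly K alpha)`_k; first exact: (polyOverP (minPolyOver K alpha)).
move: kE; rewrite coef_map /= => ->.
rewrite cE rmorph_prod gnorm_prod //; apply: eq_bigr => i _.
by rewrite rmorphB /= map_polyX map_polyC gnorm_XsubC.
Qed.

(* If the coefficient [k] of the minimal polynomial has the largest absolute value, then
   [rel_disc / k ^+ (2 * d.-1)] is an element of [K] of absolute value less than 1, hence at
   most [1 / p] as [K] is unramified. *)
Lemma abs_rel_disc_ramified p w s i j : place_over (Some p) w ->
  (forall v : M -> R, place_over (Some p) v -> splits_at v K) -> j != i ->
  w (s (c i) - s (c j)) < Num.max 1 (w (s (c i))) * Num.max 1 (w (s (c j))) ->
  w (s rel_disc) <= p%:R^-1 * conj_prod w s ^+ (2 * d.-1).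
Proof.
move=> pw splitK ji lt; have [aw pp _] := pw; have uw := place_over_ultrametric pw.
have le1 x y : w (x - y) <= Num.max 1 (w x) * Num.max 1 (w y).
  by have := ultra_sub_le_max x y aw uw; rewrite mul1r.
have gt0 (y : R) : 0 < Num.max 1 y by apply: lt_le_trans (max1 y).
have strict : w (s rel_disc) < conj_prod w s ^+ (2 * d.-1).
  have := prod_pairs 1 (fun i => Num.max 1 (w (s (c i)))); rewrite expr1n mul1r => <-.
  rewrite rel_disc_gal abs_prod //; apply: (@prod_lt _ _ _ _ _ i) => //= [k _|k _|].
  - rewrite abs_ge0 // abs_prod //=; apply: ler_prod => l _.
    by rewrite abs_ge0 //= mul1r.
  - by apply: prodr_gt0 => l _; rewrite mul1r mulr_gt0.
  rewrite abs_prod //; apply: (@prod_lt _ _ _ _ _ j) => //= [k _|k _|].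
  - by rewrite abs_ge0 //= mul1r.
  - by rewrite mul1r mulr_gt0.
  by rewrite mul1r.
have [k kK kE] := conj_prod_attained s pw.
have c0 : 0 < conj_prod w s by apply: lt_le_trans (conj_prod_ge1 w s).
have pws := place_over_gal s pw.
have : (w \o s) (rel_disc / k ^+ (2 * d.-1)) <= p%:R^-1.
  apply: (splits_at_discrete pws (splitK _ pws)).
    by rewrite rpred_div ?rpredX // rel_disc_in.
  have [aws _ _] := pws; rewrite absM // absV // absX //= kE ltr_pdivrMr ?mul1r //.
  exact: exprn_gt0.
have [aws _ _] := pws; rewrite absM // absV // absX //= kE ler_pdivrMr //.
exact: exprn_gt0.
Qed.

End RelativeDiscriminant.

(** * The bound on a newly ramified prime *)

Section KeyInequality.
Variables (R : realType) (M : splittingFieldType rat) (p : nat).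
Variables (E0 K E1 : {subfield M}) (alpha : M).
Hypotheses (pp : prime p) (E0K : (E0 <= K)%VS) (E0E1 : (E0 <= E1)%VS).
Hypothesis dimE1 : (\dim E1 <= 3 * \dim E0)%N.
Hypotheses (aK : alpha \notin K) (aKE : alpha \in (K * E1)%VS).
Hypothesis splitK : forall w : M -> R, place_over (Some p) w -> splits_at w K.
Hypothesis ramE1 : forall w : M -> R, place_over (Some p) w ->
  exists g s0 : gal_of {:M}, inertia w g /\ exists2 x, x \in E1 & g (s0 x) != s0 x.

Let d := adjoin_degree K alpha.
Let N := #|{: gal_of {:M}}|.
Implicit Types (s g h : gal_of {:M}) (w : M -> R).

Lemma adjoin_degree_prodv_le3 : (d <= 3)%N.
Proof.
have [theta tE] := primitive_element E0E1.
have KE : (K * E1 <= <<K; theta>>)%VS.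
  apply: prodv_sub; first exact: subv_adjoin.
  by rewrite -tE; apply/FadjoinP; split; [apply: subv_trans E0K (subv_adjoin _ _)|apply: memv_adjoin].
have Kat : (<<K; alpha>> <= <<K; theta>>)%VS by apply/FadjoinP; rewrite subv_adjoin (subvP KE).
have dK : (d <= adjoin_degree K theta)%N.
  by rewrite -(leq_pmul2r (adim_gt0 K)) -!dim_Fadjoin dimvS.
apply: leq_trans dK _; have d03 : (adjoin_degree E0 theta <= 3)%N.
  by rewrite -(leq_pmul2r (adim_gt0 E0)) -dim_Fadjoin tE.
apply: leq_trans d03; have mdvd : minPoly K theta %| minPoly E0 theta by apply: minPolyS.
by have := dvdp_leq (monic_neq0 (monic_minPoly E0 theta)) mdvd; rewrite !size_minPoly ltnS.
Qed.

Section Conjugates.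
Variable c : 'I_d -> M.
Hypotheses (cinj : injective c) (cE : minPoly K alpha = \prod_i ('X - (c i)%:P)).
Hypothesis cG : forall i, exists2 h, h \in 'Gal({:M} / K)%g & c i = h alpha.
Hypothesis Gc : forall h, h \in 'Gal({:M} / K)%g -> exists i, h alpha = c i.

Definition rel_disc_norm : M := \prod_(s : gal_of {:M}) s (rel_disc c).

Lemma abs_rel_disc_norm_le w (C : R) : absolute_value w -> 0 <= C ->
  (forall x y, w (x - y) <= C * Num.max 1 (w x) * Num.max 1 (w y)) ->
  w rel_disc_norm <= C ^+ (d * d.-1 * N) * conj_height w alpha ^+ (d * (2 * d.-1)).
Proof.
move=> aw C0 hC; rewrite abs_prod // (exprM _ d) -(prod_conj_prod cG) -prodrXl.
rewrite exprM -prodr_const -big_split /=; apply: ler_prod => s _.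
by rewrite abs_ge0 // abs_rel_disc_le.
Qed.

(** The conjugate of [g] by [s] fixes [K], so [g] carries the moved [s (c i)] to another [s (c j)];
    by inertia their difference stays strictly below the trivial bound. *)
Lemma abs_rel_disc_moved w g s0 s : place_over (Some p) w -> inertia w g ->
  (exists2 x, x \in E1 & g (s0 x) != s0 x) -> {in E0, forall x, s x = s0 x} ->
  w (s (rel_disc c)) <= p%:R^-1 * conj_prod c w s ^+ (2 * d.-1).
Proof.
move=> pw ig moved ss0; have [aw _ _] := pw.
have [h hK hne] := inertia_moves_conjugate pw ig E0K E0E1 dimE1 aK aKE splitK moved ss0.
have [i hi] := Gc hK.
have gK : (s * g * s^-1)%g \in 'Gal({:M} / K)%g.
  apply/mem_galP => x xK; rewrite !galMf (inertia_fixes_conj pw ig splitK) //.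
  by rewrite -galMf mulgV gal_id.
have [pi _ hpi] := conj_permuted cinj cG Gc gK.
have gE : g (s (c i)) = s (c (pi i)) by rewrite -hpi -(galMf (s * g * s^-1)%g s) mulgKV galMf.
apply: (abs_rel_disc_ramified cinj cE cG Gc (i := i) (j := pi i)) => //.
  by apply: contraNneq hne => e; rewrite hi gE e.
by rewrite -gE; apply: inertia_lt.
Qed.

(** The gain occurs for every automorphism agreeing with [s0] on [E0]; shifting by [s0] turns this
    coset into the Galois group of [M] over [E0]. *)
Lemma abs_rel_disc_norm_ramified w : place_over (Some p) w ->
  w rel_disc_norm <=
  p%:R^-1 ^+ #|'Gal({:M} / E0)%g| * conj_height w alpha ^+ (d * (2 * d.-1)).
Proof.
move=> pw; have [aw _ _] := pw; have uw := place_over_ultrametric pw.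
have [g [s0 [ig moved]]] := ramE1 pw.
rewrite abs_prod // (exprM _ d) -(prod_conj_prod cG) -prodrXl.
rewrite (reindex_inj (mulIg s0)) [X in _ * X](reindex_inj (mulIg s0)) /=.
rewrite -prodr_const [X in X * _]big_mkcond -big_split /=; apply: ler_prod => s _.
rewrite abs_ge0 //=; case: ifP => sE0.
  apply: (abs_rel_disc_moved pw ig moved) => x xE0; rewrite galMf; congr (s0 _).
  by apply: (mem_galP _ _ sE0).
have := abs_rel_disc_le c (s * s0)%g aw (fun x y => ultra_sub_le_max x y aw uw).
by rewrite expr1n.
Qed.

End Conjugates.

(** The product formula for the rational [q], the norm of [rel_disc], is compared with the bounds
    place by place: constant 2 at the archimedean place, the gain at [p], constant 1 at the other
    primes. *)
Lemma ramified_prime_le (X : R) : 1 <= X ->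
  (forall us (w : option nat -> M -> R), uniq us -> (forall u, u \in us -> place_over u (w u)) ->
    \prod_(u <- us) conj_height (w u) alpha <= X ^+ N) ->
  p%:R <= (2 ^+ 6 * X ^+ 12) ^+ \dim E0.
Proof.
move=> X1 hX; have [c [cinj cE cG Gc]] := relative_conjugates K alpha.
have [q qE] : exists q : rat, rel_disc_norm c = q%:A.
  by apply: gal_fixed_rat => t; apply: gal_prod_fixed.
have q0 : q != 0.
  apply: contraTneq (rel_disc_neq0 cinj) => q0; move: qE; rewrite q0 scale0r => /eqP.
  by rewrite /rel_disc_norm prodf_seq_eq0 => /hasP[s _ /=]; rewrite fmorph_eq0 negbK.
(* [p] is listed apart from [S], and its factor is kept even when it does not divide [q]. *)
pose S := [seq x <- primes (`|numq q| * `|denq q|) | x != p].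
have [w pw] := exists_places_over R M.
have primeS : all prime S by apply/allP => x; rewrite mem_filter mem_primes => /and3P[].
have pwS : forall u, u \in None :: Some p :: map Some S -> place_over u (w u).
  move=> u us; apply: pw; move: us; rewrite !inE => /or3P[/eqP->|/eqP->|/mapP[x xS ->]] //=.
  exact: (allP primeS).
have uniqS : uniq (p :: S) by rewrite /= mem_filter eqxx filter_uniq ?primes_uniq.
have prodw : \prod_(u <- None :: Some p :: map Some S) w u (rel_disc_norm c) = 1.
  rewrite -[RHS](rat_product_formula R q0 uniqS) /= ?pp //; last first.
    by move=> x xP; rewrite inE mem_filter xP andbT orbN.
  rewrite qE !big_cons big_map; have ev u : u \in None :: Some p :: map Some S ->
    w u q%:A = usual_abs R u q by move=> /pwS[_ _ ->].
  rewrite ev ?inE // ev ?inE ?eqxx ?orbT //; congr (_ * (_ * _)).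
  by apply: eq_big_seq => x xS; rewrite ev // !inE map_f // !orbT.
have uniqU : uniq (None :: Some p :: map Some S).
  rewrite -[None :: _](_ : None :: map Some (p :: S) = _) // cons_uniq map_inj_uniq ?uniqS ?andbT.
    by apply/mapP => -[].
  by move=> x y [].
have := hX _ w uniqU pwS; set e := (d * (2 * d.-1))%N; set G := #|'Gal({:M} / E0)%g|.
pose H u := conj_height (w u) alpha => hH.
have H1 u : 1 <= H u.
  rewrite /H /conj_height; elim/big_ind: _ => // [x y x1 y1|i _]; last by rewrite le_max lexx.
  by rewrite -[leLHS]mulr1 ler_pM.
have pG0 : 0 < p%:R ^+ G :> R by rewrite exprn_gt0 // ltr0n prime_gt0.
have bound : p%:R ^+ G <= (2 ^+ (d * d.-1) * X ^+ e) ^+ N.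
  rewrite exprMn -!exprM mulrC -[leLHS]mul1r -ler_pdivlMr // -[leLHS]prodw mulrC.
  apply: le_trans (_ : p%:R ^- G * (2 ^+ (d * d.-1 * N) *
     (\prod_(u <- None :: Some p :: map Some S) H u) ^+ e) <= _); last first.
    rewrite [leRHS]mulrC ler_wpM2l ?invr_ge0 ?(ltW pG0) // ler_wpM2l ?exprn_ge0 //.
    rewrite mulnC exprM lerXn2r // nnegrE; last by rewrite exprn_ge0 ?(le_trans ler01 X1).
    by apply: prodr_ge0 => u _; apply: le_trans (H1 u).
  rewrite -prodrXl !big_cons.
  have -> (a b x y z : R) : a * (b * (x * (y * z))) = (b * x) * ((a * y) * z) by ring.
  have wn u : u \in None :: Some p :: map Some S -> 0 <= w u (rel_disc_norm c).
    by case/pwS => aw _ _; rewrite abs_ge0.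
  have wS : forall u, u \in map Some S -> w u (rel_disc_norm c) <= H u ^+ e.
    move=> u us; have := pwS u; rewrite !inE us !orbT => /(_ isT).
    case: u us => [p' us pw'|/mapP[] //]; have [aw _ _] := pw'.
    have uw := place_over_ultrametric pw'.
    have := abs_rel_disc_norm_le cG aw ler01 (fun x y => ultra_sub_le_max x y aw uw).
    by rewrite expr1n mul1r.
  rewrite ler_pM ?mulr_ge0 ?wn ?inE ?eqxx ?orbT //.
  - rewrite big_seq; apply: prodr_ge0 => u us; by rewrite wn // !inE us !orbT.
  - have [aw _ _] := pwS None (mem_head _ _).
    by apply: abs_rel_disc_norm_le => // x y; apply: abs_sub_le_max.
  apply: ler_pM; rewrite ?wn ?inE ?eqxx ?orbT //.
  - rewrite big_seq; apply: prodr_ge0 => u us; by rewrite wn // !inE us !orbT.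
  - by rewrite -exprVn; apply: (abs_rel_disc_norm_ramified cinj cE cG Gc); apply: pw.
  rewrite big_seq [leRHS]big_seq; apply: ler_prod => u us.
  by rewrite wn ?wS // !inE us !orbT.
(* The gain has exponent [G] and the bound exponent [N]; taking G-th roots leaves the degree of
   [E0]. *)
have NG : N = (\dim E0 * G)%N.
  rewrite /G mulnC -(galois_dim (galois_full E0)) -dim_sup_field ?subvf //.
  have -> : \dim {:M} = #|'Gal({:M} / 1%AS)%g|.
    by rewrite -(galois_dim (galois_full 1%AS)) dimv1 divn1.
  apply: eq_card => s; rewrite inE; apply/esym/mem_galP => x /vlineP[q' ->]; exact: gal_ratA.
have d3 := adjoin_degree_prodv_le3.
have e6 : (d * d.-1 <= 6)%N by move: d3; case: (d) => [|[|[|[]]]].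
have e12 : (e <= 12)%N by rewrite /e; move: d3; case: (d) => [|[|[|[]]]].
have G0 : (0 < G)%N by rewrite cardG_gt0.
rewrite -(ler_pXn2r G0) ?nnegrE ?exprn_ge0 ?mulr_ge0 ?exprn_ge0 ?(le_trans ler01 X1) //.
apply: le_trans bound _; rewrite NG (exprM _ (\dim E0) G) lerXn2r ?nnegrE ?exprn_ge0 ?mulr_ge0 ?exprn_ge0
  ?(le_trans ler01 X1) // lerXn2r ?nnegrE ?mulr_ge0 ?exprn_ge0 ?(le_trans ler01 X1) //.
by rewrite ler_pM ?exprn_ge0 ?(le_trans ler01 X1) // ler_weXn2l // ler1n.
Qed.

End KeyInequality.

(** * Bounded height and degree *)

Lemma finite_roots_bounded_poly (B D : nat) :
  finite_set [set alpha : algC | exists P : {poly rat},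
    [/\ P != 0, (size P <= B)%N,
        forall i, (`|numq P`_i| <= D)%N /\ (`|denq P`_i| <= D)%N &
        root (map_poly ratr P) alpha]].
Proof.
pose zs := [seq n%:Z | n <- iota 0 D.+1] ++ [seq - n%:Z | n <- iota 0 D.+1].
have zsP (z : int) : (`|z| <= D)%N -> z \in zs.
  rewrite mem_cat => zD; case: z zD => n nD; apply/orP; [left|right]; apply/mapP.
    by exists n; rewrite // mem_iota.
  by exists n.+1; rewrite ?NegzE // mem_iota.
pose qs : seq rat := [seq n%:~R / m%:~R | n <- zs, m <- zs].
have qsP (q : rat) : (`|numq q| <= D)%N -> (`|denq q| <= D)%N -> q \in qs.
  by move=> nD dD; apply/allpairsP; exists (numq q, denq q); rewrite !zsP //= divq_num_den.
(* The index type is ['I_B.+1] so that [inord] makes sense even for [B = 0]. *)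
pose ps : seq {poly rat} :=
  [seq \poly_(i < B) nth 0 qs (f (inord i)) | f : {ffun 'I_B.+1 -> 'I_(size qs)}].
pose rts (P : {poly rat}) := sval (closed_field_poly_normal (map_poly (ratr : rat -> algC) P)).
apply: sub_finite_set (finite_seq (flatten [seq rts P | P <- ps])).
move=> a [P [P0 PB PD Pa]] /=; apply/flatten_mapP; exists P; last first.
  move: Pa; rewrite /rts; case: closed_field_poly_normal => r /= {1}->.
  by rewrite rootZ ?lead_coef_eq0 ?map_poly_eq0 // root_prod_XsubC.
have qP i : P`_i \in qs by have [] := PD i; apply: qsP.
have qi (i : nat) : (index (P`_i)%R qs < size qs)%N by rewrite index_mem.
apply/mapP; exists [ffun i : 'I_B.+1 => Ordinal (qi i)].
  by rewrite mem_enum.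
apply/polyP => i; rewrite coef_poly; case: ltnP => iB.
  by rewrite ffunE /= inordK ?ltnS ?(ltnW iB) // nth_index.
by rewrite nth_default // (leq_trans PB).
Qed.

Lemma splitting_field_exists (s : seq algC) :
  exists (M : splittingFieldType rat) (psi : {rmorphism M -> algC}),
    forall a, a \in s -> exists y, a = psi y.
Proof.
pose p a := s2val (minCpolyP a).
have pE a : map_poly ratr (p a) = minCpoly a by rewrite /p; case: minCpolyP => q /= [].
pose rts a := sval (closed_field_poly_normal (minCpoly a)).
have rE a : minCpoly a = \prod_(z <- rts a) ('X - z%:P).
  rewrite /rts; case: closed_field_poly_normal => r /= {1}->.
  by rewrite (monicP (minCpoly_monic a)) scale1r.
have [Q [psi [s1 s1E s1gen]]] := num_field_exists (flatten [seq rts a | a <- s]).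
have splitQ : SplittingField.axiom Q.
  exists (\prod_(a <- s) map_poly (in_alg Q) (p a)).
    by apply: rpred_prod => a _; apply/polyOver1P; exists (p a).
  exists s1 => //; rewrite (_ : \prod_(a <- s) _ = \prod_(z <- s1) ('X - z%:P)) ?eqpxx //.
  apply: (map_poly_inj psi); rewrite !rmorph_prod /=.
  under [RHS]eq_bigr do rewrite rmorphB /= map_polyX map_polyC /=.
  rewrite -(big_map psi xpredT (fun z => 'X - z%:P)) s1E big_flatten big_map.
  apply: eq_bigr => a _; rewrite -rE -pE -map_poly_comp; apply: eq_map_poly => q /=.
  by rewrite rmorphZ_num rmorph1 mulr1.
pose M : splittingFieldType rat := HB.pack Q (FieldExt_isSplittingField.Build rat Q splitQ).
exists M, psi => a sa; have : a \in flatten [seq rts a | a <- s].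
  apply/flatten_mapP; exists a => //; rewrite -root_prod_XsubC -rE; exact: root_minCpoly.
by rewrite -s1E => /mapP[y _ ->]; exists y.
Qed.

Lemma common_splitting_field n (F : nat -> numField) :
  exists (M : splittingFieldType rat) (psi : {rmorphism M -> algC}),
    forall i, (i < n)%N -> exists f : {rmorphism F i -> M}, forall x, psi (f x) = nf_emb (F i) x.
Proof.
have [M [psi psiP]] := splitting_field_exists
  (flatten [seq [seq nf_emb (F i) x | x <- vbasis {:F i}] | i <- iota 0 n]).
exists M, psi => i ni; have inb j : exists y, nf_emb (F i) (vbasis {:F i})`_j = psi y.
  have [jn|jn] := ltnP j (size (vbasis {:F i})); last by exists 0; rewrite nth_default ?rmorph0.
  apply: psiP; apply/flatten_mapP; exists i; first by rewrite mem_iota.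
  by apply: map_f; apply: mem_nth.
have [y yE] := choice inb.
have /choice[f fE] x : exists z, nf_emb (F i) x = psi z.
  exists (\sum_j coord (vbasis {:F i}) j x *: y j).
  rewrite {1}(coord_vbasis (memvf x)) !rmorph_sum; apply: eq_bigr => j _ /=.
  by rewrite !rmorphZ_num yE.
have psiI := fmorph_inj psi.
have [a b||a b|g gE] := @exists_rmorphism (F i) M f.
- by apply: psiI; rewrite rmorphB -!fE rmorphB.
- by apply: psiI; rewrite rmorph1 -fE rmorph1.
- by apply: psiI; rewrite rmorphM -!fE rmorphM.
by exists g => x; rewrite gE fE.
Qed.

Lemma abs_coef_prod_XsubC_le (R : realType) (L : fieldExtType rat) (w : L -> R) (rs : seq L) k :
  absolute_value w ->
  w (\prod_(c <- rs) ('X - c%:P))`_k <= \prod_(c <- rs) (2 * Num.max 1 (w c)).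
Proof.
move=> aw; elim: rs k => [|c rs IH] k.
  by rewrite !big_nil coef1; case: eqP => _; rewrite ?abs1 ?abs0.
rewrite !big_cons; set P := \prod_(c <- rs) _; set B := \prod_(c <- rs) _.
have B0 : 0 <= B by apply: le_trans (abs_ge0 aw _) (IH 0%N).
have m0 : 0 <= Num.max 1 (w c) by rewrite le_max ler01.
rewrite mulrBl coefB mulrC coefMX coefCM.
have := abs_leD aw (if k == 0%N then 0 else P`_k.-1) (- (c * P`_k)).
rewrite absN // absM // => le; apply: le_trans le _.
rewrite -mulrA mulr_natl mulr2n lerD //.
  apply: le_trans (_ : B <= _); first by case: eqP => _; rewrite ?abs0 ?IH.
  by rewrite ler_peMl // le_max lexx.
by rewrite ler_pM ?abs_ge0 ?IH // le_max lexx orbT.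
Qed.

(** * Coefficients of minimal polynomials over Q *)

Section MinimalPolynomialHeight.
Variables (R : realType) (M : splittingFieldType rat) (alpha : M) (X : R).
Let d := adjoin_degree 1 alpha.
Let N := #|{: gal_of {:M}}|.
Hypothesis X1 : 1 <= X.
Hypothesis hX : forall us (w : option nat -> M -> R), uniq us ->
  (forall u, u \in us -> place_over u (w u)) ->
  \prod_(u <- us) conj_height (w u) alpha <= X ^+ N.

Lemma conj_prod_bound (c : 'I_d -> M) us (w : option nat -> M -> R) : injective c ->
  (forall i, exists2 h, h \in 'Gal({:M} / 1)%g & c i = h alpha) ->
  (forall h, h \in 'Gal({:M} / 1)%g -> exists i, h alpha = c i) ->
  uniq us -> (forall u, u \in us -> place_over u (w u)) ->
  \prod_(u <- us) conj_prod c (w u) 1%g <= X ^+ d.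
Proof.
move=> cinj cG Gc uus pw.
have N0 : (0 < N)%N by apply/card_gt0P; exists 1%g.
have cp0 (v : M -> R) s : 0 <= conj_prod c v s by apply: le_trans (conj_prod_ge1 c v s).
rewrite -(ler_pXn2r N0) ?nnegrE ?prodr_ge0 ?exprn_ge0 ?(le_trans ler01 X1) //.
have -> : (\prod_(u <- us) conj_prod c (w u) 1%g) ^+ N = (\prod_(u <- us) conj_height (w u) alpha) ^+ d.
  rewrite -!prodrXl; apply: eq_bigr => u _; rewrite -(prod_conj_prod cG) -prodr_const.
  apply: eq_bigr => s _; have s1 : s \in 'Gal({:M} / 1%AS)%g.
    by apply/mem_galP => x /vlineP[q ->]; exact: gal_ratA.
  have [pi pinj hpi] := conj_permuted cinj cG Gc s1.
  rewrite /conj_prod (reindex_inj pinj) /=; apply: eq_bigr => i _.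
  by rewrite gal_id hpi.
rewrite -exprM mulnC exprM lerXn2r ?nnegrE ?hX ?exprn_ge0 ?(le_trans ler01 X1) //.
by apply: prodr_ge0 => u _; apply: prodr_ge0 => s _; rewrite le_max ler01.
Qed.

(** The places over primes bound the denominator of a coefficient, and the archimedean one its
    absolute value; the product of the two bounds is one for the numerator. *)
Lemma bounded_minPoly : exists P : {poly rat}, minPoly 1 alpha = map_poly (in_alg M) P /\
  forall k, (`|numq P`_k|%N)%:R <= (2 * X ^+ 2) ^+ d :> R /\ (`|denq P`_k|%N)%:R <= (2 * X ^+ 2) ^+ d :> R.
Proof.
have /polyOver1P[P PE] := minPolyOver 1 alpha; exists P; split=> // k.
have [c [cinj cE cG Gc]] := relative_conjugates 1%AS alpha.
set q := P`_k; have qE : (minPoly 1 alpha)`_k = q%:A by rewrite PE coef_map.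
pose S := primes `|denq q|.
have [w pw] := exists_places_over R M.
have primeS : all prime S by apply/allP => x; rewrite mem_primes => /and3P[].
have pwS : forall u, u \in None :: map Some S -> place_over u (w u).
  move=> u us; apply: pw; move: us; rewrite inE => /orP[/eqP->|/mapP[x xS ->]] //=.
  exact: (allP primeS).
have uniqS : uniq (None :: map Some S).
  rewrite cons_uniq map_inj_uniq ?primes_uniq ?andbT; first by apply/mapP => -[].
  by move=> x y [].
have := conj_prod_bound cinj cG Gc uniqS pwS; pose Q u := conj_prod c (w u) 1%g.
have Q1 u : 1 <= Q u by apply: conj_prod_ge1.
have prod1 (us : seq (option nat)) : 1 <= \prod_(u <- us) Q u.
  elim/big_ind: _ => // x y x1 y1; by rewrite -[leLHS]mulr1 ler_pM.
rewrite big_cons -/(Q None) -[X in _ * X]/(\prod_(u <- map Some S) Q u) => le.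
have X0 : 0 <= X by apply: le_trans X1.
(* All factors are at least 1, so each part of the product inherits the bound on the whole. *)
have QN : Q None <= X ^+ d by apply: le_trans le; rewrite ler_peMr // (le_trans ler01).
have QS : \prod_(u <- map Some S) Q u <= X ^+ d.
  by apply: le_trans le; rewrite ler_peMl // (le_trans ler01).
have dq : (`|denq q|%N)%:R <= X ^+ d.
  apply: le_trans QS; rewrite big_map; apply: le_trans (denq_le_prod R _ primeS _) _ => //.
    exact: primes_uniq.
  rewrite big_seq [leRHS]big_seq; apply: ler_prod => p pS; rewrite le_max ler01 /= ge_max Q1 /=.
  have pwp : place_over (Some p) (w (Some p)) by apply: pwS; rewrite inE map_f ?orbT.
  have [aw _ wq] := pwp; have uw := place_over_ultrametric pwp.
  have := wq q; rewrite /usual_abs => <-; rewrite -qE.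
  apply: le_trans (gnorm_ge_coef aw _ _) _; rewrite cE gnorm_prod //.
  by apply: ler_prod => i _; rewrite gnorm_XsubC // le_max ler01 gal_id /=.
have nq : `|ratr q : R| <= 2 ^+ d * X ^+ d.
  have pwN : place_over None (w None) by apply: pwS; rewrite inE.
  have [aw _ wq] := pwN; have := wq q; rewrite /usual_abs => <-; rewrite -qE cE.
  rewrite -(big_map c xpredT (fun y => 'X - y%:P)).
  apply: le_trans (abs_coef_prod_XsubC_le _ _ aw) _; rewrite big_map big_split /=.
  rewrite prodr_const card_ord ler_wpM2l ?exprn_ge0 //; apply: le_trans QN.
  by apply: ler_prod => i _; rewrite le_max ler01 gal_id /=.
have nE : (`|numq q|%N)%:R = `|ratr q : R| * (`|denq q|%N)%:R.
  rewrite !natr_absz !intr_norm -normrM; congr `|_|.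
  by rewrite /ratr divfK // intr_eq0 denq_eq0.
have e2 : (2 * X ^+ 2) ^+ d = 2 ^+ d * X ^+ d * X ^+ d.
  by rewrite exprMn -exprM mulnC mulnS muln1 exprD mulrA.
have p1 : 1 <= 2 ^+ d * X ^+ d.
  by rewrite -[leLHS]mulr1 ler_pM // exprn_ege1 // ler1n.
split; first by rewrite nE e2 ler_pM.
by apply: le_trans dq _; rewrite e2 ler_peMl // exprn_ge0.
Qed.

End MinimalPolynomialHeight.

(** Northcott's theorem, phrased for any field and element representing [alpha], the form in which
    [height_witness] delivers a height. *)
Lemma northcott_bounded_degree (R : realType) (B : nat) (X : R) : 1 <= X ->
  finite_set [set alpha : algC | exists (F : numField) (x : F),
    [/\ nf_emb F x = alpha, field_height R x <= X & (size (minPoly 1 x) <= B.+1)%N]].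
Proof.
move=> X1; have [D Dle] : exists D : nat, (2 * X ^+ 2) ^+ B <= D%:R.
  exists (Num.bound ((2 * X ^+ 2) ^+ B)); apply/ltW/archi_boundP.
  by rewrite exprn_ge0 ?mulr_ge0 ?exprn_ge0 ?(le_trans ler01 X1).
apply: sub_finite_set (finite_roots_bounded_poly B.+1 D) => _ [F [x [<- hx szx]]].
have [M [psi psiP]] := common_splitting_field 1 (fun=> F).
have [f fE] := psiP 0%N isT.
have hX us (w : option nat -> M -> R) : uniq us -> (forall u, u \in us -> place_over u (w u)) ->
    \prod_(u <- us) conj_height (w u) (f x) <= X ^+ #|{: gal_of {:M}}|.
  exact: prod_conj_height_le_expr.
have [P [PE PB]] := bounded_minPoly X1 hX.
have szP : size P = size (minPoly 1 (f x)) by rewrite PE size_map_poly.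
have dB : (adjoin_degree 1 (f x) <= B)%N by rewrite -ltnS -size_minPoly minPoly_rmorph.
have leD : (2 * X ^+ 2) ^+ adjoin_degree 1 (f x) <= D%:R.
  apply: le_trans Dle; rewrite ler_weXn2l // -[leLHS]mulr1 ler_pM ?ler1n // exprn_ege1 //.
exists P; split.
- by rewrite -size_poly_gt0 szP size_minPoly.
- by rewrite szP minPoly_rmorph.
- by move=> i; have [nP dP] := PB i; rewrite -!(ler_nat R); split; apply: le_trans leD.
have : root (map_poly (in_alg M) P) (f x) by rewrite -PE root_minPoly.
rewrite -fE -(fmorph_root psi) -map_poly_comp; congr (root _ _); apply: eq_map_poly => q /=.
by rewrite rmorphZ_num rmorph1 mulr1.
Qed.

(** * Towers of subfields *)

Lemma injective_bounded (f : nat -> nat) D : injective f ->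
  exists m, forall n, (f n <= D)%N -> (n <= m)%N.
Proof.
move=> finj; elim: D => [|D [m hm]].
  have [[n fn]|no] := pselect (exists n, f n = 0%N).
    by exists n => k; rewrite leqn0 -fn => /eqP/finj->.
  by exists 0%N => k; rewrite leqn0 => /eqP fk; case: no; exists k.
have [[n fn]|no] := pselect (exists n, f n = D.+1).
  exists (maxn m n) => k; rewrite leq_eqVlt ltnS => /orP[/eqP|/hm km].
    by rewrite -fn => /finj->; rewrite leq_maxr.
  by rewrite leq_max km.
exists m => k; rewrite leq_eqVlt ltnS => /orP[/eqP fk|/hm //].
by case: no; exists k.
Qed.

Lemma is_subfieldP (S : set algC) : is_subfield S <->
  [/\ S 1, forall x y, S x -> S y -> S (x - y) & forall x y, S x -> S y -> S (x / y)].
Proof.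
split=> [[S1 SB SV]|[S1 SB SV]]; split=> [|x y|x y].
- by move: S1; rewrite inE.
- by move=> Sx Sy; have := SB x y; rewrite !inE; apply.
- by move=> Sx Sy; have := SV x y; rewrite !inE; apply.
- by rewrite inE.
- by rewrite !inE; apply: SB.
- by rewrite !inE; apply: SV.
Qed.

(** The elements with this property form a subfield containing every [F i]. *)
Lemma compositum_finite_level (F : nat -> numField) alpha : compositum F alpha ->
  exists m, forall S, is_subfield S -> (forall i, (i <= m)%N -> nf_set (F i) `<=` S) -> S alpha.
Proof.
pose A := [set a : algC | exists m, forall S, is_subfield S ->
  (forall i, (i <= m)%N -> nf_set (F i) `<=` S) -> S a].
apply: (_ : compositum F `<=` A); apply: smallest_sub; last first.
  by move=> a [i _ Fa]; exists i => S _ /(_ i (leqnn i)); apply.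
have op (g : algC -> algC -> algC) :
    (forall S, is_subfield S -> forall x y, S x -> S y -> S (g x y)) ->
    forall x y, A x -> A y -> A (g x y).
  move=> gS x y [m1 h1] [m2 h2]; exists (maxn m1 m2) => S sS FS; apply: gS => //.
    by apply: h1 => // i im; apply: FS; rewrite leq_max im.
  by apply: h2 => // i im; apply: FS; rewrite leq_max im orbT.
apply/is_subfieldP; split.
- by exists 0%N => S /is_subfieldP[].
- by apply: (op (fun x y => x - y)) => S /is_subfieldP[].
- by apply: (op (fun x y => x / y)) => S /is_subfieldP[].
Qed.

Fixpoint tower (M : splittingFieldType rat) (E : nat -> {subfield M}) k : {subfield M} :=
  if k is k'.+1 then (tower E k' * E k)%AS else E 0%N.

Section Tower.
Variables (R : realType) (F : nat -> numField) (M : splittingFieldType rat).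
Variables (psi : {rmorphism M -> algC}) (E : nat -> {subfield M}) (m : nat).
Hypothesis hext : forall i : nat, (0 < i)%N -> nf_set (F 0%N) `<=` nf_set (F i).
Hypothesis hdeg : forall i : nat, (0 < i)%N ->
  exists2 d : nat, (d <= 3)%N & has_degree (F 0%N) (F i) d.
Hypothesis EP : forall i, (i <= m)%N -> exists f : {rmorphism F i -> M},
  (forall x, psi (f x) = nf_emb (F i) x) /\ forall y, y \in E i <-> exists x, y = f x.

Lemma sub_tower i k : (i <= k)%N -> (E i <= tower E k)%VS.
Proof.
elim: k => [|k IH]; first by rewrite leqn0 => /eqP->.
rewrite leq_eqVlt ltnS => /orP[/eqP->|/IH Ek]; first exact: field_subvMl.
by apply: subv_trans Ek _; apply: field_subvMr.
Qed.

Lemma mem_tower alpha :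
  (forall S, is_subfield S -> (forall i, (i <= m)%N -> nf_set (F i) `<=` S) -> S alpha) ->
  exists2 y, y \in tower E m & psi y = alpha.
Proof.
move=> h; suff [y yK <-] : [set psi y | y in [set y : M | y \in tower E m]] alpha by exists y.
apply: h => [|i im _ [x _ <-]].
  apply/is_subfieldP; split.
  - by exists 1; rewrite ?rmorph1 //=; apply: mem1v.
  - by move=> _ _ [x xK <-] [y yK <-]; exists (x - y); rewrite ?rmorphB //=; apply: rpredB.
  - by move=> _ _ [x xK <-] [y yK <-]; exists (x / y); rewrite ?fmorph_div //=; apply: rpred_div.
have [f [fE Ef]] := EP im; exists (f x) => //=.
by apply: (subvP (sub_tower im)); apply/Ef; exists x.
Qed.

Lemma dim_image_le i : (i <= m)%N -> (\dim (E i) <= \dim {:F i})%N.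
Proof.
move=> im; have [f [_ Ef]] := EP im.
pose b := [seq f x | x <- vbasis {:F i}].
suff /dimvS h : (E i <= <<b>>)%VS.
  by apply: leq_trans h (leq_trans (dim_span _) _); rewrite size_map size_tuple.
apply/subvP => y /Ef[x ->]; rewrite (coord_vbasis (memvf x)) rmorph_sum.
apply: rpred_sum => j _ /=; rewrite rmorph_ratZ rpredZ // memv_span //.
by apply: map_f; rewrite mem_nth // size_tuple.
Qed.

Lemma dim_tower_le k : (k <= m)%N -> (\dim (tower E k) <= \prod_(i < k.+1) \dim {:F i})%N.
Proof.
elim: k => [|k IH] km; first by rewrite big_ord1 dim_image_le.
rewrite big_ord_recr /=; apply: leq_trans (dim_prodv _ _) _.
by rewrite leq_mul ?dim_image_le ?IH // ltnW.
Qed.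

Lemma base_sub i : (i <= m)%N -> (E 0%N <= E i)%VS.
Proof.
case: i => [|i] im; first exact: subvv.
have [f [fE Ef]] := EP im; have [f0 [f0E Ef0]] := EP (leq0n m).
apply/subvP => y /Ef0[x ->]; apply/Ef.
have [x' _ x'E] : nf_set (F i.+1) (nf_emb (F 0%N) x) by apply: hext => //; exists x.
by exists x'; apply: (fmorph_inj psi); rewrite fE f0E x'E.
Qed.

Lemma dim_le3 i : (0 < i <= m)%N -> (\dim (E i) <= 3 * \dim (E 0%N))%N.
Proof.
move=> /andP[i0 im]; have [f [fE Ef]] := EP im; have [f0 [f0E Ef0]] := EP (leq0n m).
have [d d3 [b bP]] := hdeg i0; pose v := [seq f (b j) | j : 'I_d].
suff /dimvS h : (E i <= E 0%N * <<v>>)%VS.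
  apply: leq_trans h (leq_trans (dim_prodv _ _) _); rewrite mulnC leq_mul2r; apply/orP; right.
  by apply: leq_trans (dim_span _) _; rewrite size_map -cardE card_ord.
apply/subvP => y /Ef[x ->]; have [c [cE _]] := bP x.
have -> : f x = \sum_(j < d) f0 (c j) * f (b j).
  apply: (fmorph_inj psi); rewrite fE cE rmorph_sum; apply: eq_bigr => j _ /=.
  by rewrite rmorphM /= f0E fE.
apply: rpred_sum => j _; apply: memv_mul; first by apply/Ef0; exists (c j).
by apply: memv_span; apply: map_f; rewrite mem_enum.
Qed.

Lemma tower_splits_at k p (w : M -> R) : place_over (Some p) w -> (k <= m)%N ->
  (forall j, (j <= k)%N -> ~~ (p%:Z %| discriminant (F j))%Z) -> splits_at w (tower E k).
Proof.
move=> pw km pD; have [aw _ _] := pw.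
have spl j : (j <= k)%N -> splits_at w (E j).
  move=> jk; have [f [_ Ef]] := EP (leq_trans jk km).
  exact: (unramified_splits_at pw Ef (pD j jk)).
(* Only the level of the tower becomes the induction variable; [k] stays as the bound for [spl]. *)
have {pD} : (k <= k)%N by []; move: {1 3}k => l.
elim: l => [|l IH] lk; first exact: spl.
by apply: splits_at_prodv => //; [apply/IH/ltnW | apply: spl].
Qed.

Lemma tower_prime_le n p (y : M) (X : R) : 1 <= X -> (n < m)%N ->
  (forall us (w : option nat -> M -> R), uniq us -> (forall u, u \in us -> place_over u (w u)) ->
    \prod_(u <- us) conj_height (w u) y <= X ^+ #|{: gal_of {:M}}|) ->
  y \notin tower E n -> y \in tower E n.+1 -> discriminant (F n.+1) != 0 ->
  prime p -> (p%:Z %| discriminant (F n.+1))%Z ->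
  (forall j, (j <= n)%N -> ~~ (p%:Z %| discriminant (F j))%Z) ->
  p%:R <= (2 ^+ 6 * X ^+ 12) ^+ \dim {:F 0%N}.
Proof.
move=> X1 nm hX yn yn1 D0 pp pD npD; have [f [_ Ef]] := EP nm.
have splt (w : M -> R) : place_over (Some p) w -> splits_at w (tower E n).
  by move=> pw; apply: tower_splits_at pw (ltnW nm) npD.
have ram (w : M -> R) : place_over (Some p) w ->
    exists g s0 : gal_of {:M}, inertia w g /\ exists2 x, x \in E n.+1 & g (s0 x) != s0 x.
  move=> pw; have [g [s [ig [x gx]]]] := ramified_inertia pw Ef D0 pD.
  by exists g, s; split=> //; exists (f x) => //; apply/Ef; exists x.
have E0n := sub_tower (leq0n n).
have := ramified_prime_le pp E0n (base_sub nm) (dim_le3 _) yn yn1 splt ram X1 hX.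
move=> /(_ nm) le; apply: le_trans le _; rewrite ler_weXn2l ?dim_image_le //.
by rewrite -[leLHS]mulr1 ler_pM ?exprn_ege1 // ler1n.
Qed.

End Tower.

(** [height] is the value computed in some field containing [alpha]; the rest of the argument runs
    with that field. *)
Lemma height_witness (R : realType) (alpha : algC) : exists (F : numField) (x : F),
  nf_emb F x = alpha /\ height R alpha = field_height R x.
Proof.
have [M [psi psiP]] := splitting_field_exists [:: alpha].
have [y yE] := psiP alpha (mem_head _ _).
pose G := NumField psi; have := @xgetPex _ (0 : R) [set h | exists (F : numField) (x : F),
  nf_emb F x = alpha /\ h = field_height R x].
case; first by exists (field_height R (y : G)), G, y; rewrite yE.
by move=> F [x xP]; exists F, x.
Qed.

Theorem corollary4 (R : realType) (F : nat -> numField)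
  (hext : forall i : nat, (0 < i)%N -> nf_set (F 0%N) `<=` nf_set (F i))
  (hdeg : forall i : nat, (0 < i)%N ->
    exists2 d : nat, (d <= 3)%N & has_degree (F 0%N) (F i) d)
  (hram : forall i : nat, (0 < i)%N -> exists p : nat,
    [/\ prime p, (p%:Z %| discriminant (F i))%Z &
      forall j : nat, (j < i)%N -> ~~ (p%:Z %| discriminant (F j))%Z]) :
  northcott R (compositum F).
Proof.
move=> X' _; pose X : R := Num.max 1 X'; have X1 : 1 <= X by rewrite le_max lexx.
(* The index is shifted: [pr i] divides the discriminant of [F i.+1] and governs the passage from
   level [i] to level [i.+1]. Not dividing the discriminants of earlier fields, it also shows them
   to be nonzero. *)
have /choice[pr prP] i := hram i.+1 isT.
have D0 i : discriminant (F i) != 0.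
  by have [_ _ /(_ i (leqnn _))] := prP i; apply: contraNneq => ->; rewrite dvdz0.
have prinj : injective pr.
  have lt i j : (i < j)%N -> pr i <> pr j.
    move=> ij e; have [_ di _] := prP i; have [_ _ /(_ i.+1 ij)] := prP j.
    by rewrite -e di.
  by move=> i j e; case: (ltngtP i j) => // /lt []; rewrite e.
pose Bd := (2 ^+ 6 * X ^+ 12) ^+ \dim {:F 0%N}.
have [m0 m0P] := injective_bounded (Num.bound Bd) prinj.
(* Beyond level [m0.+1] the primes exceed the bound, so the product of the degrees of the first
   [m0.+2] fields bounds the degree. *)
apply: sub_finite_set (northcott_bounded_degree (\prod_(i < m0.+2) \dim {:F i}) X1).
move=> alpha [/compositum_finite_level[m am] hX'].
have [F' [x [xE hE]]] := height_witness R alpha.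
(* Index 0 is taken by the field in which the height is computed and index [i.+1] by [F i], hence
   [m.+2] fields. *)
have [M [psi psiP]] := common_splitting_field m.+2 (fun i => if i is i'.+1 then F i' else F').
have [f fE] := psiP 0%N isT.
have hX : field_height R x <= X by rewrite -hE le_max hX' orbT.
exists F', x; split=> //.
have /choice[E EP] i : exists E : {subfield M}, (i <= m)%N -> exists f : {rmorphism F i -> M},
    (forall x, psi (f x) = nf_emb (F i) x) /\ forall y, y \in E <-> exists x, y = f x.
  have [im|im] := leqP i m; last by exists 1%AS.
  have [fi fiE] := psiP i.+1 im; have [Ei Eif] := image_subfield fi.
  by exists Ei => _; exists fi.
have [y yK yE] := mem_tower EP am.
have fxy : f x = y by apply: (fmorph_inj psi); rewrite fE yE.
have [n yn minn] := ex_minnP (ex_intro (fun n => y \in tower E n) m yK).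
have nm : (n <= m)%N by apply: minn.
have nm0 : (n <= m0.+1)%N.
  case: n yn minn nm => [//|n] yn minn nm; rewrite ltnS; apply: m0P.
  have [pp pD npD] := prP n.
  rewrite -(ler_nat R); apply: le_trans (ltW (archi_boundP _)); last first.
    by rewrite exprn_ge0 ?mulr_ge0 ?exprn_ge0 ?(le_trans ler01 X1).
  apply: (tower_prime_le hext hdeg EP X1 nm _ _ yn) => //; last first.
    by apply/negP => /minn; rewrite ltnn.
  by move=> us w uus pw; rewrite -fxy; apply: prod_conj_height_le_expr.
rewrite -(minPoly_rmorph f) fxy size_minPoly ltnS.
have dy : (adjoin_degree 1 y <= \dim (tower E n))%N.
  have := dim_Fadjoin 1%AS y; rewrite dimv1 muln1 => <-.
  by apply: dimvS; apply/FadjoinP; rewrite sub1v yn.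
apply: leq_trans dy (leq_trans (dim_tower_le EP nm) _).
(* The degree product up to level [n] is extended to [m0.+1], each further factor being positive. *)
rewrite -(subnKC (nm0 : n.+1 <= m0.+2)%N); elim: (m0.+2 - n.+1)%N => [|k IH]; first by rewrite addn0.
by rewrite addnS [leqRHS]big_ord_recr /=; apply: leq_trans IH (leq_pmulr _ (adim_gt0 _)).
Qed.
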